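(* Let $m\ge1$ and let $L\in C^2(\mathbb{R}^m\times\mathbb{R}^m,\mathbb{R})$ be such that for all $x,p\in\mathbb{R}^m$ $$|L(x,p)|\le C(1+|p|^2),\qquad |D_pL(x,p)|\le C(1+|p|)$$ for some constant $C>0$. For $u\in H^{\frac12}(\mathbb{S}^1,\mathbb{R}^m)$ set $E(u):=\int_{\mathbb{S}^1}L\left(u(x),(-\Delta)^{\frac14}u(x)\right)dx$. Let $X$ be a smooth vector field on $\mathbb{S}^1$ with flow $\phi_t$, and assume that for every $w\in H^{\frac12}(\mathbb{S}^1,\mathbb{R}^m)$ $$L\left(w\circ\phi_t(x),(-\Delta)^{\frac14}(w\circ\phi_t)(x)\right)=L\left(w(\phi_t(x)),\big((-\Delta)^{\frac14}w\big)(\phi_t(x))\right)\phi_t'(x)$$ for a.e. $x\in\mathbb{S}^1$ and for $t$ in a neighbourhood of $0$. Assume that $u\in H^{\frac12}(\mathbb{S}^1,\mathbb{R}^m)$ satisfies the stationarity equation $$\frac{d}{dx}\left[L\left(u,(-\Delta)^{\frac14}u\right)\right]X+\operatorname{div}_{\frac14}\left[D_pL\left(u(x),(-\Delta)^{\frac14}u(x)\right)\cdot u'(y)\right]X=0$$ in the sense of distributions. Then, in the sense of distributions, $$\frac{d}{dx}\left[L\left(u,(-\Delta)^{\frac14}u\right)X\right]+\operatorname{div}_{\frac14}\left[D_pL\left(u(x),(-\Delta)^{\frac14}u(x)\right)\cdot u'(y)X(y)\right]=0.$$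
   Context: $\mathbb{S}^1=\mathbb{R}/2\pi\mathbb{Z}$ is identified with $\partial D^2$ via $x\mapsto e^{ix}$; vector fields on $\mathbb{S}^1$ are identified with functions $X:\mathbb{S}^1\to\mathbb{R}$, and $\phi_t'$ is the $x$-derivative. $\mathscr{D}'(\mathbb{S}^1)$ is the dual of $C^\infty(\mathbb{S}^1)$, $\widehat f(k)=\frac1{2\pi}\langle f,e^{-ik\cdot}\rangle$, $\|f\|_{H^s}^2=\sum_k(1+k^2)^s|\widehat f(k)|^2$, $(-\Delta)^sf$ has Fourier coefficients $|k|^{2s}\widehat f(k)$, and $u'$ is the distributional derivative. A distribution $T$ times $X$ acts as $TX[\varphi]=T[X\varphi]$. $K^{\frac14}$ is the kernel of $(-\Delta)^{\frac14}$ on $\mathbb{S}^1$: the even function on $\mathbb{S}^1\setminus\{0\}$, bounded above and below by positive multiples of $|\sin(z/2)|^{-\frac32}$, such that $(-\Delta)^{\frac14}v(x)=\int_{\mathbb{S}^1}(v(x)-v(y))K^{\frac14}(x-y)dy$ for all $v\in C^\infty(\mathbb{S}^1)$. Fractional divergence: if one of $a,b:\mathbb{S}^1\to\mathbb{R}^m$ is in $L^2$ and the other one in the Lorentz space $L^{2,1}$, then $$\operatorname{div}_{\frac14}[a(x)\cdot b(y)][\varphi]=\int_{\mathbb{S}^1}\int_{\mathbb{S}^1}a(x)\cdot b(y)(\varphi(x)-\varphi(y))K^{\frac14}(x-y)\,dxdy,\quad\varphi\in C^\infty(\mathbb{S}^1),$$ which converges absolutely and is bounded by $C\big(|\widehat\varphi(0)|+\sum_{k\neq0}|k||\widehat\varphi(k)|\big)$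 times the $L^2$-norm of one factor times the $H^{-\frac12}$-norm of the other; hence it extends by continuity to the case where one of the factors is in $L^2$ and the other in $H^{-\frac12}(\mathbb{S}^1)$, which is the meaning used in the claim (where $u',\,u'X\in H^{-\frac12}$). *)

(* Defs.v *)
From HB Require Import structures.
From mathcomp Require Import all_boot all_order all_algebra.
From mathcomp Require Import all_classical all_reals all_analysis.
From mathcomp Require Import complex.

Set Implicit Arguments.
Unset Strict Implicit.
Unset Printing Implicit Defensive.

Import Order.TTheory GRing.Theory Num.Theory.
Import numFieldNormedType.Exports.

Local Open Scope classical_set_scope.
Local Open Scope ring_scope.

(* Functions on the circle S^1 = R / 2 pi Z are 2 pi-periodic functions on R,
   and integrals over S^1 are Lebesgue integrals over [0, 2 pi]. *)

Notation leb := (@lebesgue_measure _).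

Definition circ (R : realType) : set R := `[0, 2 * pi]%classic.
Arguments circ : clear implicits.

Definition periodic2pi (R : realType) (f : R -> R) : Prop :=
  forall x, f (x + 2 * pi) = f x.

Definition Cinf (R : realType) (f : R -> R) : Prop :=
  periodic2pi f /\ forall n x, derivable (derive1n n f) x 1.

(* On a finite-dimensional V, taking all directions v amounts to taking all
   partial derivatives. *)
Fixpoint Ck (R : realType) (V : normedModType R) (n : nat) (f : V -> R)
    : Prop :=
  continuous f /\
  (if n is k.+1 then
     forall v : V, (forall p, derivable f p v) /\ Ck k (fun p => 'D_v f p)
   else True).

(* The library norm on 'rV_m is the sup norm, hence these definitions. *)
Definition dotv (R : realType) (m : nat) (p q : 'rV[R]_m) : R :=
  \sum_(j < m) p 0 j * q 0 j.

Definition enorm (R : realType) (m : nat) (p : 'rV[R]_m) : R :=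
  Num.sqrt (dotv p p).

Definition compj (R : realType) (m : nat) (u : R -> 'rV[R]_m) (j : 'I_m)
    : R -> R := fun x => u x 0 j.

Definition L2 (R : realType) (f : R -> R) : Prop :=
  [/\ periodic2pi f, measurable_fun [set: R] f
    & leb.-integrable (circ R) (EFin \o (fun x => f x ^+ 2))].

(* Half of the usual Lorentz quasi-norm
   \int_0^oo t^(1/2) f^*(t) dt / t, written with the distribution function. *)
Definition L21norm (R : realType) (f : R -> R) : \bar R :=
  (\int[leb]_(t in `[0%R, +oo[)
     (leb (circ R `&` [set x | (t < `|f x|)%R]) `^ 2^-1))%E.

Definition L21 (R : realType) (f : R -> R) : Prop :=
  [/\ periodic2pi f, measurable_fun [set: R] f & (L21norm f < +oo)%E].

(* Real distributions on the circle; only the values on Cinf matter. *)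
Definition distr (R : realType) := (R -> R) -> R.

Definition distr_eq0 (R : realType) (T : distr R) : Prop :=
  forall phi, Cinf phi -> T phi = 0.

Definition distr_add (R : realType) (S T : distr R) : distr R :=
  fun phi => S phi + T phi.

Definition distr_sub (R : realType) (S T : distr R) : distr R :=
  fun phi => S phi - T phi.

Definition distr_mul (R : realType) (T : distr R) (X : R -> R) : distr R :=
  fun phi => T (fun x => X x * phi x).

Definition distr_deriv (R : realType) (T : distr R) : distr R :=
  fun phi => - T (derive1 phi).

Definition dist_of (R : realType) (f : R -> R) : distr R :=
  fun phi => \int[leb]_(x in circ R) (f x * phi x).

(* <T, e^{-ik.}> / (2 pi), where T acts on complex-valued functions by
   complex linearity. *)
Definition fourier (R : realType) (T : distr R) (k : int) : R[i] :=
  Complex (T (fun x => cos (k%:~R * x)) / (2 * pi))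
          (- T (fun x => sin (k%:~R * x)) / (2 * pi)).

Definition sqmodC (R : realType) (z : R[i]) : R :=
  complex.Re z ^+ 2 + complex.Im z ^+ 2.

Definition Hnorm2 (R : realType) (s : R) (T : distr R) : \bar R :=
  \esum_(k in [set: int])
    (((1 + (k%:~R : R) ^+ 2) `^ s * sqmodC (fourier T k))%:E).

Definition H12 (R : realType) (m : nat) (u : R -> 'rV[R]_m) : Prop :=
  forall j, L2 (compj u j) /\
    (Hnorm2 2^-1 (dist_of (compj u j)) < +oo)%E.

(* g is an L^2 representative of (-Delta)^s f.  For s <> 0 the k = 0
   coefficient of g is 0, because 0 `^ (2 * s) = 0. *)
Definition is_fraclap (R : realType) (s : R) (f g : R -> R) : Prop :=
  L2 g /\
  forall k : int, fourier (dist_of g) k =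
    Complex (`|(k%:~R : R)| `^ (2 * s)) 0 * fourier (dist_of f) k.

(* (-Delta)^s f, for those f for which it is an L^2 function (such as
   f \in H^{2s}); it is determined up to a null set, and one representative
   is chosen. *)
Definition fraclap (R : realType) (s : R) (f : R -> R) : R -> R :=
  xget (fun=> 0) [set g | is_fraclap s f g].

Definition fraclapv (R : realType) (m : nat) (s : R) (u : R -> 'rV[R]_m)
    : R -> 'rV[R]_m :=
  fun x => \row_(j < m) fraclap s (compj u j) x.

(* Only the values of K off 2 pi Z matter; these properties determine K up to
   a null set. *)
Definition is_K14 (R : realType) (K : R -> R) : Prop :=
  [/\ periodic2pi K /\ measurable_fun [set: R] K,
      forall z, K (- z) = K z,
      exists c1 c2 : R, [/\ 0 < c1, 0 < c2 &
        forall z, sin (z / 2) != 0 ->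
          c1 * `|sin (z / 2)| `^ (- (3 / 2)) <= K z
            <= c2 * `|sin (z / 2)| `^ (- (3 / 2))]
    & forall v, Cinf v ->
        is_fraclap 4^-1 v
          (fun x => \int[leb]_(y in circ R) ((v x - v y) * K (x - y)))].

Definition fracdiv0 (R : realType) (m : nat) (K : R -> R)
    (a b : R -> 'rV[R]_m) : distr R :=
  fun phi => \int[(leb \x leb)%E]_(z in circ R `*` circ R)
    (dotv (a z.1) (b z.2) * (phi z.1 - phi z.2) * K (z.1 - z.2)).

(* div_{1/4}[a(x) . b(y)] for a in L^2 and b in H^{-1/2}: the extension by
   continuity of fracdiv0 K a, that is, the common limit of
   fracdiv0 K a (b_ n) phi along all sequences of L^{2,1} functions b_ n that
   converge to b in H^{-1/2}. *)
Definition fracdiv (R : realType) (m : nat) (K : R -> R)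
    (a : R -> 'rV[R]_m) (b : 'I_m -> distr R) : distr R :=
  fun phi => xget 0 [set l : R |
    forall b_ : nat -> R -> 'rV[R]_m,
      (forall n j, L21 (compj (b_ n) j)) ->
      (forall j, Hnorm2 (- 2^-1) (distr_sub (dist_of (compj (b_ n) j)) (b j))
         @[n --> \oo] --> 0%E) ->
      fracdiv0 K a (b_ n) phi @[n --> \oo] --> l].

(* D_p L (x, p), the gradient in the second variable. *)
Definition gradp (R : realType) (m : nat) (L : 'rV[R]_m * 'rV[R]_m -> R)
    (x p : 'rV[R]_m) : 'rV[R]_m :=
  \row_(j < m) 'D_((0, delta_mx 0 j) : 'rV[R]_m * 'rV[R]_m) L (x, p).

(* The flow of X, lifted to R. *)
Definition is_flow (R : realType) (X : R -> R) (phi : R -> R -> R) : Prop :=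
  (forall x, phi 0 x = x) /\
  (forall t x : R, is_derive t 1 (phi^~ x) (X (phi t x))).

(* Main.v *)
(** Let Lam = (-Delta)^(1/4), f = L(u, Lam u), g = D_pL(u, Lam u).
The identity to prove differs from the hypothesis, tested with X psi, only by the terms
int f (X psi)' - int f X psi' = int psi f X' and
div[g(x).u'(y)](X psi) - div[g(x).u'(y)X(y)](psi) = div[psi(x)g(x).u'(y)](X) = int psi g.c, where
c(x) = int u'(y) (X(x) - X(y)) K(x - y) dy is the commutator Lam(X u') - X Lam(u').
So it suffices that g.c = f X' almost everywhere.

For a trigonometric polynomial w in place of u this follows by differentiating the invariance
at t = 0: w o phi_t is the first argument of L on both sides, so only the difference
Lam(w o phi_t) - (Lam w) o phi_t, whose derivative at t = 0 is Lam(X w') - X Lam(w'), and the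
derivative X' of phi_t' contribute.

The Fourier matrix of w' |-> c is (|k|^(1/2) - |l|^(1/2)) times that of multiplication by X, so by
the Schur test it maps H^(-1/2) to L^2. Hence the commutators of the Fourier partial sums of u
converge in L^2, the identity g.c = f X' passes to the limit along an almost everywhere
convergent subsequence, and the same estimate identifies the extension of div by continuity. *)

(* The invariance cannot be differentiated at u itself, because u' and X u' are only distributions.
   Even for a polynomial w it holds, at each time t, only off a null set that depends on t;
   derivatives at t = 0 are therefore taken along a sequence t_n -> 0, so that countably many null
   sets are discarded. Moreover [fraclap] is a representative fixed only almost everywhere and is
   read at the point phi_t(x), so the flow must pull null sets back to null sets. On w o phi_t it is
   replaced by the singular integral [LamK], whose difference quotients in t converge at every point
   by dominated convergence. The value of [fracdiv] is a limit that must be shared by every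
   admissible sequence of L^(2,1) functions; this requires L^(2,1) inside L^2 and an H^(-1/2) bound
   of the form valid for all L^2 functions, not only for smooth ones. Real Hartley series in cos kx
   + sin kx keep all functions real-valued; the price is that products couple the frequencies k - l
   and k + l. *)
Require Import Defs.
From HB Require Import structures.
From mathcomp Require Import all_boot all_order all_algebra.
From mathcomp Require Import all_classical all_reals all_analysis.
From mathcomp Require Import measurable_realfun.
From mathcomp Require Import complex ring lra zify.
Import Order.TTheory GRing.Theory Num.Theory.
Import numFieldNormedType.Exports.
Set Implicit Arguments.
Unset Strict Implicit.
Unset Printing Implicit Defensive.
Local Open Scope classical_set_scope.
Local Open Scope ring_scope.

(** * Integration on the circle *)

Section circle_integral.
Context {R : realType}.
Implicit Types (f g h : R -> R) (P : R -> Prop).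
Notation mu := (@lebesgue_measure R).

Definition cint f : R := \int[mu]_(x in circ R) f x.

(** Measurability is asked on the whole line rather than on [circ R], so that compositions with
    projections and translations stay measurable without side conditions. *)
Definition cintegrable f : Prop :=
  measurable_fun [set: R] f /\ mu.-integrable (circ R) (EFin \o f).

Definition sqint f : Prop :=
  measurable_fun [set: R] f /\ mu.-integrable (circ R) (EFin \o (fun x => f x ^+ 2)).

Definition aec P : Prop := {ae mu, forall x, circ R x -> P x}.

#[global] Instance ae_lebesgue_filter : Filter (almost_everywhere mu).
Proof. exact: ae_filter_ringOfSetsType. Qed.

Lemma pi2_gt0 : 0 < 2 * pi :> R.
Proof. by rewrite mulr_gt0// pi_gt0. Qed.

Lemma in_circ x : (x \in circ R) = (0 <= x <= 2 * pi).
Proof. by apply/idP/idP; rewrite inE /circ/= in_itv/=. Qed.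

Lemma circE x : circ R x <-> 0 <= x <= 2 * pi.
Proof. by rewrite /circ/= in_itv/=. Qed.

Lemma measurable_circ : measurable (circ R).
Proof. exact: measurable_itv. Qed.
Hint Resolve measurable_circ : core.

Lemma mu_circ : mu (circ R) = (2 * pi)%:E.
Proof. by rewrite /circ lebesgue_measure_itv/= lte_fin pi2_gt0 -EFinB subr0. Qed.

Lemma mu_circ_fin : (mu (circ R) < +oo)%E.
Proof. by rewrite mu_circ ltry. Qed.

Lemma cint_cst (c : R) : cint (fun=> c) = c * (2 * pi).
Proof. by rewrite /cint Rintegral_cst//; congr (_ * _); rewrite -[LHS]/(fine (mu (circ R))) mu_circ. Qed.

Lemma eq_cint f g : (forall x, circ R x -> f x = g x) -> cint f = cint g.
Proof. by move=> fg; apply: eq_Rintegral => x; rewrite inE; exact: fg. Qed.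

Lemma cintegrable_int f : cintegrable f -> mu.-integrable (circ R) (EFin \o f).
Proof. by case. Qed.

Lemma cintegrable_mf f : cintegrable f -> measurable_fun [set: R] f.
Proof. by case. Qed.

Lemma le_cintegrable f g : measurable_fun [set: R] f -> cintegrable g ->
  (forall x, circ R x -> `|f x| <= `|g x|) -> cintegrable f.
Proof.
move=> mf [mg ig] fg; split=> //.
apply: (@le_integrable _ _ _ mu _ measurable_circ _ _ _ _ ig).
  by apply/measurable_EFinP; exact: measurable_funS mf.
by move=> x Cx /=; rewrite lee_fin fg.
Qed.

Lemma cintegrable_cst c : cintegrable (fun=> c).
Proof.
split; first exact: measurable_cst.
apply: (@measurable_bounded_integrable _ _ _ mu (fun=> c) _ measurable_circ mu_circ_fin).
  exact: measurable_cst.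
exists `|c|; split; first exact: num_real.
by move=> x cx y _ /=; exact: ltW.
Qed.

Lemma bounded_cintegrable f M : measurable_fun [set: R] f ->
  (forall x, circ R x -> `|f x| <= M) -> cintegrable f.
Proof.
move=> mf fM; apply: (le_cintegrable mf (cintegrable_cst M)) => x Cx.
by rewrite (le_trans (fM _ Cx))// ler_norm.
Qed.

Lemma cintegrableD f g : cintegrable f -> cintegrable g ->
  cintegrable (fun x => f x + g x).
Proof.
move=> [mf i_f] [mg ig]; split; first exact: measurable_funD.
exact: (@integrableD _ _ _ mu _ measurable_circ (EFin \o f) (EFin \o g)).
Qed.

Lemma cintegrableZ c f : cintegrable f -> cintegrable (fun x => c * f x).
Proof.
move=> [mf i_f]; split; first by apply: measurable_funM => //; exact: measurable_cst.
exact: (@integrableZl _ _ _ mu _ measurable_circ c (EFin \o f)).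
Qed.

Lemma cintegrableN f : cintegrable f -> cintegrable (fun x => - f x).
Proof.
by move=> /(cintegrableZ (-1)); under eq_fun do rewrite mulN1r.
Qed.

Lemma cintegrableB f g : cintegrable f -> cintegrable g ->
  cintegrable (fun x => f x - g x).
Proof. by move=> i_f ig; apply: cintegrableD => //; exact: cintegrableN. Qed.

Lemma cintegrable_norm f : cintegrable f -> cintegrable (fun x => `|f x|).
Proof.
move=> [mf i_f]; split; first exact: measurableT_comp.
exact: integrable_norm.
Qed.

Lemma cintegrable_sum (I : Type) (s : seq I) (F : I -> R -> R) :
  (forall i, cintegrable (F i)) -> cintegrable (fun x => \sum_(i <- s) F i x).
Proof.
move=> iF; elim: s => [|i s ih].
  by under eq_fun do rewrite big_nil; exact: cintegrable_cst.
by under eq_fun do rewrite big_cons; exact: cintegrableD.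
Qed.

Lemma cintD f g : cintegrable f -> cintegrable g ->
  cint (fun x => f x + g x) = cint f + cint g.
Proof. by move=> [_ ?] [_ ?]; exact: RintegralD. Qed.

Lemma cintB f g : cintegrable f -> cintegrable g ->
  cint (fun x => f x - g x) = cint f - cint g.
Proof. by move=> [_ ?] [_ ?]; exact: RintegralB. Qed.

Lemma cintZ c f : cintegrable f -> cint (fun x => c * f x) = c * cint f.
Proof. by move=> [_ ?]; exact: RintegralZl. Qed.

Lemma cintN f : cintegrable f -> cint (fun x => - f x) = - cint f.
Proof.
by move=> i_f; rewrite -mulN1r -cintZ//; apply: eq_cint => x _; rewrite mulN1r.
Qed.

Lemma cint_sum (I : Type) (s : seq I) (F : I -> R -> R) :
  (forall i, cintegrable (F i)) ->
  cint (fun x => \sum_(i <- s) F i x) = \sum_(i <- s) cint (F i).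
Proof.
move=> iF; elim: s => [|i s ih].
  by under eq_fun do rewrite big_nil; rewrite big_nil cint_cst mul0r.
under eq_fun do rewrite big_cons; rewrite big_cons cintD ?ih//.
exact: cintegrable_sum.
Qed.

Lemma le_cint f g : cintegrable f -> cintegrable g ->
  (forall x, circ R x -> f x <= g x) -> cint f <= cint g.
Proof. by move=> [_ ?] [_ ?]; exact: (@le_Rintegral _ _ _ mu _ _ _ measurable_circ). Qed.

Lemma cint_ge0 f : (forall x, circ R x -> 0 <= f x) -> 0 <= cint f.
Proof. by move=> f0; exact: Rintegral_ge0. Qed.

Lemma le_norm_cint f : cintegrable f -> `|cint f| <= cint (fun x => `|f x|).
Proof. by move=> [_ ?]; exact: le_normr_Rintegral. Qed.

Lemma EFin_cint f : cintegrable f -> (cint f)%:E = (\int[mu]_(x in circ R) (f x)%:E)%E.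
Proof. by move=> [_ ?]; rewrite fineK//; exact: integrable_fin_num. Qed.

Lemma aec_ae P Q : (forall x, (circ R x -> P x) -> Q x) -> aec P -> {ae mu, forall x, Q x}.
Proof. by move=> PQ; rewrite /aec; apply: filterS. Qed.

Lemma aecW P : (forall x, circ R x -> P x) -> aec P.
Proof. by move=> p; exact: aeW. Qed.

Lemma aecS P Q : (forall x, circ R x -> P x -> Q x) -> aec P -> aec Q.
Proof. by move=> PQ; rewrite /aec; apply: filterS => x Px Cx; apply: PQ => //; exact: Px. Qed.

Lemma aecS2 P Q S : (forall x, circ R x -> P x -> Q x -> S x) ->
  aec P -> aec Q -> aec S.
Proof. by move=> PQ; rewrite /aec; apply: filterS2 => x Px Qx Cx; apply: PQ; [| exact: Px| exact: Qx]. Qed.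

Lemma aec_foralln (P : nat -> R -> Prop) : (forall n, aec (P n)) ->
  aec (fun x => forall n, P n x).
Proof.
move=> p; rewrite /aec.
apply: filterS (@ae_foralln _ _ _ mu (fun n x => circ R x -> P n x) p) => x h Cx n.
exact: h.
Qed.

Lemma aec_forall_fin (I : finType) (P : I -> R -> Prop) : (forall n, aec (P n)) ->
  aec (fun x => forall n, P n x).
Proof.
(* The finite family is enumerated and padded with [True], which reduces the claim to the countable
   case. *)
move=> p; have := aec_foralln (P := fun n x => if insub n is Some k then P (enum_val (k : 'I_(#|I|))) x else True).
move=> /(_ _)/wrap[n|].
  by case: insubP => [k _ _|_]; [exact: p|exact: aecW].
apply: aecS => x Cx h i; have := h (enum_rank i).
by rewrite insubT//= => ?; rewrite (_ : Sub _ _ = enum_rank i) ?enum_rankK//; exact: val_inj.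
Qed.

Lemma eq_cint_ae f g : measurable_fun [set: R] f -> measurable_fun [set: R] g ->
  aec (fun x => f x = g x) -> cint f = cint g.
Proof.
move=> mf mg fg; rewrite /cint /Rintegral; congr fine; apply: ae_eq_integral => //.
- by apply/measurable_EFinP; exact: measurable_funS mf.
- by apply/measurable_EFinP; exact: measurable_funS mg.
- by apply: aec_ae fg => x h Cx; rewrite h.
Qed.

Lemma cint_cvg0_dom (F : nat -> R -> R) f g : (forall n, cintegrable (F n)) ->
  cintegrable f -> cintegrable g ->
  aec (fun x => F ^~ x @ \oo --> f x) ->
  aec (fun x => forall n, `|F n x| <= g x) ->
  cint (F n) @[n --> \oo] --> cint f.
Proof.
move=> iF i_f ig Ff Fg.
have [|||||_ _ +] := @dominated_convergence _ _ _ mu (circ R) measurable_circ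
  (fun n => EFin \o F n) (EFin \o f) (EFin \o g).
- by move=> n; apply: measurable_int (iF n).2.
- by apply: measurable_int i_f.2.
- by apply: aec_ae Ff => x h Cx; apply/fine_cvgP; split; [exact: nearW|exact: h].
- exact: cintegrable_int.
- by apply: aec_ae Fg => x h n Cx; rewrite /= lee_fin; exact: h.
by rewrite -EFin_cint// => /fine_cvgP[_].
Qed.

End circle_integral.
#[global] Hint Resolve measurable_circ : core.

(** * Square integrable functions, Cauchy-Schwarz and Fatou *)

Section L2_theory.
Context {R : realType}.
Implicit Types (f g h : R -> R) (P : R -> Prop).
Notation mu := (@lebesgue_measure R).
Let mC : measurable (circ R) := @measurable_circ R.
Hint Resolve mC : core.

Definition ip f g : R := cint (fun x => f x * g x).
Definition sqn f : R := ip f f.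

Lemma sqint_mf f : sqint f -> measurable_fun [set: R] f.
Proof. by case. Qed.

Lemma sqint_sqr f : sqint f -> cintegrable (fun x => f x ^+ 2).
Proof. by move=> [mf i_f]; split => //; exact: measurable_funX. Qed.

Lemma sqint_ip f g : sqint f -> sqint g -> cintegrable (fun x => f x * g x).
Proof.
move=> sf sg.
apply: (le_cintegrable _ (cintegrableD (sqint_sqr sf) (sqint_sqr sg))).
  by apply: measurable_funM; exact: sqint_mf.
move=> x _; rewrite [leRHS]ger0_norm ?addr_ge0 ?sqr_ge0//.
rewrite normrM -(real_normK (num_real (f x))) -(real_normK (num_real (g x))).
have := sqr_ge0 (`|f x| - `|g x|); have := sqr_ge0 (`|f x| + `|g x|).
by rewrite sqrrD sqrrB; lra.
Qed.

Lemma le_sqint f g : measurable_fun [set: R] f -> sqint g ->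
  (forall x, circ R x -> `|f x| <= `|g x|) -> sqint f.
Proof.
move=> mf sg fg; split=> //.
apply: (le_cintegrable _ (sqint_sqr sg) _).2; first exact: measurable_funX.
by move=> x Cx; rewrite !normrX lerXn2r ?nnegrE// fg.
Qed.

Lemma sqint_bounded f M : measurable_fun [set: R] f ->
  (forall x, circ R x -> `|f x| <= M) -> sqint f.
Proof.
move=> mf fM; split => //.
apply: (bounded_cintegrable (M := M ^+ 2) _ _).2; first exact: measurable_funX.
move=> x Cx; rewrite normrX lerXn2r ?nnegrE//; last exact: fM.
by rewrite (le_trans _ (fM _ Cx)).
Qed.

Lemma sqint_cst (c : R) : sqint (fun=> c).
Proof. by apply: (@sqint_bounded _ `|c|). Qed.

Lemma sqint_L1 f : sqint f -> cintegrable f.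
Proof.
move=> sf; have := sqint_ip sf (sqint_cst 1).
by under eq_fun do rewrite mulr1.
Qed.

Lemma sqintZ c f : sqint f -> sqint (fun x => c * f x).
Proof.
move=> [mf i_f]; split; first by apply: measurable_funM => //; exact: measurable_cst.
have := (cintegrableZ (c ^+ 2) (sqint_sqr (conj mf i_f))).2.
by under eq_fun do rewrite -exprMn.
Qed.

Lemma sqintD f g : sqint f -> sqint g -> sqint (fun x => f x + g x).
Proof.
move=> sf sg; split; first by apply: measurable_funD; exact: sqint_mf.
rewrite (_ : (fun x => _) =
    (fun x => (f x ^+ 2 + g x ^+ 2) + 2 * (f x * g x))); last first.
  by apply/funext => x; ring.
exact: (cintegrableD (cintegrableD (sqint_sqr sf) (sqint_sqr sg))
         (cintegrableZ _ (sqint_ip sf sg))).2.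
Qed.

Lemma sqintN f : sqint f -> sqint (fun x => - f x).
Proof. by move=> /(sqintZ (-1)); under eq_fun do rewrite mulN1r. Qed.

Lemma sqintB f g : sqint f -> sqint g -> sqint (fun x => f x - g x).
Proof. by move=> sf sg; apply: sqintD => //; exact: sqintN. Qed.

Lemma sqintM f g M : sqint f -> measurable_fun [set: R] g ->
  (forall x, circ R x -> `|g x| <= M) -> sqint (fun x => f x * g x).
Proof.
move=> sf mg gM; apply: (le_sqint _ (sqintZ M sf)).
  by apply: measurable_funM => //; exact: sqint_mf.
move=> x Cx; rewrite !normrM mulrC ler_wpM2r//.
by rewrite (le_trans (gM _ Cx))// ler_norm.
Qed.

Lemma ipC f g : ip f g = ip g f.
Proof. by apply: eq_cint => x _; rewrite mulrC. Qed.

Lemma eq_ip f g f' g' : (forall x, circ R x -> f x = f' x) ->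
  (forall x, circ R x -> g x = g' x) -> ip f g = ip f' g'.
Proof. by move=> ff gg; apply: eq_cint => x Cx; rewrite ff// gg. Qed.

Lemma ipDl f g h : sqint f -> sqint g -> sqint h ->
  ip (fun x => f x + g x) h = ip f h + ip g h.
Proof.
move=> sf sg sh; rewrite /ip -cintD; try exact: sqint_ip.
by apply: eq_cint => x _; rewrite mulrDl.
Qed.

Lemma ipZl c f h : sqint f -> sqint h -> ip (fun x => c * f x) h = c * ip f h.
Proof.
move=> sf sh; rewrite /ip -cintZ; last exact: sqint_ip.
by apply: eq_cint => x _; rewrite mulrA.
Qed.

Lemma ipBl f g h : sqint f -> sqint g -> sqint h ->
  ip (fun x => f x - g x) h = ip f h - ip g h.
Proof.
move=> sf sg sh; rewrite /ip -cintB; try exact: sqint_ip.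
by apply: eq_cint => x _; rewrite mulrBl.
Qed.

Lemma ipDr f g h : sqint f -> sqint g -> sqint h ->
  ip h (fun x => f x + g x) = ip h f + ip h g.
Proof. by move=> *; rewrite ipC ipDl// !(ipC h). Qed.

Lemma ipBr f g h : sqint f -> sqint g -> sqint h ->
  ip h (fun x => f x - g x) = ip h f - ip h g.
Proof. by move=> *; rewrite ipC ipBl// !(ipC h). Qed.

Lemma ipZr c f h : sqint f -> sqint h -> ip h (fun x => c * f x) = c * ip h f.
Proof. by move=> *; rewrite ipC ipZl// (ipC h). Qed.

Lemma ip_suml (I : Type) (s : seq I) (F : I -> R -> R) h :
  (forall i, sqint (F i)) -> sqint h ->
  ip (fun x => \sum_(i <- s) F i x) h = \sum_(i <- s) ip (F i) h.
Proof.
move=> sF sh; rewrite /ip -cint_sum; last by move=> i; exact: sqint_ip.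
by apply: eq_cint => x _; rewrite mulr_suml.
Qed.

Lemma sqn_ge0 f : 0 <= sqn f.
Proof. by apply: cint_ge0 => x _; rewrite -expr2 sqr_ge0. Qed.

Lemma sqnE f : sqn f = cint (fun x => f x ^+ 2).
Proof. by []. Qed.

Lemma sqnZ c f : sqint f -> sqn (fun x => c * f x) = c ^+ 2 * sqn f.
Proof.
by move=> sf; rewrite /sqn ipZl ?ipZr ?mulrA//; exact: sqintZ.
Qed.

Lemma sqnBC f g : sqn (fun x => f x - g x) = sqn (fun x => g x - f x).
Proof. by rewrite !sqnE; apply: eq_cint => x _; rewrite -opprB sqrrN. Qed.

Lemma sqnD f g : sqint f -> sqint g ->
  sqn (fun x => f x + g x) = sqn f + 2 * ip f g + sqn g.
Proof.
move=> sf sg; rewrite /sqn ipDl ?ipDr//; last exact: sqintD.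
by rewrite (ipC g f); ring.
Qed.

Lemma sqnB f g : sqint f -> sqint g ->
  sqn (fun x => f x - g x) = sqn f - 2 * ip f g + sqn g.
Proof.
move=> sf sg; rewrite /sqn ipBl ?ipBr//; last exact: sqintB.
by rewrite (ipC g f); ring.
Qed.

(** The discriminant argument behind every Cauchy-Schwarz inequality here; it also turns additive
    bounds on a bilinear form into multiplicative ones, see [Bk_bound]. *)
Lemma discr_le (a b c : R) : (forall t, 0 <= a + 2 * t * b + t ^+ 2 * c) ->
  0 <= c -> b ^+ 2 <= a * c.
Proof.
move=> h; rewrite le_eqVlt => /predU1P[c0|c0].
  suff -> : b = 0 by rewrite expr0n/= -c0 mulr0.
  (* For c = 0 the expression is affine in t, and this t gives it the value -1. *)
  apply/eqP/negPn/negP => b0; have := h (- (a + 1) / (2 * b)).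
  rewrite -c0 mulr0 addr0 (_ : 2 * _ * b = - (a + 1)); last by field.
  by lra.
have := h (- b / c); rewrite (_ : a + _ + _ = (a * c - b ^+ 2) / c).
  by rewrite pmulr_lge0 ?invr_gt0// subr_ge0.
by field; rewrite gt_eqF.
Qed.

Lemma ip_sqr_le f g : sqint f -> sqint g -> ip f g ^+ 2 <= sqn f * sqn g.
Proof.
move=> sf sg; apply: discr_le; last exact: sqn_ge0.
move=> t; have := sqn_ge0 (fun x => f x + t * g x).
rewrite sqnD ?sqnZ//; last exact: sqintZ.
by rewrite ipZr// mulrA.
Qed.

(** No majorant is available where this is used: a uniform bound on the integrals alone makes the
    limit integrable. *)
Lemma fatou_circ (F : nat -> R -> R) f e : (forall n, cintegrable (F n)) ->
  (forall n x, circ R x -> 0 <= F n x) -> measurable_fun [set: R] f ->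
  aec (fun x => F ^~ x @ \oo --> f x) -> (forall n, cint (F n) <= e) ->
  cintegrable f /\ cint f <= e.
Proof.
move=> iF F0 mf Ff Fe.
(* Almost everywhere |f| is the lower limit of the F n in the extended reals, to which Fatou's lemma
   applies. *)
have le_e : (\int[mu]_(x in circ R) `|(f x)%:E| <= e%:E)%E.
  rewrite (_ : (\int[mu]_(x in circ R) _ =
      \int[mu]_(x in circ R) (limn_einf (fun n => (F n x)%:E)))%E); last first.
    apply: ge0_ae_eq_integral => //.
    - by do 2 apply: measurableT_comp => //; exact: measurable_funS mf.
    - rewrite /limn_einf; apply: measurableT_comp => //; apply: measurable_fun_limn_esup => n.
      by apply: measurableT_comp => //; apply/measurable_EFinP; apply: measurable_funS (iF n).1.
    - move=> x Cx; rewrite limn_einf_lim; apply: lime_ge; first exact: is_cvg_einfs.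
      apply: nearW => n; apply: le_ereal_inf_tmp => _ /= [k _ <-].
      by rewrite lee_fin F0.
    - apply: aec_ae Ff => x h Cx.
      have hF : (fun n => (F n x)%:E) @ \oo --> (f x)%:E.
        by apply/fine_cvgP; split; [exact: nearW|exact: h].
      have [-> _] := cvg_limn_einf_sup hF.
      rewrite gee0_abs// lee_fin -(cvg_lim _ (h Cx))//; apply: limr_ge; first exact: cvgP (h Cx).
      by apply: nearW => n; exact: F0.
  apply: le_trans (fatou mu measurable_circ _ _) _.
  - by move=> n; apply/measurable_EFinP; apply: measurable_funS (iF n).1.
  - by move=> n x Cx; rewrite lee_fin F0.
  rewrite limn_einf_lim; apply: lime_le; first exact: is_cvg_einfs.
  apply: nearW => n; apply: ge_ereal_inf; exists (cint (F n))%:E.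
    by exists n => //=; rewrite -EFin_cint.
  by rewrite lee_fin.
have i_f : cintegrable f.
  split=> //; apply/integrableP; split.
    by apply/measurable_EFinP; apply: measurable_funS mf.
  by rewrite (le_lt_trans le_e)// ltry.
split=> //; rewrite -lee_fin EFin_cint// (le_trans _ le_e)//.
apply: le_trans (le_abse_integral _ _ _) => //; first exact: lee_abs.
by apply/measurable_EFinP; apply: measurable_funS mf.
Qed.

Lemma sum_geometric_half_le (C : R) n : 0 <= C -> \sum_(i < n) C / 2 ^+ i <= 2 * C.
Proof.
move=> C0; rewrite (_ : \sum_(i < n) _ = 2 * C * (1 - 1 / 2 ^+ n)); last first.
  elim: n => [|n ih]; first by rewrite big_ord0 expr0 divr1 subrr mulr0.
  by rewrite big_ord_recr/= ih exprS; field; rewrite expf_neq0.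
by rewrite ler_piMr ?mulr_ge0// gerBl divr_ge0// exprn_ge0.
Qed.

(** Squared norms below 4^-n force the series of |g_n| to have a finite integral, hence a finite sum
    almost everywhere. Applied to successive differences it gives almost everywhere convergence of a
    subsequence. *)
Lemma fast_ae (g : nat -> R -> R) : (forall n, sqint (g n)) ->
  (forall n, sqn (g n) <= (4 ^+ n)^-1) ->
  aec (fun x => exists M : R, forall n, \sum_(j < n) `|g j x| <= M).
Proof.
move=> sg Ng.
have mg n : measurable_fun (circ R) (fun x => `|g n x|%:E).
  by apply/measurable_EFinP; apply: measurableT_comp => //; apply: measurable_funS (sg n).1.
pose C := 1 + 2 * pi : R.
have C0 : 0 <= C by rewrite addr_ge0// ltW// pi2_gt0.
(* From |g| <= 2^n g^2 + 2^-n: the first term contributes 2^n 4^-n, the second 2^-n times the length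
   2 pi, whence C = 1 + 2 pi. *)
have Ig n : cint (fun x => `|g n x|) <= C / 2 ^+ n.
  have := @le_cint R (fun x => `|g n x|) (fun x => 2 ^+ n * g n x ^+ 2 + 1 / 2 ^+ n).
  move=> /(_ _ _ _)/wrap[].
  - by apply: cintegrable_norm; exact: sqint_L1.
  - apply: cintegrableD; last exact: cintegrable_cst.
    by apply: cintegrableZ; exact: sqint_sqr.
  - move=> x _; rewrite -subr_ge0 -(real_normK (num_real (g n x))).
    have p0 : 0 < 2 ^+ n :> R by rewrite exprn_gt0.
    have -> : 2 ^+ n * `|g n x| ^+ 2 + 1 / 2 ^+ n - `|g n x| =
      2 ^+ n * ((`|g n x| - 1 / (2 * 2 ^+ n)) ^+ 2 + 3 / 4 * (1 / 2 ^+ n) ^+ 2).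
      by field; rewrite gt_eqF.
    rewrite mulr_ge0 ?addr_ge0 ?sqr_ge0// ?mulr_ge0 ?sqr_ge0// ltW//.
  move=> /le_trans; apply; rewrite cintD; last 2 first.
  - by apply: cintegrableZ; exact: sqint_sqr.
  - exact: cintegrable_cst.
  rewrite cintZ ?cint_cst; last exact: sqint_sqr.
  have -> : C / 2 ^+ n = 1 / 2 ^+ n + 1 / 2 ^+ n * (2 * pi).
    by rewrite /C div1r mulrDl mul1r; congr (_ + _); rewrite mulrC.
  rewrite lerD2r div1r.
  rewrite -sqnE (le_trans (ler_wpM2l _ (Ng n)))// ?exprn_ge0//.
  rewrite (_ : 4 = 2 * 2)// ?exprMn ?invfM ?mulrA ?divff ?mul1r ?expf_neq0//.
  by rewrite -natrM.
have fin : (\int[mu]_(x in circ R) (\sum_(n <oo) `|g n x|%:E) <= (2 * C)%:E)%E.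
  rewrite integral_nneseries//.
  apply: lime_le; first by apply: is_cvg_nneseries => n _ _; exact: integral_ge0.
  apply: nearW => n; rewrite big_mkord.
  rewrite (eq_bigr (fun i : 'I_n => (cint (fun x => `|g i x|))%:E)); last first.
    move=> i _; rewrite EFin_cint//; apply: cintegrable_norm; exact: sqint_L1.
  rewrite sumEFin lee_fin (le_trans _ (sum_geometric_half_le n C0))//.
  by apply: ler_sum => i _; exact: Ig.
have mS : measurable_fun (circ R) (fun x => (\sum_(n <oo) `|g n x|%:E)%E).
  by apply: ge0_emeasurable_sum.
have h : mu.-integrable (circ R) (fun x => (\sum_(n <oo) `|g n x|%:E)%E).
  apply/integrableP; split => //.
  rewrite (le_lt_trans _ (ltry (2 * C)))// (le_trans _ fin)//.
  apply: ge0_le_integral => //; first exact: measurableT_comp.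
  by move=> x Cx; rewrite gee0_abs// nneseries_ge0.
have := @integrable_ae _ _ _ mu _ mC _ h; rewrite /aec; apply: filterS => x hx Cx.
exists (fine (\sum_(n <oo) `|g n x|%:E)%E) => n.
rewrite -lee_fin fineK//; last exact: hx.
have := @nneseries_lim_ge R (fun n => `|g n x|%:E) xpredT 0 n.
by rewrite big_mkord sumEFin; apply => k _ _; rewrite lee_fin.
Qed.

End L2_theory.

(** * Completeness of L^2 and almost everywhere convergent subsequences *)

Section L2_complete.
Context {R : realType}.
Implicit Types (f g h : R -> R) (P : R -> Prop).
Notation mu := (@lebesgue_measure R).

Definition L2cvg (F : nat -> R -> R) f : Prop := forall e, 0 < e ->
  exists n0, forall n, (n0 <= n)%N -> sqn (fun x => F n x - f x) <= e.

Definition L2cauchy (F : nat -> R -> R) : Prop := forall e, 0 < e ->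
  exists n0, forall n m, (n0 <= n)%N -> (n0 <= m)%N ->
    sqn (fun x => F n x - F m x) <= e.

Lemma bounded_sum_is_cvg (a : nat -> R) (M : R) :
  (forall n, \sum_(j < n) `|a j| <= M) -> cvgn (series a).
Proof.
move=> aM; apply: normed_cvg; apply: nondecreasing_is_cvgn.
  by apply: nondecreasing_series => n _ _; exact: normr_ge0.
by exists M => _ [n _ <-] /=; rewrite /series/= big_mkord; exact: aM.
Qed.

Lemma bounded_sum_cvg0 (a : nat -> R) (M : R) :
  (forall n, \sum_(j < n) `|a j| <= M) -> a n @[n --> \oo] --> 0.
Proof. by move=> /bounded_sum_is_cvg; exact: cvg_series_cvg_0. Qed.

Lemma exp4V_gt0 j : 0 < (4 ^+ j)^-1 :> R.
Proof. by rewrite invr_gt0 exprn_gt0. Qed.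

(** One subsequence serves a whole finite family, because the arguments of L and the commutators
    have to converge at the same points. *)
Lemma L2cvg_subseq_ae (I : finType) (F : I -> nat -> R -> R) (G : I -> R -> R) :
  (forall i n, sqint (F i n)) -> (forall i, sqint (G i)) ->
  (forall i, L2cvg (F i) (G i)) ->
  exists s : nat -> nat, (forall j, (j <= s j)%N) /\
    forall i, aec (fun x => F i (s j) x @[j --> \oo] --> G i x).
Proof.
move=> sF sG FG.
have /choice[n0 hn0] : forall p : I * nat, exists n0, forall n, (n0 <= n)%N ->
    sqn (fun x => F p.1 n x - G p.1 x) <= (4 ^+ p.2)^-1.
  by move=> [i j]; exact: FG (exp4V_gt0 j).
(* Summing over i makes the index exceed the rank required by each member; s need not be
   monotone. *)
exists (fun j => (j + \sum_i n0 (i, j))%N); split=> [j|i]; first exact: leq_addr.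
have := @fast_ae R (fun j x => F i (j + \sum_i n0 (i, j))%N x - G i x).
move=> /(_ _ _)/wrap[].
- by move=> n; exact: sqintB.
- move=> j; apply: (hn0 (i, j)).
  by rewrite (bigD1 i)//= addnCA leq_addr.
apply: aecS => x Cx [M hM].
by apply/subr_cvg0; exact: (bounded_sum_cvg0 hM).
Qed.

Lemma L2_complete (F : nat -> R -> R) : (forall n, sqint (F n)) -> L2cauchy F ->
  exists f, [/\ sqint f, L2cvg F f &
    (forall n, periodic2pi (F n)) -> periodic2pi f].
Proof.
move=> sF cF.
have /choice[n0 hn0] : forall j, exists n0, forall n m, (n0 <= n)%N -> (n0 <= m)%N ->
    sqn (fun x => F n x - F m x) <= (4 ^+ j)^-1.
  by move=> j; exact: cF (exp4V_gt0 j).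
(* Adding all earlier ranks makes both s j and s (j + 1) at least n0 j, so that successive
   differences have squared norm at most 4^-j. *)
pose s j := (j + \sum_(i < j.+1) n0 i)%N.
have sj j : (j <= s j)%N by exact: leq_addr.
have n0s j : (n0 j <= s j)%N by rewrite /s big_ord_recr/= addnA leq_addl.
have n0sS j : (n0 j <= s j.+1)%N.
  by rewrite /s big_ord_recr/= big_ord_recr/=; lia.
have ae1 : aec (fun x => cvgn (fun j => F (s j) x)).
  have := @fast_ae R (fun j x => F (s j.+1) x - F (s j) x).
  move=> /(_ _ _)/wrap[].
  - by move=> n; exact: sqintB.
  - by move=> j; exact: hn0.
  apply: aecS => x Cx [M hM].
  have := @bounded_sum_is_cvg (fun j => F (s j.+1) x - F (s j) x) M hM.
  rewrite (_ : series _ = (fun n => F (s n) x - F (s 0) x)); last first.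
    apply/funext => n; rewrite /series/= telescope_sumr//.
  move=> /cvg_ex[l hl]; apply/cvg_ex; exists (l + F (s 0) x).
  rewrite (_ : (fun j => _) = (fun n => (F (s n) x - F (s 0) x) + F (s 0) x)); last first.
    by apply/funext => n; rewrite subrK.
  by apply: cvgD => //; exact: cvg_cst.
(* An upper limit is defined at every point, so that f is measurable, and periodic whenever the F n
   are, with no exceptional set. *)
pose f x := fine (limn_esup (fun j => (F (s j) x)%:E)).
have mf : measurable_fun [set: R] f.
  apply: measurableT_comp => //; apply: measurable_fun_limn_esup => n.
  by apply/measurable_EFinP; exact: sqint_mf.
have ae2 : aec (fun x => F (s j) x @[j --> \oo] --> f x).
  apply: aecS ae1 => x Cx /cvg_ex[l hl].
  suff -> : f x = l by [].
  rewrite /f; have /cvg_limn_einf_sup[_ ->//] : (F (s j) x)%:E @[j --> \oo] --> l%:E.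
  by apply/fine_cvgP; split; [exact: nearW|exact: hl].
(* Almost everywhere convergence becomes L^2 convergence by Fatou's lemma applied to the squared
   distances from F n. *)
have fatou n e j0 : (forall j, (j0 <= j)%N -> sqn (fun x => F n x - F (s j) x) <= e) ->
    cintegrable (fun x => (F n x - f x) ^+ 2) /\ sqn (fun x => F n x - f x) <= e.
  move=> h; apply: (@fatou_circ R (fun j x => (F n x - F (s (j + j0)) x) ^+ 2)).
  - by move=> j; apply: sqint_sqr; exact: sqintB.
  - by move=> j x _; exact: sqr_ge0.
  - by apply: measurable_funX; apply: measurable_funB => //; exact: sqint_mf.
  - apply: aecS ae2 => x Cx h'.
    have := h'; rewrite -(cvg_shiftn j0) => h2.
    have h3 : F n x - F (s (j + j0)%N) x @[j --> \oo] --> F n x - f x.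
      by apply: cvgB => //; exact: cvg_cst.
    by rewrite expr2; under eq_fun do rewrite expr2; exact: cvgM.
  - by move=> j; apply: h; rewrite leq_addl.
have sf : sqint f.
  have [|h _] := fatou (n0 0) (4 ^+ 0)^-1 0.
    by move=> j _; apply: hn0 => //; rewrite /s big_ord_recl/= addnCA leq_addr.
  have sd : sqint (fun x => F (n0 0) x - f x).
    by split; [apply: measurable_funB => //; exact: sqint_mf|exact: h.2].
  have := sqintB (sF (n0 0)) sd.
  by under eq_fun do rewrite opprB addrC subrK.
exists f; split=> //.
  move=> e e0; have [n1 hn1] := cF _ e0; exists n1 => n n1n.
  have [|_ //] := fatou n e n1.
  by move=> j n1j; apply: hn1 => //; rewrite (leq_trans n1j).
move=> pF x; rewrite /f; congr (fine (limn_esup _)).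
by apply/funext => j; rewrite pF.
Qed.

End L2_complete.

(** * Fubini on the torus *)

Section circle_fubini.
Context {R : realType}.
Implicit Types (h : R * R -> R).
Notation mu := (@lebesgue_measure R).
Let mC : measurable (circ R) := @measurable_circ R.
Hint Resolve mC : core.

Definition cint2 h : R := \int[(mu \x mu)%E]_(z in circ R `*` circ R) h z.

Definition cintegrable2 h : Prop :=
  measurable_fun [set: R * R] h /\
  (mu \x mu)%E.-integrable (circ R `*` circ R) (EFin \o h).

Lemma measurable_csquare : measurable (circ R `*` circ R).
Proof. exact: measurableX. Qed.
Hint Resolve measurable_csquare : core.

(** Extension by zero to the plane, where the Fubini theorems are stated. *)
Let ext h : R * R -> \bar R := (EFin \o h) \_ (circ R `*` circ R).

Let ext_mf h : measurable_fun [set: R * R] h -> measurable_fun [set: R * R] (ext h).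
Proof.
move=> mh; apply: (@measurable_restrictT _ _ _ _ _ _ measurable_csquare).1.
by apply/measurable_EFinP; exact: measurable_funS mh.
Qed.

Let ext_abse h z : `|ext h z|%E = ext (fun z => `|h z|) z.
Proof. by rewrite /ext !patchE; case: ifPn => //=; rewrite normr0. Qed.

Let ext_int h : cintegrable2 h -> (mu \x mu)%E.-integrable setT (ext h).
Proof.
move=> [_ ih].
exact: (@integrable_mkcond _ _ _ (mu \x mu)%E _ (EFin \o h) measurable_csquare).1 ih.
Qed.

Let int_ext1 h x : (\int[mu]_y ext h (x, y))%E =
  if x \in circ R then (\int[mu]_(y in circ R) (h (x, y))%:E)%E else 0%E.
Proof.
rewrite [in RHS]integral_mkcond; case: ifPn => xC.
  apply: eq_integral => y _; rewrite /ext !patchE.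
  by rewrite in_setX/= xC.
rewrite integral0_eq// => y _.
by rewrite /ext patchE in_setX (negbTE xC).
Qed.

Lemma measurable_cint_param h : measurable_fun [set: R * R] h ->
  measurable_fun [set: R] (fun x => cint (fun y => h (x, y))).
Proof.
move=> mh; rewrite /cint /Rintegral.
apply: (@measurableT_comp _ _ _ _ _ _ fine); first exact: fine_measurable.
(* Only the second variable is cut off, since measurability in x is wanted on the whole line. *)
pose H : R * R -> \bar R := (EFin \o h) \_ (setT `*` circ R).
have mH : measurable_fun [set: R * R] H.
  apply: (@measurable_restrictT _ _ _ _ _ _ (measurableX measurableT mC)).1.
  by apply/measurable_EFinP; exact: measurable_funS mh.
rewrite (_ : (fun x => _) = (fun x => \int[mu]_y H^\+ (x, y) - \int[mu]_y H^\- (x, y))%E).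
  by apply: emeasurable_funB; apply: (measurable_fun_fubini_tonelli_F (m2 := mu));
    [exact: measurable_funepos| |exact: measurable_funeneg|].
apply/funext => x; rewrite integral_mkcond integralE; congr (_ - _)%E.
  by apply: eq_integral => y _; rewrite !funeposE /H !patchE in_setX/= in_setT.
by apply: eq_integral => y _; rewrite !funenegE /H !patchE in_setX/= in_setT.
Qed.

Lemma measurable_swap h : measurable_fun [set: R * R] h ->
  measurable_fun [set: R * R] (fun z => h (z.2, z.1)).
Proof.
move=> mh; apply: (measurableT_comp mh).
by apply: measurable_fun_pair; [exact: measurable_snd|exact: measurable_fst].
Qed.

Lemma cintegrable2P h : measurable_fun [set: R * R] h ->
  (\int[mu]_(x in circ R) \int[mu]_(y in circ R) `|h (x, y)|%:E < +oo)%E ->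
  cintegrable2 h.
Proof.
move=> mh hoo; split=> //.
apply: (@integrable_mkcond _ _ _ (mu \x mu)%E _ (EFin \o h) measurable_csquare).2.
apply/integrable12ltyP; first exact: ext_mf.
rewrite (_ : (\int[mu]_x _)%E = (\int[mu]_(x in circ R) \int[mu]_(y in circ R) `|h (x, y)|%:E)%E)//.
rewrite [RHS]integral_mkcond; apply: eq_integral => x _.
under eq_integral do rewrite -/(ext h _) ext_abse.
by rewrite int_ext1 patchE.
Qed.

Let fubini_ext h : cintegrable2 h ->
  cint2 h = fine (\int[mu]_(x in circ R) \int[mu]_(y in circ R) (h (x, y))%:E)%E /\
  mu.-integrable (circ R) (fun x => \int[mu]_(y in circ R) (h (x, y))%:E)%E.
Proof.
move=> ih; have ih' := ext_int ih.
have E : fubini_F mu (ext h) = ((fun x => \int[mu]_(y in circ R) (h (x, y))%:E) \_ (circ R))%E.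
  by apply/funext => x; rewrite /fubini_F int_ext1 patchE.
split.
  rewrite /cint2 /Rintegral integral_mkcond; congr fine.
  transitivity (\int[mu]_x (fubini_F mu (ext h)) x)%E; first exact/esym/(integral12_prod_meas1 ih').
  by rewrite E -integral_mkcond.
by apply/integrable_mkcond => //; rewrite -E; exact: (integrable_fubini_F ih').
Qed.

Lemma cint2_fubini h : cintegrable2 h ->
  cintegrable (fun x => cint (fun y => h (x, y))) /\
  cint2 h = cint (fun x => cint (fun y => h (x, y))).
Proof.
move=> ih; have [-> iF] := fubini_ext ih.
have mc := measurable_cint_param ih.1.
(* The inner integral may be infinite on a null set of x; elsewhere passing to its real value with
   [fine] changes nothing. *)
have ae : ae_eq mu (circ R) (fun x => \int[mu]_(y in circ R) (h (x, y))%:E)%E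
    (EFin \o (fun x => cint (fun y => h (x, y)))).
  have := @integrable_ae _ _ _ mu _ mC _ iF.
  by apply: filterS => x hx Cx; rewrite /= fineK//; exact: hx.
have mc' : measurable_fun (circ R) (EFin \o (fun x => cint (fun y => h (x, y)))).
  by apply/measurable_EFinP; exact: measurable_funS mc.
split; last by rewrite [in RHS]/cint /Rintegral; congr fine; apply: ae_eq_integral => //; apply: measurable_int iF.
split=> //; move: iF => /integrableP[mF Foo]; apply/integrableP; split => //.
suff <- : (\int[mu]_(x in circ R) `|\int[mu]_(y in circ R) (h (x, y))%:E| =
  \int[mu]_(x in circ R) `|(EFin \o (fun x => cint (fun y => h (x, y)))) x|)%E by [].
apply: ae_eq_integral => //; try exact: measurableT_comp.
by apply: ae_eq_abse.
Qed.

Lemma cint2_swap h : cintegrable2 h ->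
  cintegrable2 (fun z => h (z.2, z.1)) /\ cint2 (fun z => h (z.2, z.1)) = cint2 h.
Proof.
move=> ih.
have E (g : R -> R -> \bar R) : (forall x y, 0 <= g x y)%E ->
    measurable_fun [set: R * R] (fun z => g z.1 z.2) ->
    (\int[mu]_(x in circ R) \int[mu]_(y in circ R) g x y =
     \int[mu]_(y in circ R) \int[mu]_(x in circ R) g x y)%E.
  move=> g0 mg.
  pose G : R * R -> \bar R := (fun z => g z.1 z.2) \_ (circ R `*` circ R).
  have G0 z : (0 <= G z)%E by rewrite /G patchE; case: ifPn.
  have mG : measurable_fun setT G.
    by apply: (@measurable_restrictT _ _ _ _ _ _ measurable_csquare).1; exact: measurable_funS mg.
  transitivity (\int[mu]_x \int[mu]_y G (x, y))%E.
    rewrite integral_mkcond; apply: eq_integral => x _; rewrite patchE.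
    case: ifPn => xC; last first.
      by rewrite integral0_eq// => y _; rewrite /G patchE in_setX/= (negbTE xC).
    by rewrite integral_mkcond; apply: eq_integral => y _; rewrite /G !patchE in_setX/= xC.
  transitivity (\int[mu]_y \int[mu]_x G (x, y))%E.
    exact: (fubini_tonelli (m1 := mu) (m2 := mu) G mG G0).
  rewrite [RHS]integral_mkcond; apply: eq_integral => y _; rewrite patchE.
  case: ifPn => yC; last first.
    by rewrite integral0_eq// => x _; rewrite /G patchE in_setX/= (negbTE yC) andbF.
  by rewrite [RHS]integral_mkcond; apply: eq_integral => x _; rewrite /G !patchE in_setX/= yC andbT.
have ih2 : cintegrable2 (fun z => h (z.2, z.1)).
  apply: cintegrable2P; first exact: measurable_swap ih.1.
  rewrite (E (fun x y => `|h (y, x)|%:E))//=; last first.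
    apply/measurable_EFinP; apply: measurableT_comp => //.
    exact: (measurable_swap ih.1).
  have := (integrable12ltyP mu mu (ext_mf ih.1)).1 (ext_int ih).
  rewrite (_ : (\int[mu]_x _)%E = (\int[mu]_(x in circ R) \int[mu]_(y in circ R) `|h (x, y)|%:E)%E)//.
  rewrite [RHS]integral_mkcond; apply: eq_integral => x _.
  under eq_integral do rewrite -/(ext h _) ext_abse.
  by rewrite int_ext1 patchE.
split=> //.
have ih' := ext_int ih.
have [-> _] := fubini_ext ih2; have [-> _] := fubini_ext ih; congr fine.
transitivity (\int[mu]_x \int[mu]_y (ext h) (y, x))%E.
  rewrite integral_mkcond; apply: eq_integral => x _; rewrite patchE.
  case: ifPn => xC; last first.
    by rewrite integral0_eq// => y _; rewrite /ext patchE in_setX/= (negbTE xC) andbF.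
  by rewrite integral_mkcond; apply: eq_integral => y _; rewrite /ext !patchE in_setX/= xC andbT.
transitivity (\int[mu]_x \int[mu]_y (ext h) (x, y))%E; first exact/esym/(Fubini ih').
rewrite [RHS]integral_mkcond; apply: eq_integral => x _.
by rewrite int_ext1 patchE.
Qed.

Lemma cint_exchange h : cintegrable2 h ->
  cintegrable (fun y => cint (fun x => h (x, y))) /\
  cint (fun x => cint (fun y => h (x, y))) = cint (fun y => cint (fun x => h (x, y))).
Proof.
move=> ih; have [i2 e2] := cint2_swap ih.
have [_ <-] := cint2_fubini ih; have [] := cint2_fubini i2; rewrite e2.
by [].
Qed.

End circle_fubini.

(** * Hartley series *)

Section hartley.
Context {R : realType}.
Implicit Types (f g : R -> R) (k l : int).
Notation mu := (@lebesgue_measure R).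
Let mC : measurable (circ R) := @measurable_circ R.
Hint Resolve mC : core.

(* The Hartley functions are a real orthogonal substitute for e^(ikx), still indexed by [int]. *)
Definition cas k (x : R) : R := cos (k%:~R * x) + sin (k%:~R * x).

Lemma continuous_cintegrable f : continuous f -> cintegrable f.
Proof.
move=> cf; split; first exact: continuous_measurable_fun.
apply: continuous_compact_integrable; first exact: segment_compact.
exact: continuous_subspaceT.
Qed.

Lemma continuous_sqint f : continuous f -> sqint f.
Proof.
move=> cf; split; first exact: continuous_measurable_fun.
apply: (@continuous_cintegrable (fun x => f x ^+ 2) _).2.
by move=> x; apply: cvgM; exact: cf.
Qed.

Lemma is_derive_continuous (F f : R -> R) :
  (forall x, is_derive x (1 : R) F (f x)) -> continuous F.
Proof.
move=> dF x; apply: differentiable_continuous; apply/derivable1_diffP.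
by case: (dF x).
Qed.

Lemma cint_is_derive (F f : R -> R) : (forall x, is_derive x (1 : R) F (f x)) ->
  continuous f -> cint f = F (2 * pi) - F 0.
Proof.
move=> dF cf; rewrite /cint /Rintegral.
rewrite (@continuous_FTC2 _ f F)//; first exact: pi2_gt0.
- exact: continuous_subspaceT.
- have cF := is_derive_continuous dF.
  split; first by move=> x _; case: (dF x).
  + by apply: cvg_at_right_filter; exact: cF.
  + by apply: cvg_at_left_filter; exact: cF.
- by move=> x _; rewrite derive1E; case: (dF x).
Qed.

Lemma cosDint (x : R) k : cos (x + k%:~R * (2 * pi)) = cos x.
Proof.
have h n (y : R) : cos (y + n%:R * (2 * pi)) = cos y.
  by rewrite mulr_natl -mulr_natl (mulr_natl pi) mulr_natl (periodicn (@cosD2pi R)).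
case: k => n; first by rewrite -pmulrn h.
by rewrite NegzE mulrNz mulNr -pmulrn -[in RHS](subrK (n.+1%:R * (2 * pi)) x) h.
Qed.

Lemma sinDint (x : R) k : sin (x + k%:~R * (2 * pi)) = sin x.
Proof.
have h n (y : R) : sin (y + n%:R * (2 * pi)) = sin y.
  by rewrite mulr_natl -mulr_natl (mulr_natl pi) mulr_natl (periodicn (@sinD2pi R)).
case: k => n; first by rewrite -pmulrn h.
by rewrite NegzE mulrNz mulNr -pmulrn -[in RHS](subrK (n.+1%:R * (2 * pi)) x) h.
Qed.

Lemma cas_periodic k : periodic2pi (cas k).
Proof. by move=> x; rewrite /cas mulrDr cosDint sinDint. Qed.

Lemma casN k (x : R) : cas (- k) x = cos (k%:~R * x) - sin (k%:~R * x).
Proof. by rewrite /cas mulrNz mulNr cosN sinN. Qed.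

Lemma cosE_cas k (x : R) : cos (k%:~R * x) = (cas k x + cas (- k) x) / 2.
Proof. by rewrite casN /cas; field. Qed.

Lemma sinE_cas k (x : R) : sin (k%:~R * x) = (cas k x - cas (- k) x) / 2.
Proof. by rewrite casN /cas; field. Qed.

Lemma cas0 (x : R) : cas 0 x = 1.
Proof. by rewrite /cas mul0r cos0 sin0 addr0. Qed.

(** The reversal of the index stands for multiplication by i, and is the source of the reflected
    indices in [hc_derive] and [derive1_trig]. *)
Lemma is_derive_cas k (x : R) : is_derive x (1 : R) (cas k) (k%:~R * cas (- k) x).
Proof.
rewrite casN.
have d1 : is_derive x (1 : R) (fun x => k%:~R * x) (k%:~R : R).
  have : is_derive x (1 : R) (k%:~R *: (@id R)) (k%:~R *: (1 : R)) by exact: is_deriveZ.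
  by rewrite [X in is_derive _ _ _ X]/GRing.scale/= mulr1.
have dc : is_derive x (1 : R) (cos \o (fun x => k%:~R * x)) (- sin (k%:~R * x) * k%:~R).
  exact: is_derive1_comp.
have ds : is_derive x (1 : R) (sin \o (fun x => k%:~R * x)) (cos (k%:~R * x) * k%:~R).
  exact: is_derive1_comp.
apply: is_derive_eq (is_deriveD dc ds) _; by ring.
Qed.

Lemma continuous_cas k : continuous (cas k).
Proof. exact: is_derive_continuous (is_derive_cas k). Qed.

Lemma measurable_cas k : measurable_fun [set: R] (cas k).
Proof. by apply: continuous_measurable_fun; exact: continuous_cas. Qed.

Lemma sqint_cas k : sqint (cas k).
Proof. by apply: continuous_sqint; exact: continuous_cas. Qed.

Lemma norm_cas_le2 k (x : R) : `|cas k x| <= 2.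
Proof.
rewrite (le_trans (ler_normD _ _))// (_ : 2 = 1 + 1)//.
by rewrite lerD// ?cos_max// sin_max.
Qed.

(** Both frequencies k - l and k + l appear, which is why each matrix bound below has two decaying
    terms. *)
Lemma casM k l (x : R) :
  cas k x * cas l x = cos ((k - l)%:~R * x) + sin ((k + l)%:~R * x).
Proof.
rewrite intrB intrD [(k%:~R - _) * x]mulrBl [(k%:~R + _) * x]mulrDl cosB sinD.
by rewrite /cas; ring.
Qed.

Lemma cint_cas k : cint (cas k) = (2 * pi) * (k == 0)%:R.
Proof.
have [->|k0] := eqVneq k 0.
  by rewrite (eq_cint (g := fun=> 1)) ?cint_cst ?mul1r ?mulr1// => x _; rewrite cas0.
have k0' : k%:~R != 0 :> R by rewrite intr_eq0.
have dF x : is_derive x (1 : R) (fun x => (- k%:~R^-1) * cas (- k) x) (cas k x).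
  apply: is_derive_eq (is_deriveZ (- k%:~R^-1) (is_derive_cas (- k) x)) _.
  by rewrite opprK /GRing.scale/= mulrNz mulrA mulrNN mulVf// mul1r.
rewrite mulr0 (cint_is_derive dF (@continuous_cas k)).
by rewrite -{1}[2 * pi]add0r cas_periodic subrr.
Qed.

Lemma cint_cos k : cint (fun x : R => cos (k%:~R * x)) = (2 * pi) * (k == 0)%:R.
Proof.
rewrite (eq_cint (g := fun x => 2^-1 * (cas k x + cas (- k) x))); last first.
  by move=> x _; rewrite cosE_cas mulrC.
have i k' : cintegrable (cas k') by apply: sqint_L1; exact: sqint_cas.
rewrite cintZ; last exact: (cintegrableD (i _) (i _)).
rewrite (cintD (i _) (i _)).
by rewrite !cint_cas oppr_eq0; field.
Qed.

Lemma cint_sin k : cint (fun x : R => sin (k%:~R * x)) = 0.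
Proof.
rewrite (eq_cint (g := fun x => 2^-1 * (cas k x - cas (- k) x))); last first.
  by move=> x _; rewrite sinE_cas mulrC.
have i k' : cintegrable (cas k') by apply: sqint_L1; exact: sqint_cas.
rewrite cintZ; last exact: (cintegrableB (i _) (i _)).
rewrite (cintB (i _) (i _)).
by rewrite !cint_cas oppr_eq0 subrr mulr0.
Qed.

Lemma continuous_scale (a : R) : continuous (fun x => a * x).
Proof. by move=> x; apply: cvgM; [exact: cvg_cst|exact: cvg_id]. Qed.

Lemma continuous_cosk k : continuous (fun x : R => cos (k%:~R * x)).
Proof. by move=> x; apply: continuous_comp; [exact: continuous_scale|exact: continuous_cos]. Qed.

Lemma continuous_sink k : continuous (fun x : R => sin (k%:~R * x)).
Proof. by move=> x; apply: continuous_comp; [exact: continuous_scale|exact: continuous_sin]. Qed.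

Lemma ip_cas k l : ip (cas k) (cas l) = (2 * pi) * (k == l)%:R.
Proof.
rewrite /ip (eq_cint (g := fun x => cos ((k - l)%:~R * x) + sin ((k + l)%:~R * x))); last first.
  by move=> x _; rewrite casM.
rewrite cintD; first by rewrite cint_cos cint_sin addr0 subr_eq0.
- by apply: continuous_cintegrable; exact: continuous_cosk.
- by apply: continuous_cintegrable; exact: continuous_sink.
Qed.

(** Normalised by 2 pi, the value of [sqn (cas k)]. *)
Definition hc k f : R := ip f (cas k) / (2 * pi).

Definition irange (n : nat) : seq int := [seq (i%:Z - n%:Z)%R | i <- iota 0 (n.*2.+1)].

Lemma mem_irange n k : (k \in irange n) = (`|k| <= n)%N.
Proof.
apply/mapP/idP => [|kn].
  by case=> i; rewrite mem_iota => /andP[_ ih] ->; lia.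
exists (absz (k + n%:Z)%R); last by lia.
by rewrite mem_iota; lia.
Qed.

Lemma irange_uniq n : uniq (irange n).
Proof. by rewrite map_inj_uniq ?iota_uniq// => i j; lia. Qed.

Definition trig (s : seq int) (c : int -> R) (x : R) : R := \sum_(k <- s) c k * cas k x.

Lemma trig_periodic s c : periodic2pi (trig s c).
Proof. by move=> x; apply: eq_bigr => k _; rewrite cas_periodic. Qed.

Lemma continuous_trig s c : continuous (trig s c).
Proof.
move=> x; rewrite /trig; elim: s => [|k s ih].
  by under eq_fun do rewrite big_nil; exact: cvg_cst.
under eq_fun do rewrite big_cons.
apply: cvgD => //; apply: cvgM; [exact: cvg_cst|exact: continuous_cas].
Qed.

Lemma sqint_trig s c : sqint (trig s c).
Proof. by apply: continuous_sqint; exact: continuous_trig. Qed.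

Lemma ip_trig s c f : sqint f -> ip (trig s c) f = \sum_(k <- s) c k * ip (cas k) f.
Proof.
move=> sf; rewrite ip_suml//; last by move=> k; apply: sqintZ; exact: sqint_cas.
by apply: eq_bigr => k _; rewrite ipZl//; exact: sqint_cas.
Qed.

Lemma ip_hc k f : ip f (cas k) = 2 * pi * hc k f.
Proof. by rewrite /hc mulrC divfK// gt_eqF// pi2_gt0. Qed.

Lemma hc_trig s c k : uniq s -> hc k (trig s c) = if k \in s then c k else 0.
Proof.
move=> us; rewrite /hc ip_trig; last exact: sqint_cas.
under eq_bigr do rewrite ip_cas.
have p0 := pi2_gt0 (R := R).
case: ifPn => ks.
  rewrite (bigD1_seq k)//= eqxx big1 ?addr0.
    by rewrite mulr1 mulfK// gt_eqF.
  by move=> i ik; rewrite (negbTE ik) !mulr0.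
rewrite big1_seq ?mul0r// => i /andP[_ si].
have [ik|_] := eqVneq i k; last by rewrite !mulr0.
by rewrite -ik si in ks.
Qed.

Lemma sqn_trig s c : uniq s -> sqn (trig s c) = 2 * pi * \sum_(k <- s) c k ^+ 2.
Proof.
move=> us; rewrite /sqn ip_trig; last exact: sqint_trig.
rewrite mulr_sumr big_seq [RHS]big_seq; apply: eq_bigr => k ks.
by rewrite ipC ip_hc hc_trig// ks; ring.
Qed.

Lemma hcB k f g : sqint f -> sqint g -> hc k (fun x => f x - g x) = hc k f - hc k g.
Proof. by move=> sf sg; rewrite /hc ipBl ?mulrBl//; exact: sqint_cas. Qed.

Lemma hcZ k a f : sqint f -> hc k (fun x => a * f x) = a * hc k f.
Proof. by move=> sf; rewrite /hc ipZl ?mulrA//; exact: sqint_cas. Qed.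

Lemma bessel_eq s f : uniq s -> sqint f ->
  sqn (fun x => f x - trig s (hc^~ f) x) = sqn f - 2 * pi * \sum_(k <- s) hc k f ^+ 2.
Proof.
move=> us sf; rewrite (sqnB sf (sqint_trig _ _)) sqn_trig// ipC ip_trig//.
under eq_bigr do rewrite ipC ip_hc.
rewrite (_ : \sum_(k <- s) _ = 2 * pi * \sum_(k <- s) hc k f ^+ 2); first by ring.
by rewrite mulr_sumr; apply: eq_bigr => k _; ring.
Qed.

Lemma bessel s f : uniq s -> sqint f -> 2 * pi * \sum_(k <- s) hc k f ^+ 2 <= sqn f.
Proof. by move=> us sf; rewrite -subr_ge0 -bessel_eq// sqn_ge0. Qed.

Lemma hc_sqr_le k f : sqint f -> hc k f ^+ 2 <= sqn f / (2 * pi).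
Proof.
move=> sf; rewrite ler_pdivlMr ?pi2_gt0// mulrC.
by have := @bessel [:: k] f erefl sf; rewrite big_seq1.
Qed.

End hartley.

(** * Peak kernels: vanishing coefficients at a point of continuity *)

Section trig_complete.
Context {R : realType}.
Implicit Types (f g : R -> R) (k l : int).
Notation mu := (@lebesgue_measure R).
Let mC : measurable (circ R) := @measurable_circ R.
Hint Resolve mC : core.

Lemma continuous_bounded_circ g : continuous g ->
  exists M : R, forall x, circ R x -> `|g x| <= M.
Proof.
move=> cg; have [|c _ hc] := @EVT_max R (fun x => `|g x|) 0 (2 * pi) (ltW pi2_gt0).
  by apply: continuous_subspaceT => x; apply: cvg_norm; exact: cg.
by exists `|g c| => x Cx; apply: hc.
Qed.

Lemma cintegrableM_bounded f g (M : R) : cintegrable f -> measurable_fun [set: R] g ->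
  (forall x, circ R x -> `|g x| <= M) -> cintegrable (fun x => f x * g x).
Proof.
move=> i_f mg gM; apply: (le_cintegrable _ (cintegrableZ M i_f)).
  by apply: measurable_funM => //; exact: cintegrable_mf.
move=> x Cx; rewrite !normrM mulrC ler_wpM2r//.
by rewrite (le_trans (gM _ Cx))// ler_norm.
Qed.

Lemma cintegrableM_continuous f g : cintegrable f -> continuous g ->
  cintegrable (fun x => f x * g x).
Proof.
move=> i_f cg; have [M gM] := continuous_bounded_circ cg.
by apply: cintegrableM_bounded gM => //; exact: continuous_measurable_fun.
Qed.

Lemma cintegrable2_bound (h : R * R -> R) g : measurable_fun [set: R * R] h ->
  cintegrable g ->
  (forall x y, circ R x -> circ R y -> `|h (x, y)| <= g y) -> cintegrable2 h.
Proof.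
move=> mh ig hg; apply: cintegrable2P => //.
apply: (@le_lt_trans _ _ (\int[mu]_(x in circ R) (cint g)%:E)%E).
  apply: ge0_le_integral => //.
  - by move=> x Cx; exact: integral_ge0.
  - pose H : R * R -> \bar R := (EFin \o (fun z => `|h z|)) \_ (setT `*` circ R).
    have mH : measurable_fun [set: R * R] H.
      apply: (@measurable_restrictT _ _ _ _ _ _ (measurableX measurableT mC)).1.
      by apply/measurable_EFinP; apply: measurableT_comp => //; exact: measurable_funS mh.
    have := measurable_fun_fubini_tonelli_F (m2 := mu) H mH.
    move=> /(_ _)/wrap[|].
      by move=> z; rewrite /H patchE; case: ifPn => //= _; rewrite lee_fin.
    move=> mF; apply: (@measurable_funS _ _ _ _ setT) => //.
    move: mF; congr measurable_fun; apply/funext => x; rewrite [RHS]integral_mkcond.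
    by apply: eq_integral => y _; rewrite /H !patchE in_setX/= in_setT.
  - move=> x Cx; rewrite EFin_cint//; apply: ge0_le_integral => //.
    + apply/measurable_EFinP; apply: measurableT_comp => //; apply: measurable_funS (_ : measurable_fun setT _) => //.
      by apply: (measurableT_comp mh); exact: measurable_fun_pair.
    + by apply/measurable_EFinP; apply: measurable_funS ig.1.
    + by move=> y Cy; rewrite lee_fin hg.
rewrite integral_cst//; apply: lte_mul_pinfty => //; last exact: mu_circ_fin.
rewrite lee_fin; apply: cint_ge0 => y Cy; rewrite (le_trans _ (hg 0 y _ Cy))//.
by rewrite /circ/= in_itv/= lexx ltW// pi2_gt0.
Qed.

(** The span of the Hartley functions is stable under multiplication by cos(x - x0) + b, so
    orthogonality to all of them passes to the powers of this factor by induction. *)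
Let cas_mul_q k (x x0 b : R) : cas k x * (cos (x - x0) + b) =
  b * cas k x + cos x0 / 2 * (cas (k + 1) x + cas (k - 1) x)
  + sin x0 / 2 * (cas (- (k - 1)) x - cas (- (k + 1)) x).
Proof.
rewrite !casN /cas intrB intrD [(_ + 1%:~R) * x]mulrDl [(_ - 1%:~R) * x]mulrBl.
rewrite !mulr1z !mul1r !(cosD, sinD) !(cosN, sinN).
by field.
Qed.

Let continuous_q (x0 b : R) n : continuous (fun x => (cos (x - x0) + b) ^+ n).
Proof.
move=> x.
apply: (@continuous_comp _ _ _ (fun x => cos (x - x0) + b) (fun y => y ^+ n)); last exact: exprn_continuous.
apply: (@cvgD _ _ _ _ _ (fun x => cos (x - x0)) (fun=> b)); last exact: cvg_cst.
apply: (@continuous_comp _ _ _ (fun x => x - x0) cos); last exact: continuous_cos.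
by apply: (@cvgB _ _ _ _ _ id (fun=> x0)); [exact: cvg_id|exact: cvg_cst].
Qed.

Let q_orth f x0 b : cintegrable f -> (forall k, cint (fun x => f x * cas k x) = 0) ->
  forall n k, cint (fun x => f x * (cas k x * (cos (x - x0) + b) ^+ n)) = 0.
Proof.
move=> i_f h; have cq n := @continuous_q x0 b n.
have ik n k : cintegrable (fun x => f x * (cas k x * (cos (x - x0) + b) ^+ n)).
  apply: cintegrableM_continuous => // x; apply: cvgM; last exact: cq.
  exact: continuous_cas.
elim=> [|n ih] k.
  by under eq_cint do rewrite expr0 mulr1.
rewrite (eq_cint (g := fun x =>
   b * (f x * (cas k x * (cos (x - x0) + b) ^+ n)) +
   (cos x0 / 2 * (f x * (cas (k + 1) x * (cos (x - x0) + b) ^+ n)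
                + f x * (cas (k - 1) x * (cos (x - x0) + b) ^+ n)) +
   sin x0 / 2 * (f x * (cas (- (k - 1)) x * (cos (x - x0) + b) ^+ n)
               - f x * (cas (- (k + 1)) x * (cos (x - x0) + b) ^+ n))))); last first.
  move=> x _; rewrite exprS (mulrA (cas k x)) cas_mul_q; ring.
have iD u v : cintegrable u -> cintegrable v -> cintegrable (fun x : R => u x + v x).
  exact: cintegrableD.
rewrite cintD; [|exact: cintegrableZ|apply: cintegrableD; apply: cintegrableZ; [exact: cintegrableD|exact: cintegrableB]].
rewrite cintD; [|by apply: cintegrableZ; exact: cintegrableD|by apply: cintegrableZ; exact: cintegrableB].
rewrite !cintZ//; [|exact: cintegrableB|exact: cintegrableD].
by rewrite cintD// cintB// !ih !(mulr0, addr0, subr0).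
Qed.

Let cos_le_cos (x y : R) : 0 <= x -> x <= y -> y <= pi -> cos y <= cos x.
Proof.
move=> x0 xy yp; rewrite le_eqVlt; have [->|nxy] := eqVneq x y; first by rewrite eqxx.
by rewrite ltr_cos ?lt_neqAle ?nxy ?xy ?orbT// in_itv/= ?x0 ?yp ?(le_trans xy)// (le_trans x0).
Qed.

Lemma bernoulli (e : R) n : 0 <= e -> 1 + n%:R * e <= (1 + e) ^+ n.
Proof.
move=> e0; elim: n => [|n ih]; first by rewrite mul0r addr0 expr0.
rewrite exprS; apply: le_trans (ler_wpM2l (addr_ge0 ler01 e0) ih).
have : 0 <= n%:R * e * e by rewrite !mulr_ge0.
by rewrite -natr1; lra.
Qed.

(* [cos (x - x0) + 1 - cos d] exceeds 1 exactly at distance less than d from x0, so its powers form a peak kernel. *)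
Lemma peak_le0 f x0 : cintegrable f -> {for x0, continuous f} -> 0 < x0 < 2 * pi ->
  (forall k, cint (fun x => f x * cas k x) = 0) -> f x0 <= 0.
Proof.
move=> i_f cf /andP[x00 x0p] hf; rewrite leNgt; apply/negP => a0.
have /nbhs_ballP[e /= e0 he] : \forall x \near x0, f x0 / 2 <= f x.
  have : f x0 / 2 < f x0 by rewrite ltr_pdivrMr// ltr_pMr// ltr1n.
  by move=> h; apply: (cvgr_ge _ cf).
(* Within distance d of x0 the function stays above f x0 / 2 and the circle is not left; the last
   two bounds also give d <= pi. *)
pose d := Num.min (e / 2) (Num.min x0 (2 * pi - x0)).
have d0 : 0 < d by rewrite !lt_min divr_gt0//= x00 subr_gt0.
have [de dx dy] : [/\ d <= e / 2, d <= x0 & d <= 2 * pi - x0].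
  by split; rewrite !ge_min lexx ?orbT.
have dpi : d <= pi by move: dx dy; lra.
pose b := 1 - cos d; pose q x := cos (x - x0) + b.
pose eta := cos (d / 2) - cos d.
have eta0 : 0 < eta.
  by rewrite subr_gt0 ltr_cos ?in_itv/=; [lra|apply/andP; split; lra|apply/andP; split; lra].
have q1 x : `|x - x0| <= d -> 1 <= q x.
  move=> xd; rewrite /q /b -cos_norm.
  by have := cos_le_cos (normr_ge0 _) xd dpi; lra.
have q2 x : `|x - x0| <= d / 2 -> 1 + eta <= q x.
  move=> xd; rewrite /q /b /eta -(cos_norm (x - x0)).
  have := @cos_le_cos `|x - x0| (d / 2) (normr_ge0 _) xd; move=> /(_ _)/wrap[]; first lra.
  by lra.
have q3 x : circ R x -> d < `|x - x0| -> `|q x| <= 1.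
  rewrite /circ/= in_itv/= => /andP[x1 x2] xd.
  have c1 : cos (x - x0) <= cos d.
    rewrite -cos_norm; have [xp|xp] := leP `|x - x0| pi.
      by apply: cos_le_cos => //; exact: ltW.
    (* Beyond pi the distance is reflected to 2 pi - |x - x0|, which is still at least d because d
       <= x0 and d <= 2 pi - x0. *)
    rewrite -(cosN `|_|) -(@cosD2pi R) -mulr_natl addrC.
    apply: cos_le_cos; [exact: ltW| |lra].
    by have [xx|xx] := ger0P (x - x0); lra.
  rewrite /q /b ler_norml; have := cos_geN1 (x - x0); have := cos_le1 d.
  by move=> h1 h2; apply/andP; split; lra.
pose J := `[x0 - d / 2, x0 + d / 2]%classic.
have JC : J `<=` circ R.
  by move=> x; rewrite /J /circ/= !in_itv/= => /andP[? ?]; apply/andP; split; lra.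
have muJ : mu J = d%:E.
  rewrite /J lebesgue_measure_itv/= lte_fin ifT; last by lra.
  by rewrite -EFinB; congr EFin; lra.
have J1 : cint (\1_J) = d.
  rewrite /cint /Rintegral integral_indic//; last exact: measurable_itv.
  by rewrite setIidl// -[fine _]/(fine (mu J)) muJ.
have iJ : cintegrable (\1_J : R -> R).
  apply: (bounded_cintegrable (M := 1)).
    by apply: measurable_indic; exact: measurable_itv.
  by move=> x _; rewrite indicE; case: (_ \in _); rewrite ?normr1 ?normr0.
(* On J the integrand f q^n is at least f x0 / 2 times the Bernoulli bound, between J and distance d
   it is nonnegative, and beyond it is at least -|f|. The left side is unbounded in n, the right
   side is fixed. *)
have key n : f x0 / 2 * (1 + n%:R * eta) * d <= cint (fun x => `|f x|).
  have cq : continuous (fun x => q x ^+ n) by exact: continuous_q.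
  have := @q_orth f x0 b i_f hf n 0.
  rewrite (eq_cint (g := fun x => f x * q x ^+ n)); last first.
    by move=> x _; rewrite cas0 mul1r.
  move=> h0; rewrite -subr_ge0 -oppr_le0 opprB -J1 -cintZ// -cintB//; last first.
  - exact: cintegrable_norm.
  - exact: cintegrableZ.
  rewrite -h0; apply: le_cint.
  - by apply: cintegrableB; [exact: cintegrableZ|exact: cintegrable_norm].
  - exact: cintegrableM_continuous.
  move=> x Cx; have [xd|xd] := leP `|x - x0| d; last first.
    rewrite indicE memNset ?mulr0 ?sub0r; last first.
      rewrite /J/= in_itv/= => /andP[? ?]; move: xd; rewrite ltNge => /negP; apply.
      by rewrite ler_norml; apply/andP; split; lra.
    rewrite lerNl (le_trans (ler_norm _))// normrN normrM ler_piMr//.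
    by rewrite normrX exprn_ile1// q3.
  have fx : f x0 / 2 <= f x.
    apply: he; rewrite /ball/= distrC (le_lt_trans xd)//; lra.
  have fx_ge0 : 0 <= f x by rewrite (le_trans _ fx)// divr_ge0// ltW.
  rewrite lerBlDr indicE; have [xJ|xJ] := boolP (x \in J); last first.
    rewrite mulr0 addr_ge0// mulr_ge0// exprn_ge0// (le_trans _ (q1 _ xd))//.
  rewrite mulr1 (@le_trans _ _ (f x * q x ^+ n))//; last by rewrite lerDl.
  have qx : 1 + eta <= q x.
    apply: q2; move: xJ; rewrite inE /J/= in_itv/= => /andP[? ?].
    by rewrite ler_norml; apply/andP; split; lra.
  have bern := bernoulli n (ltW eta0).
  apply: ler_pM => //; first by rewrite divr_ge0// ltW.
    by rewrite addr_ge0// mulr_ge0// ltW.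
  rewrite (le_trans bern)// lerXn2r ?nnegrE//; first by rewrite addr_ge0// ltW.
  by rewrite (le_trans _ qx)// addr_ge0// ltW.
pose A := cint (fun x => `|f x|).
have c0 : 0 < f x0 / 2 * eta * d by rewrite !mulr_gt0// invr_gt0.
have := key (Num.truncn (A / (f x0 / 2 * eta * d))).+1.
have : A / (f x0 / 2 * eta * d) < (Num.truncn (A / (f x0 / 2 * eta * d))).+1%:R.
  by rewrite truncnS_gt// .
rewrite ltr_pdivrMr// -/A; move: (_.+1%:R) => t tA.
have : 0 < f x0 / 2 * d by rewrite !mulr_gt0// invr_gt0.
move=> h1; rewrite (_ : _ * d = f x0 / 2 * d + t * (f x0 / 2 * eta * d)); last by ring.
by lra.
Qed.

Lemma continuous_coef0 f x0 : cintegrable f -> {for x0, continuous f} ->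
  0 < x0 < 2 * pi ->
  (forall k, cint (fun x => f x * cas k x) = 0) -> f x0 = 0.
Proof.
move=> i_f cf x0p hf; apply/eqP; rewrite eq_le peak_le0//=.
rewrite -oppr_le0; apply: (@peak_le0 (fun x => - f x)) => //.
- exact: cintegrableN.
- exact: cvgN.
- move=> k; under eq_cint do rewrite mulNr; rewrite cintN ?hf ?oppr0//.
  by apply: cintegrableM_continuous => //; exact: continuous_cas.
Qed.

End trig_complete.

(** * Completeness of the Hartley system in L^1 *)

Section parseval.
Context {R : realType}.
Implicit Types (f g : R -> R) (k l : int).
Notation mu := (@lebesgue_measure R).
Let mC : measurable (circ R) := @measurable_circ R.
Hint Resolve mC : core.

Lemma aec_interior (P : R -> Prop) :
  {ae mu, forall x, 0 < x < 2 * pi -> P x} -> aec P.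
Proof.
move=> h; have n0 (a : R) : {ae mu, forall x, x != a}.
  exists [set a]; split => //; first exact: lebesgue_measure_set1.
  by move=> x /= /negP/negPn/eqP.
rewrite /aec; apply: filterS3 h (n0 0) (n0 (2 * pi)) => x hx x0 xp.
rewrite /circ/= in_itv/= => /andP[x1 x2]; apply: hx.
by rewrite !lt_neqAle x1 x2 xp eq_sym x0.
Qed.

Lemma measurable_le_set : measurable [set z : R * R | z.2 <= z.1].
Proof.
rewrite (_ : [set _ | _] = (fun z : R * R => z.1 - z.2) @^-1` `[0, +oo[%classic); last first.
  by apply/seteqP; split => z /=; rewrite in_itv/= andbT subr_ge0.
rewrite -[X in measurable X]setTI.
have mf : measurable_fun [set: R * R] (fun z : R * R => z.1 - z.2).
  by apply: measurable_funB; [exact: measurable_fst|exact: measurable_snd].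
exact: mf.
Qed.

Let measurable_ind : measurable_fun [set: R * R] (\1_[set z : R * R | z.2 <= z.1] : R * R -> R).
Proof. by apply: measurable_indic; exact: measurable_le_set. Qed.

Let restr f : R -> R := f \_ (circ R).
Let prim f x : R := \int[mu]_(t in `[0, x]) restr f t.

(** The indicator of the triangle y <= x makes the primitive a double integral accessible to Fubini,
    while [prim] is the form to which the fundamental theorem of calculus applies. *)
Let prim_cint f x : circ R x -> prim f x = cint (fun y => f y * \1_[set z : R * R | z.2 <= z.1] (x, y)).
Proof.
rewrite /circ/= in_itv/= => /andP[x0 xp].
rewrite /prim /cint Rintegral_mkcond [RHS]Rintegral_mkcond.
apply: eq_Rintegral => y _; rewrite /restr !patchE indicE.
have -> : (y \in `[0, x]%classic) = (0 <= y <= x) by apply/idP/idP; rewrite inE/= in_itv/=.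
rewrite in_circ.
have -> : ((x, y) \in [set z : R * R | z.2 <= z.1]) = (y <= x) by apply/idP/idP; rewrite inE.
case: (leP 0 y) => //= y0; case: (leP y x) => yx; rewrite ?mulr0 ?mulr1//.
by case: ifP.
Qed.

Let prim_mf f : measurable_fun [set: R] f ->
  measurable_fun [set: R] (fun x => cint (fun y => f y * \1_[set z : R * R | z.2 <= z.1] (x, y))).
Proof.
move=> mf.
apply: (measurable_cint_param (h := fun z => f z.2 * \1_[set z : R * R | z.2 <= z.1] z)).
apply: measurable_funM; first exact: (measurableT_comp mf measurable_snd).
by apply: measurable_indic; exact: measurable_le_set.
Qed.

Let restr_int f : cintegrable f -> mu.-integrable setT (EFin \o restr f).
Proof.
move=> [mf i_f]; rewrite /restr -restrict_EFin.
exact: (@integrable_mkcond _ _ _ mu _ (EFin \o f) mC).1 i_f.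
Qed.

Let prim_continuous f x0 : cintegrable f -> 0 < x0 < 2 * pi ->
  {for x0, continuous (fun x => cint (fun y => f y * \1_[set z : R * R | z.2 <= z.1] (x, y)))}.
Proof.
move=> i_f /andP[x00 x0p].
have ii : mu.-integrable `[0, 2 * pi] (EFin \o restr f).
  apply: integrableS (restr_int i_f) => //.
have /(continuous_within_itvP _ pi2_gt0)[+ _ _] :=
  @parameterized_integral_continuous R 0 (2 * pi) (restr f) (ltW pi2_gt0) ii.
move=> /(_ x0); rewrite in_itv/= x00 x0p => /(_ isT) h.
have E x : circ R x -> parameterized_integral mu 0 x (restr f) =
   cint (fun y => f y * \1_[set z : R * R | z.2 <= z.1] (x, y)).
  by move=> Cx; rewrite -prim_cint.
rewrite /prop_for /continuous_at -E; last by rewrite /circ/= in_itv/= !ltW.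
apply: cvg_trans h; apply: near_eq_cvg.
have : \forall x \near x0, x \in `]0, 2 * pi[ by apply: near_in_itvoo; rewrite in_itv/= x00.
by apply: filterS => x; rewrite in_itv/= => /andP[? ?]; rewrite E// /circ/= in_itv/= !ltW.
Qed.

Let tail_cas k y : k != 0 -> circ R y ->
  cint (fun x => cas k x * \1_[set z : R * R | z.2 <= z.1] (x, y)) =
  (cas (- k) y - cas (- k) (2 * pi)) / k%:~R.
Proof.
move=> k0; rewrite /circ/= in_itv/= => /andP[y0 yp].
have k0' : k%:~R != 0 :> R by rewrite intr_eq0.
transitivity (\int[mu]_(x in `[y, 2 * pi]) cas k x).
  rewrite /cint Rintegral_mkcond [RHS]Rintegral_mkcond.
  apply: eq_Rintegral => x _; rewrite !patchE indicE.
  have -> : (x \in `[y, 2 * pi]%classic) = (y <= x <= 2 * pi) by apply/idP/idP; rewrite inE/= in_itv/=.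
  rewrite in_circ.
  have -> : ((x, y) \in [set z : R * R | z.2 <= z.1]) = (y <= x) by apply/idP/idP; rewrite inE.
  case: (leP y x) => /= yx; last by rewrite mulr0; case: ifP.
  by rewrite mulr1 (le_trans y0).
move: yp; rewrite le_eqVlt => /predU1P[->|yp].
  by rewrite set_itv1 Rintegral_set1 subrr mul0r.
have dF x : is_derive x (1 : R) (fun x => (- k%:~R^-1) * cas (- k) x) (cas k x).
  apply: is_derive_eq (is_deriveZ (- k%:~R^-1) (is_derive_cas (- k) x)) _.
  by rewrite opprK /GRing.scale/= mulrNz mulrA mulrNN mulVf// mul1r.
rewrite /Rintegral (@continuous_FTC2 _ (cas k) (fun x => (- k%:~R^-1) * cas (- k) x))//=.
- by field.
- by apply: continuous_subspaceT; exact: continuous_cas.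
- have cF := is_derive_continuous dF.
  split; first by move=> x _; case: (dF x).
  + by apply: cvg_at_right_filter; exact: cF.
  + by apply: cvg_at_left_filter; exact: cF.
- by move=> x _; rewrite derive1E; case: (dF x).
Qed.

(** Exchanging the integrals replaces [cas k] by its integral over [y, 2 pi], a combination of
    [cas (- k)] and a constant, and f is orthogonal to both. *)
Let prim_coef f k : cintegrable f -> (forall k, cint (fun x => f x * cas k x) = 0) ->
  k != 0 ->
  cint (fun x => cint (fun y => f y * \1_[set z : R * R | z.2 <= z.1] (x, y)) * cas k x) = 0.
Proof.
move=> i_f hf k0.
pose h (z : R * R) := cas k z.1 * (f z.2 * \1_[set z : R * R | z.2 <= z.1] z).
have mh : measurable_fun [set: R * R] h.
  apply: measurable_funM; first exact: (measurableT_comp (measurable_cas k) measurable_fst).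
  apply: measurable_funM; first exact: (measurableT_comp i_f.1 measurable_snd).
  by apply: measurable_indic; exact: measurable_le_set.
have ih : cintegrable2 h.
  apply: (cintegrable2_bound (g := fun y => 2 * `|f y|) mh).
    by apply: cintegrableZ; exact: cintegrable_norm.
  move=> x y _ _; rewrite /h/= normrM ler_pM// ?norm_cas_le2// normrM ler_piMr//.
  by rewrite indicE; case: (_ \in _); rewrite ?normr1 ?normr0.
have i1 x : cintegrable (fun y => f y * \1_[set z : R * R | z.2 <= z.1] (x, y)).
  apply: (cintegrableM_bounded (M := 1)) => //.
    apply: (measurableT_comp measurable_ind).
    exact: measurable_fun_pair.
  by move=> y _; rewrite indicE; case: (_ \in _); rewrite ?normr1 ?normr0.
rewrite (eq_cint (g := fun x => cint (fun y => h (x, y)))); last first.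
  by move=> x _; rewrite /h/= cintZ// mulrC.
rewrite (cint_exchange ih).2.
rewrite (eq_cint (g := fun y => k%:~R^-1 * (f y * cas (- k) y) - (k%:~R^-1 * cas (- k) (2 * pi)) * f y)).
  rewrite cintB; last 2 first.
  - by apply: cintegrableZ; apply: cintegrableM_continuous => //; exact: continuous_cas.
  - exact: cintegrableZ.
  rewrite !cintZ//; last by apply: cintegrableM_continuous => //; exact: continuous_cas.
  rewrite hf; have := hf 0; under eq_cint do rewrite cas0 mulr1.
  by move=> ->; rewrite !mulr0 subr0.
move=> y Cy; rewrite /h/=.
rewrite (eq_cint (g := fun x => f y * (cas k x * \1_[set z : R * R | z.2 <= z.1] (x, y)))); last first.
  by move=> x _; ring.
rewrite cintZ ?tail_cas//; first by ring.
apply: (cintegrableM_bounded (M := 1)).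
- by apply: sqint_L1; exact: sqint_cas.
- apply: (measurableT_comp measurable_ind).
  exact: measurable_fun_pair.
by move=> x _; rewrite indicE; case: (_ \in _); rewrite ?normr1 ?normr0.
Qed.

(** Since f need not be continuous, the peak kernel is applied to its primitive minus the mean
    value. The primitive is thus constant inside the circle, and differentiating it almost
    everywhere gives f = 0. *)
Lemma trig_complete f : cintegrable f -> (forall k, cint (fun x => f x * cas k x) = 0) ->
  aec (fun x => f x = 0).
Proof.
move=> i_f hf.
pose F x := cint (fun y => f y * \1_[set z : R * R | z.2 <= z.1] (x, y)).
have iF : cintegrable F.
  apply: (bounded_cintegrable (M := cint (fun y => `|f y|)) (prim_mf i_f.1)) => x _.
  have i1 : cintegrable (fun y => f y * \1_[set z : R * R | z.2 <= z.1] (x, y)).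
    apply: (cintegrableM_bounded (M := 1)) => //.
      apply: (measurableT_comp measurable_ind).
      exact: measurable_fun_pair.
    by move=> y _; rewrite indicE; case: (_ \in _); rewrite ?normr1 ?normr0.
  apply: le_trans (le_norm_cint i1) _; apply: le_cint; try exact: cintegrable_norm.
  move=> y _; rewrite normrM ler_piMr//.
  by rewrite indicE; case: (_ \in _); rewrite ?normr1 ?normr0.
pose c := cint F / (2 * pi).
have p0 := pi2_gt0 (R := R).
have Fc x : 0 < x < 2 * pi -> F x = c.
  move=> x0p; apply/eqP; rewrite -subr_eq0; apply/eqP.
  apply: (@continuous_coef0 R (fun x => F x - c)) => //.
  - by apply: cintegrableB => //; exact: cintegrable_cst.
  - by apply: (@cvgB _ _ _ _ _ F (fun=> c)); [exact: prim_continuous|exact: cvg_cst].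
  - move=> k; have icas : cintegrable (cas k : R -> R) by apply: sqint_L1; exact: sqint_cas.
    rewrite (eq_cint (g := fun x => F x * cas k x - c * cas k x)); last first.
      by move=> y _; rewrite mulrBl.
    rewrite cintB ?cintZ//; last 2 first.
    + by apply: cintegrableM_continuous => //; exact: continuous_cas.
    + exact: cintegrableZ.
    rewrite cint_cas; have [->|k0] := eqVneq k 0.
      under eq_cint do rewrite cas0 mulr1.
      by rewrite mulr1 /c divfK ?subrr// gt_eqF.
    by rewrite !mulr0 subr0 prim_coef.
have := @FTC1 R (restr f) (BLeft 0).
move=> /(_ _ _)/wrap[||].
- by move=> y; apply: integrableS (restr_int i_f).
- by apply: integrable_locally => //; exact: i_f.2.
move=> ae; apply: aec_interior; apply: filterS ae => x hx x0p.
have [x0 xp] := andP x0p.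
have [_] := hx ltac:(by rewrite /= lte_fin).
rewrite /restr patchE in_circ !ltW//= => <-.
rewrite derive1E (@near_eq_derive _ _ _ _ (cst c)); first exact: derive_cst.
have : \forall x \near x, x \in `]0, 2 * pi[ by apply: near_in_itvoo; rewrite in_itv/= x0.
apply: filterS => y; rewrite in_itv/= => y0p; have [y0 yp] := andP y0p.
by rewrite -[LHS]/(prim f y) prim_cint ?circE ?ltW//; exact: Fc.
Qed.

End parseval.

(** * Riesz-Fischer theorem and convergence of the partial sums *)

Section riesz_fischer.
Context {R : realType}.
Implicit Types (f g : R -> R) (k l : int) (c : int -> R).
Notation mu := (@lebesgue_measure R).

Lemma hc_inj f g : sqint f -> sqint g -> (forall k, hc k f = hc k g) ->
  aec (fun x => f x = g x).
Proof.
move=> sf sg fg; have := @trig_complete R (fun x => f x - g x).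
move=> /(_ _ _)/wrap[||].
- exact/sqint_L1/sqintB.
- move=> k; rewrite -[LHS]/(ip _ _) ip_hc hcB// fg subrr mulr0.
  by [].
by apply: aecS => x _ /eqP; rewrite subr_eq0 => /eqP.
Qed.

Lemma eq_sqn_ae f g : measurable_fun [set: R] f -> measurable_fun [set: R] g ->
  aec (fun x => f x = g x) -> sqn f = sqn g.
Proof.
move=> mf mg fg; apply: eq_cint_ae.
- exact: measurable_funM.
- exact: measurable_funM.
- by apply: aecS fg => x _ ->.
Qed.

Lemma hc_cvg (F : nat -> R -> R) f k a : (forall n, sqint (F n)) -> sqint f ->
  L2cvg F f -> (exists n0, forall n, (n0 <= n)%N -> hc k (F n) = a) -> hc k f = a.
Proof.
move=> sF sf Ff [n0 hn0]; apply/eqP; rewrite eq_sym -subr_eq0 -sqrf_eq0 eq_le sqr_ge0 andbT.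
apply/ler_addgt0Pl => e e0; rewrite addr0.
have [n1 hn1] := Ff (e * (2 * pi)) (mulr_gt0 e0 pi2_gt0).
rewrite -(hn0 (n0 + n1)%N) ?leq_addr// -hcB//.
apply: le_trans (hc_sqr_le _ _) _; first exact: sqintB.
by rewrite ler_pdivrMr ?pi2_gt0// hn1// leq_addl.
Qed.

Lemma sumsq_irange_le c m n : (m <= n)%N ->
  \sum_(k <- irange m) c k ^+ 2 <= \sum_(k <- irange n) c k ^+ 2.
Proof.
move=> mn; rewrite [leRHS](bigID (fun k => k \in irange m))/=.
rewrite -[leLHS]addr0 lerD ?sumr_ge0//; last by move=> k _; exact: sqr_ge0.
have h : perm_eq [seq k <- irange n | k \in irange m] (irange m).
  apply: uniq_perm; [by rewrite filter_uniq// irange_uniq|exact: irange_uniq|].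
  move=> k; rewrite mem_filter !mem_irange; apply/idP/idP => [/andP[]//|km].
  by rewrite km (leq_trans km).
by rewrite -[leRHS]big_filter (perm_big _ h) lexx.
Qed.

Lemma sqn_trigB c m n : (m <= n)%N ->
  sqn (fun x => trig (irange n) c x - trig (irange m) c x) =
  2 * pi * (\sum_(k <- irange n) c k ^+ 2 - \sum_(k <- irange m) c k ^+ 2).
Proof.
move=> mn.
have E k : k \in irange m -> hc k (trig (irange n) c : R -> R) = c k.
  rewrite !mem_irange => km; rewrite hc_trig ?irange_uniq// mem_irange.
  by rewrite (leq_trans km).
have := bessel_eq (irange_uniq m) (sqint_trig (irange n) c).
rewrite sqn_trig ?irange_uniq//.
rewrite (_ : trig (irange m) (hc^~ _) = trig (irange m) c); last first.
  by apply/funext => x; apply: eq_big_seq => k km; rewrite E.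
move=> ->; rewrite mulrBr; congr (_ - _ * _).
by apply: eq_big_seq => k km; rewrite E.
Qed.

Lemma riesz_fischer c (M : R) : (forall n, \sum_(k <- irange n) c k ^+ 2 <= M) ->
  exists f, [/\ sqint f, periodic2pi f, forall k, hc k f = c k &
    L2cvg (fun n => trig (irange n) c) f].
Proof.
move=> cM; pose P n := \sum_(k <- irange n) c k ^+ 2.
have /cvg_ex[l hl] : cvgn P.
  apply: nondecreasing_is_cvgn; first by move=> m n; exact: sumsq_irange_le.
  by exists M => _ [n _ <-]; exact: cM.
have cau : L2cauchy (fun n => trig (irange n) c).
  move=> e e0; have e1 : 0 < e / (2 * pi) / 2 by rewrite !divr_gt0// pi2_gt0.
  have /cvgrPdist_le/(_ _ e1)[n0 _ hn0] := hl; exists n0.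
  suff H m n : (n0 <= m)%N -> (m <= n)%N ->
     sqn (fun x => trig (irange n) c x - trig (irange m) c x) <= e.
    move=> n m nn mm; case/orP: (leq_total m n) => mn; first exact: H.
    by rewrite sqnBC; exact: H.
  move=> mm mn; rewrite sqn_trigB// -ler_pdivlMl ?pi2_gt0//.
  have := hn0 _ mm; have := hn0 n (leq_trans mm mn); rewrite /P/= !ler_norml.
  rewrite [_^-1 * e]mulrC; move=> /andP[? ?] /andP[? ?].
  rewrite [e / (2 * pi)](splitr (e / (2 * pi))); lra.
have [f [sf Ff pf]] := L2_complete (fun n => sqint_trig (irange n) c) cau.
exists f; split => //; first by apply: pf => n; exact: trig_periodic.
move=> k; apply: (hc_cvg _ sf Ff); first by move=> n; exact: sqint_trig.
exists `|k|%N => n kn; rewrite hc_trig ?irange_uniq//.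
by rewrite mem_irange kn.
Qed.

(** Riesz-Fischer provides some L^2 limit of the partial sums with the coefficients of f;
    completeness identifies it with f almost everywhere. *)
Lemma trig_cvg f : sqint f -> L2cvg (fun n => trig (irange n) (hc^~ f)) f.
Proof.
move=> sf; have [|g [sg _ hg cg]] := @riesz_fischer (hc^~ f) (sqn f / (2 * pi)).
  move=> n; rewrite ler_pdivlMr ?pi2_gt0// mulrC; apply: bessel => //.
  exact: irange_uniq.
have fg := hc_inj sg sf hg.
move=> e /cg[n0 hn0]; exists n0 => n /hn0; rewrite (@eq_sqn_ae _ (fun x => trig (irange n) (hc^~ f) x - f x))//.
- by apply: sqint_mf; apply: sqintB => //; exact: sqint_trig.
- by apply: sqint_mf; apply: sqintB => //; exact: sqint_trig.
- by apply: aecS fg => x _ ->.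
Qed.

Lemma parseval_le f (M : R) : sqint f ->
  (forall n, 2 * pi * \sum_(k <- irange n) hc k f ^+ 2 <= M) -> sqn f <= M.
Proof.
move=> sf hM; apply/ler_addgt0Pl => e e0.
have [n hn] := trig_cvg sf e0; have := hn n (leqnn n).
rewrite sqnBC bessel_eq ?irange_uniq//; have := hM n; lra.
Qed.

Lemma normr_le_of_sqr (x e : R) : 0 <= e -> x ^+ 2 <= e ^+ 2 -> `|x| <= e.
Proof.
by move=> e0 h; rewrite -(@ler_pXn2r _ 2) ?nnegrE// real_normK ?num_real.
Qed.

Lemma L2cvg_ip (F : nat -> R -> R) f g : (forall n, sqint (F n)) -> sqint f -> sqint g ->
  L2cvg F f -> ip (F n) g @[n --> \oo] --> ip f g.
Proof.
move=> sF sf sg Ff; apply/cvgrPdist_le => e e0.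
have s1 : 0 < sqn g + 1 by rewrite ltr_wpDl// sqn_ge0.
have [n0 hn0] := Ff (e ^+ 2 / (sqn g + 1)) (divr_gt0 (exprn_gt0 2 e0) s1).
exists n0 => // n /= n0n; rewrite distrC -ipBl//.
apply: (normr_le_of_sqr (ltW e0)).
rewrite (le_trans (ip_sqr_le (sqintB (sF n) sf) sg))//.
rewrite (le_trans (ler_wpM2r (sqn_ge0 g) (hn0 n n0n)))//.
by rewrite mulrAC ler_pdivrMr// ler_wpM2l ?sqr_ge0// lerDl.
Qed.

End riesz_fischer.

(** * The singular kernel *)

Section kernel.
Context {R : realType}.
Notation mu := (@lebesgue_measure R).

(* An increment of a Lipschitz function times the kernel of (-Delta)^(1/4) is O(kap), see [kernel_bound]. *)
Definition kap (z : R) : R := `|sin (z / 2)| `^ (- (1 / 2)).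

Lemma kapN z : kap (- z) = kap z.
Proof. by rewrite /kap mulNr sinN normrN. Qed.

Lemma kap_ge0 z : 0 <= kap z.
Proof. exact: powR_ge0. Qed.

Lemma sin_half_sqr (z : R) : sin (z / 2) ^+ 2 = (1 - cos z) / 2.
Proof.
rewrite {2}(_ : z = (z / 2) *+ 2); last by rewrite -mulr_natr divfK.
by rewrite cos_mulr2n cos2sin2; field.
Qed.

Lemma continuous_powR a (x : R) : 0 < x -> {for x, continuous (@powR R ^~ a)}.
Proof.
move=> x0; apply: differentiable_continuous; apply/derivable1_diffP.
by case: (is_derive1_powR a x0).
Qed.

(** This is sin^2((y - x) / 2) + e: for e > 0 its real powers are smooth, and off the zeros of the
    sine its power -1/4 tends to [kap (x - y)] as e -> 0. *)
Let q (x e y : R) := (1 - cos (y - x)) / 2 + e.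

Let q_gt0 x e y : 0 < e -> 0 < q x e y.
Proof. by move=> e0; rewrite ltr_wpDl// divr_ge0// subr_ge0 cos_le1. Qed.

Let dcos x (y : R) : is_derive y (1 : R) (fun y => cos (y - x)) (- sin (y - x)).
Proof.
have d1 : is_derive y (1 : R) (fun y => y - x) (1 : R).
  by apply: is_derive_eq (is_deriveB (is_derive_id y (1 : R)) (is_derive_cst x y (1 : R))) _; rewrite subr0.
by apply: is_derive_eq (@is_derive1_comp _ (@cos R) _ _ _ _ _ d1) _; rewrite mulr1.
Qed.

Let dsin x (y : R) : is_derive y (1 : R) (fun y => sin (y - x)) (cos (y - x)).
Proof.
have d1 : is_derive y (1 : R) (fun y => y - x) (1 : R).
  by apply: is_derive_eq (is_deriveB (is_derive_id y (1 : R)) (is_derive_cst x y (1 : R))) _; rewrite subr0.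
by apply: is_derive_eq (@is_derive1_comp _ (@sin R) _ _ _ _ _ d1) _; rewrite mulr1.
Qed.

Let dq x e y : is_derive y (1 : R) (q x e) (sin (y - x) / 2).
Proof.
have d := is_deriveD (is_deriveZ (2^-1 : R) (is_deriveB (is_derive_cst (1 : R) y (1 : R)) (dcos x y))) (is_derive_cst e y (1 : R)).
rewrite (_ : q x e = (2^-1 \*: (cst 1 \- (fun y => cos (y - x)))) \+ cst e)%R.
  by apply: is_derive_eq d _; rewrite sub0r opprK addr0 /GRing.scale/= mulrC.
by apply/funext => z; rewrite /q/= /GRing.scale/= mulrC.
Qed.

Let dqp x e a y : 0 < e ->
  is_derive y (1 : R) (fun y => q x e y `^ a) (a * q x e y `^ (a - 1) * (sin (y - x) / 2)).
Proof.
move=> e0; have := is_derive1_powR a (q_gt0 x y e0) => d.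
exact: (@is_derive1_comp _ (@powR R ^~ a) (q x e) _ _ _ d (dq x e y)).
Qed.

Let cqp x e a : 0 < e -> continuous (fun y => q x e y `^ a).
Proof. by move=> e0; exact: (is_derive_continuous (fun y => dqp x a y e0)). Qed.

Let csin x : continuous (fun y : R => sin (y - x)).
Proof. exact: (is_derive_continuous (dsin x)). Qed.

Let ccos x : continuous (fun y : R => cos (y - x)).
Proof. exact: (is_derive_continuous (dcos x)). Qed.

Let a4 : R := - (1 / 4).

(** A periodic function whose derivative controls the regularised kernel by [le_G']; since G' has
    integral zero, the integral of the kernel is at most 3 * 2 pi = 6 pi, uniformly in e. *)
Let G x e y := sin (y - x) * q x e y `^ a4.
Let G' x e y := cos (y - x) * q x e y `^ a4
  + sin (y - x) * (a4 * q x e y `^ (a4 - 1) * (sin (y - x) / 2)).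

Let dG x e y : 0 < e -> is_derive y (1 : R) (G x e) (G' x e y).
Proof.
move=> e0; apply: is_derive_eq (is_deriveM (dsin x y) (dqp x a4 y e0)) _.
by rewrite /G' /GRing.scale/=; ring.
Qed.

Let cG' x e : 0 < e -> continuous (G' x e).
Proof.
move=> e0 y; apply: cvgD; apply: cvgM; [exact: ccos|exact: cqp|exact: csin|].
apply: cvgM; first by apply: cvgM; [exact: cvg_cst|exact: cqp].
by apply: cvgM; [exact: csin|exact: cvg_cst].
Qed.

Let intG' x e : 0 < e -> cint (G' x e) = 0.
Proof.
move=> e0; rewrite (cint_is_derive (fun y => dG x y e0) (@cG' x e e0)).
have E (f : R -> R) : (forall y, f (y + pi *+ 2) = f y) -> f (2 * pi - x) = f (0 - x).
  by move=> h; rewrite -[in RHS]h sub0r addrC mulr_natl.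
by rewrite /G /q (E sin) ?(E cos) ?subrr//; [exact: cosD2pi|exact: sinD2pi].
Qed.

(** With P the power of q and S = sin^2((y - x) / 2) <= q, one has G' = (1 - 2 S) P - S (1 - S) P /
    (2 q) >= (P - 3 S P) / 2, and S P <= 1. *)
Let le_G' x e y : 0 < e -> q x e y `^ a4 <= 2 * G' x e y + 3.
Proof.
move=> e0; have q0 := q_gt0 x y e0.
rewrite /G'; set P := q x e y `^ a4.
have P0 : 0 < P by exact: powR_gt0.
have -> : q x e y `^ (a4 - 1) = P / q x e y.
  by rewrite powRB ?(gt_eqF q0) ?implybT// powRr1// ltW.
set S := (1 - cos (y - x)) / 2.
have Sq : S <= q x e y by rewrite lerDl ltW.
have S0 : 0 <= S by rewrite divr_ge0// subr_ge0 cos_le1.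
have S1 : S <= 1 by rewrite /S; have := cos_geN1 (y - x); lra.
have SP : S * P <= 1.
  have [q1|q1] := leP (q x e y) 1.
    have : P <= (q x e y)^-1.
      rewrite -(powR_inv1 (ltW q0)); apply: ger_powR; first by rewrite q0.
      by rewrite /a4; lra.
    move=> /(ler_wpM2l S0)/le_trans; apply.
    by rewrite ler_pdivrMr// mul1r.
  rewrite -[leRHS]mulr1; apply: ler_pM => //; first exact: ltW.
  have : P <= q x e y `^ 0 by apply: ler_powR; [exact: ltW|rewrite /a4; lra].
  by rewrite powRr0.
have -> : cos (y - x) = 1 - 2 * S by rewrite /S; field.
have sE : sin (y - x) ^+ 2 = 4 * S * (1 - S).
  by rewrite sin2cos2 /S; field.
have -> : sin (y - x) * (a4 * (P / q x e y) * (sin (y - x) / 2)) =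
   - (1 / 2) * (S * (1 - S) * (P / q x e y)).
  move: (P / q x e y) => W.
  rewrite (_ : sin (y - x) * _ = sin (y - x) ^+ 2 * (a4 / 2 * W)); last by ring.
  by rewrite sE /a4; field.
have SqP : S * (1 - S) * (P / q x e y) <= (1 - S) * P.
  rewrite (mulrC S) -mulrA ler_wpM2l ?subr_ge0// mulrCA; apply: ler_piMr; first exact: ltW.
  by rewrite ler_pdivrMr// mul1r.
move: SqP; rewrite mulrBl mul1r; lra.
Qed.

Lemma measurable_kap : measurable_fun [set: R] kap.
Proof.
apply: (measurableT_comp (f := @powR R ^~ (- (1 / 2)))); first exact: measurable_powR.
apply: measurableT_comp => //.
apply: (measurableT_comp (f := @sin R)).
  by apply: continuous_measurable_fun; exact: continuous_sin.
by apply: measurable_funM => //; exact: measurable_cst.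
Qed.

Lemma kap_cint x : cintegrable (fun y => kap (x - y)) /\
  cint (fun y => kap (x - y)) <= 6 * pi.
Proof.
pose e n : R := n.+1%:R^-1.
have e0 n : 0 < e n by rewrite invr_gt0 ltr0n.
(* At the zeros of the sine [powR] gives [kap] the value 0 while the regularised powers blow up; the
   indicator of A restores convergence at these points. *)
pose A := [set y : R | sin ((x - y) / 2) != 0].
have ms : measurable_fun [set: R] (fun y : R => sin ((x - y) / 2)).
  apply: (measurableT_comp (f := @sin R)).
    by apply: continuous_measurable_fun; exact: continuous_sin.
  apply: measurable_funM; last exact: measurable_cst.
  by apply: measurable_funB => //; exact: measurable_cst.
have mA : measurable A.
  rewrite (_ : A = (fun y : R => sin ((x - y) / 2)) @^-1` (~` [set 0])).
    rewrite -[X in measurable X]setTI; apply: ms => //; apply: measurableC.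
    exact: measurable_set1.
  by apply/seteqP; split => y /= /eqP.
have iq n : cintegrable (fun y => q x (e n) y `^ a4).
  by apply: continuous_cintegrable; exact: cqp.
have mi : measurable_fun [set: R] (\1_A : R -> R) by exact: measurable_indic.
apply: (@fatou_circ R (fun n y => q x (e n) y `^ a4 * \1_A y)).
- move=> n; apply: (cintegrableM_bounded (M := 1)) => //.
  by move=> y _; rewrite indicE; case: (_ \in _); rewrite ?normr1 ?normr0.
- by move=> n y _; rewrite mulr_ge0// powR_ge0.
- apply: (measurableT_comp measurable_kap).
  by apply: measurable_funB => //; exact: measurable_cst.
- apply: aecW => y _; rewrite indicE /kap.
  have [s0|s0] := eqVneq (sin ((x - y) / 2)) 0.
    rewrite s0 normr0 powR0; last by rewrite oppr_eq0 gt_eqF// divr_gt0.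
    rewrite memNset; last by rewrite /A/= s0 eqxx.
    by under eq_fun do rewrite mulr0; exact: cvg_cst.
  rewrite mem_set//; under eq_fun do rewrite mulr1.
  have -> : `|sin ((x - y) / 2)| `^ (- (1 / 2)) = ((1 - cos (y - x)) / 2) `^ a4.
    rewrite -cosN opprB -sin_half_sqr -(real_normK (num_real (sin _))).
    by rewrite -powR_mulrn// -powRrM; congr (_ `^ _); rewrite /a4; field.
  apply: (@cvg_comp _ _ _ (fun n => q x (e n) y) (@powR R ^~ a4)); last first.
    apply: continuous_powR.
    by rewrite -cosN opprB -sin_half_sqr exprn_even_gt0.
  have h : (1 - cos (y - x)) / 2 + e n @[n --> \oo] --> (1 - cos (y - x)) / 2 + 0.
    by apply: cvgD; [exact: cvg_cst|exact: cvg_harmonic].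
  by rewrite addr0 in h; exact: h.
- move=> n; apply: (@le_trans _ _ (cint (fun y => 2 * G' x (e n) y + 3))).
    apply: le_cint.
    + apply: (cintegrableM_bounded (M := 1)) => //.
      by move=> y _; rewrite indicE; case: (_ \in _); rewrite ?normr1 ?normr0.
    + apply: cintegrableD; last exact: cintegrable_cst.
      by apply: cintegrableZ; apply: continuous_cintegrable; exact: cG'.
    + move=> y _; apply: le_trans (le_G' x y (e0 n)).
      by rewrite ler_piMr ?powR_ge0// indicE; case: (_ \in _).
  have iG : cintegrable (G' x (e n)) by apply: continuous_cintegrable; exact: cG'.
  rewrite cintD; [|exact: cintegrableZ|exact: cintegrable_cst].
  by rewrite cintZ// intG'// cint_cst; lra.
Qed.

End kernel.

(** * Double integrals against the kernel *)

Section double_integrals.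
Context {R : realType}.
Notation mu := (@lebesgue_measure R).
Implicit Types (h : R * R -> R) (f g : R -> R).
Let mC : measurable (circ R) := @measurable_circ R.
Hint Resolve mC : core.

Lemma le_cintegrable2 h h' : measurable_fun [set: R * R] h -> cintegrable2 h' ->
  (forall x y, circ R x -> circ R y -> `|h (x, y)| <= `|h' (x, y)|) -> cintegrable2 h.
Proof.
move=> mh [mh' ih'] hh'; split=> //.
apply: (@le_integrable _ _ _ (mu \x mu)%E _ (@measurable_csquare R) _ _ _ _ ih').
  by apply/measurable_EFinP; exact: measurable_funS mh.
by move=> [x y] [/= Cx Cy]; rewrite lee_fin hh'.
Qed.

Lemma cintegrable2D h h' : cintegrable2 h -> cintegrable2 h' ->
  cintegrable2 (fun z => h z + h' z).
Proof.
move=> [mh ih] [mh' ih']; split; first exact: measurable_funD.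
exact: (@integrableD _ _ _ (mu \x mu)%E _ (@measurable_csquare R) (EFin \o h) (EFin \o h')).
Qed.

Lemma cintegrable2Z c h : cintegrable2 h -> cintegrable2 (fun z => c * h z).
Proof.
move=> [mh ih]; split; first by apply: measurable_funM => //; exact: measurable_cst.
exact: (@integrableZl _ _ _ (mu \x mu)%E _ (@measurable_csquare R) c (EFin \o h)).
Qed.

Lemma eq_cint2 h h' : (forall x y, circ R x -> circ R y -> h (x, y) = h' (x, y)) ->
  cint2 h = cint2 h'.
Proof.
by move=> hh'; apply: eq_Rintegral => -[x y]; rewrite inE => -[/= Cx Cy]; exact: hh'.
Qed.

Lemma cint2D h h' : cintegrable2 h -> cintegrable2 h' ->
  cint2 (fun z => h z + h' z) = cint2 h + cint2 h'.
Proof. by move=> [_ ?] [_ ?]; apply: RintegralD => //; exact: measurable_csquare. Qed.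

Lemma cint2Z c h : cintegrable2 h -> cint2 (fun z => c * h z) = c * cint2 h.
Proof. by move=> [_ ?]; apply: RintegralZl => //; exact: measurable_csquare. Qed.

Lemma cint2B h h' : cintegrable2 h -> cintegrable2 h' ->
  cint2 (fun z => h z - h' z) = cint2 h - cint2 h'.
Proof. by move=> [_ ?] [_ ?]; apply: RintegralB => //; exact: measurable_csquare. Qed.

Lemma cint2_sum (I : Type) (s : seq I) (F : I -> R * R -> R) :
  (forall i, cintegrable2 (F i)) ->
  cintegrable2 (fun z => \sum_(i <- s) F i z) /\
  cint2 (fun z => \sum_(i <- s) F i z) = \sum_(i <- s) cint2 (F i).
Proof.
move=> iF; elim: s => [|i s [ih1 ih2]].
  have i0 : cintegrable2 (fun=> 0 : R).
    by apply: (cintegrable2_bound (g := fun=> 0)) => //; [exact: cintegrable_cst|move=> x y _ _; rewrite normr0].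
  under eq_fun do rewrite big_nil; rewrite big_nil; split => //.
  transitivity (0 * cint2 (fun=> 0 : R)); last by rewrite mul0r.
  by rewrite -cint2Z//; apply: eq_cint2 => x y _ _; rewrite mul0r.
split; first by under eq_fun do rewrite big_cons; exact: cintegrable2D.
rewrite big_cons -ih2 -cint2D//; apply: eq_cint2 => x y _ _.
by rewrite big_cons.
Qed.

Lemma le_cint2 h h' : cintegrable2 h -> cintegrable2 h' ->
  (forall x y, circ R x -> circ R y -> h (x, y) <= h' (x, y)) -> cint2 h <= cint2 h'.
Proof.
move=> [_ ih] [_ ih'] hh'; apply: (@le_Rintegral _ _ _ (mu \x mu)%E _ _ _ (@measurable_csquare R)) => //.
by move=> [x y] [/= Cx Cy]; exact: hh'.
Qed.

Lemma norm_cint2_le h h' : cintegrable2 h -> cintegrable2 h' ->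
  (forall x y, circ R x -> circ R y -> `|h (x, y)| <= h' (x, y)) ->
  `|cint2 h| <= cint2 h'.
Proof.
move=> ih ih' hh'; rewrite ler_norml; apply/andP; split; last first.
  by apply: le_cint2 => // x y Cx Cy; rewrite (le_trans (ler_norm _))// hh'.
rewrite lerNl -mulN1r -cint2Z//; apply: le_cint2 => //; first exact: cintegrable2Z.
by move=> x y Cx Cy; rewrite mulN1r (le_trans (ler_norm _))// normrN hh'.
Qed.

Lemma measurable_fst1 f : measurable_fun [set: R] f ->
  measurable_fun [set: R * R] (fun z => f z.1).
Proof. by move=> mf; exact: (measurableT_comp mf measurable_fst). Qed.

Lemma measurable_snd1 f : measurable_fun [set: R] f ->
  measurable_fun [set: R * R] (fun z => f z.2).
Proof. by move=> mf; exact: (measurableT_comp mf measurable_snd). Qed.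

Lemma measurable_sub1 f : measurable_fun [set: R] f ->
  measurable_fun [set: R * R] (fun z => f (z.1 - z.2)).
Proof.
move=> mf; apply: (measurableT_comp mf).
by apply: measurable_funB; [exact: measurable_fst|exact: measurable_snd].
Qed.

(** Integrating in y first, [kap_cint] bounds the mass of the kernel by 6 pi uniformly in x. *)
Lemma kap_fst f : cintegrable f -> (forall x, 0 <= f x) ->
  cintegrable2 (fun z => f z.1 * kap (z.1 - z.2)) /\
  cint2 (fun z => f z.1 * kap (z.1 - z.2)) <= 6 * pi * cint f.
Proof.
move=> i_f f0.
have mh : measurable_fun [set: R * R] (fun z => f z.1 * kap (z.1 - z.2)).
  apply: measurable_funM; first exact: measurable_fst1 i_f.1.
  by apply: measurable_sub1; exact: measurable_kap.
have E x : cint (fun y => f x * kap (x - y)) <= 6 * pi * f x.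
  have [ik k6] := kap_cint x; rewrite cintZ// mulrC ler_wpM2r//.
have h0 x y : 0 <= f x * kap (x - y) by rewrite mulr_ge0// kap_ge0.
have ih : cintegrable2 (fun z => f z.1 * kap (z.1 - z.2)).
  apply: cintegrable2P => //.
  apply: (@le_lt_trans _ _ (\int[mu]_(x in circ R) (6 * pi * f x)%:E)%E); last first.
    by rewrite -EFin_cint ?ltry//; exact: cintegrableZ.
  apply: ge0_le_integral => //.
  - by move=> x Cx; exact: integral_ge0.
  - have := measurable_fun_fubini_tonelli_F (m2 := mu)
      ((fun z => `|f z.1 * kap (z.1 - z.2)|%:E) \_ (setT `*` circ R))%E.
    move=> /(_ _ _)/wrap[||mF].
    + apply: (@measurable_restrictT _ _ _ _ _ _ (measurableX measurableT mC)).1.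
      by apply/measurable_EFinP; apply: measurableT_comp => //; exact: measurable_funS mh.
    + by move=> z; rewrite patchE; case: ifPn => // _; rewrite lee_fin.
    apply: (@measurable_funS _ _ _ _ setT) => //.
    move: mF; congr measurable_fun; apply/funext => x; rewrite [RHS]integral_mkcond.
    by apply: eq_integral => y _; rewrite !patchE in_setX/= in_setT.
  - by apply/measurable_EFinP; apply: measurable_funS (cintegrableZ (6 * pi) i_f).1.
  - move=> x Cx; rewrite (_ : (\int[mu]_(y in circ R) _)%E = (cint (fun y => f x * kap (x - y)))%:E).
      by rewrite lee_fin.
    rewrite EFin_cint; last by apply: cintegrableZ; exact: (kap_cint x).1.
    by apply: eq_integral => y _; rewrite ger0_norm.
split=> //; have [ic ->] := cint2_fubini ih.
rewrite -cintZ//; apply: le_cint; [exact: ic|exact: cintegrableZ|by move=> x _; exact: E].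
Qed.

Lemma kap_snd f : cintegrable f -> (forall x, 0 <= f x) ->
  cintegrable2 (fun z => f z.2 * kap (z.1 - z.2)) /\
  cint2 (fun z => f z.2 * kap (z.1 - z.2)) <= 6 * pi * cint f.
Proof.
move=> i_f f0; have [ih h6] := kap_fst i_f f0.
have [i2 e2] := cint2_swap ih.
have E : (fun z : R * R => f z.2 * kap (z.1 - z.2)) = (fun z => f z.2 * kap (z.2 - z.1)).
  by apply/funext => z; rewrite -kapN opprB.
by rewrite E e2.
Qed.

End double_integrals.

(** * Lipschitz functions for the chordal distance *)

Section lips.
Context {R : realType}.
Implicit Types (v f g : R -> R).

(* Lipschitz for the chordal distance: |e^(ix) - e^(iy)| = 2 |sin ((x - y) / 2)|. *)
Definition lips (C : R) v : Prop := forall x y, `|v x - v y| <= C * `|sin ((x - y) / 2)|.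

(** The mean value theorem gives t cos(pi/4) <= sin t up to pi/4; doubling the angle and cos^2(pi/4)
    = 1/2 carry the bound to pi/2. *)
Lemma sin_ge_half (s : R) : 0 <= s -> s <= pi / 2 -> s / 2 <= sin s.
Proof.
move=> s0 sp; have pi0 := pi_gt0 R.
have h (t : R) : 0 <= t -> t <= pi / 4 -> t * cos (pi / 4) <= sin t.
  rewrite le_eqVlt => /predU1P[<-|t0] tp; first by rewrite mul0r sin0.
  have [|c] := @MVT R (@sin R) (@cos R) 0 t t0.
    by apply: continuous_subspaceT; exact: continuous_sin.
  rewrite in_itv/= => /andP[c0 ct]; rewrite sin0 !subr0 => ->.
  rewrite mulrC; apply: ler_wpM2r; first exact: ltW.
  have [->//|cp] := eqVneq c (pi / 4).
  apply/ltW; rewrite ltr_cos ?in_itv/=; [lra|apply/andP; split; lra|apply/andP; split; lra].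
have c4 : cos (pi / 4) ^+ 2 = 1 / 2 :> R.
  have := cos_mulr2n (pi / 4 : R); rewrite (_ : pi / 4 *+ 2 = pi / 2); last by rewrite -mulr_natr; field.
  by rewrite cos_pihalf -mulr_natr; lra.
have cp : 0 <= cos (pi / 4 : R) by apply: cos_ge0_pihalf; apply/andP; split; lra.
have -> : sin s = 2 * (sin (s / 2) * cos (s / 2)).
  have e : s = (s / 2) *+ 2 by rewrite -mulr_natr divfK.
  by rewrite [in LHS]e sin_mulr2n -mulr_natl (mulrC (cos _)).
have s4 : s / 2 <= pi / 4.
  by rewrite (_ : pi / 4 = pi / 2 / 2) ?ler_pM2r//; field.
have h1 := h _ (divr_ge0 s0 (ler0n R 2)) s4.
have c1 : cos (pi / 4) <= cos (s / 2).
  have [->//|cps] := eqVneq (s / 2) (pi / 4).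
  apply/ltW; clear h c4 cp h1; rewrite ltr_cos ?in_itv/=; [|apply/andP; split; lra|apply/andP; split; lra].
  by rewrite lt_neqAle cps.
have := ler_pM (mulr_ge0 (divr_ge0 s0 (ler0n R 2)) cp) cp h1 c1.
by rewrite -mulrA -expr2 c4; lra.
Qed.

Lemma norm_sin_half_shift (z : R) (k : int) :
  `|sin ((z - k%:~R * (2 * pi)) / 2)| = `|sin (z / 2)|.
Proof.
apply/eqP; rewrite -(@eqrXn2 _ 2)// !real_normK ?num_real// !sin_half_sqr.
by rewrite -[in cos z](subrK (k%:~R * (2 * pi)) z) cosDint.
Qed.

Lemma mod_2pi (z : R) : exists k : int, `|z - k%:~R * (2 * pi)| <= pi.
Proof.
have p0 := pi2_gt0 (R := R).
exists (Num.floor ((z + pi) / (2 * pi))).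
have := floor_le ((z + pi) / (2 * pi)); have := floorD1_gt ((z + pi) / (2 * pi)).
move: (Num.floor _) => k; rewrite intrD ltr_pdivrMr// ler_pdivlMr// => h1 h2.
rewrite ler_norml; apply/andP; split; first lra.
by move: h1; rewrite mulrDl mul1r; lra.
Qed.

Lemma periodic_int v : periodic2pi v -> forall (k : int) x, v (x + k%:~R * (2 * pi)) = v x.
Proof.
move=> pv; have h (n : nat) x : v (x + n%:R * (2 * pi)) = v x.
  elim: n => [|n ih]; first by rewrite mul0r addr0.
  by rewrite -natr1 mulrDl mul1r addrA pv ih.
move=> [n|n] x; first by rewrite -pmulrn h.
by rewrite NegzE mulrNz mulNr -pmulrn -[in RHS](subrK (n.+1%:R * (2 * pi)) x) h.
Qed.

Lemma lips_ge0 C v : lips C v -> 0 <= C.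
Proof.
by move=> /(_ pi 0); rewrite subr0 sin_pihalf normr1 mulr1; apply: le_trans.
Qed.

(** Modulo 2 pi one may take |z| <= pi for z = x - y; then [sin_ge_half] at |z| / 2 gives |z| <= 4
    |sin(z / 2)|, the origin of the factor 4. *)
Lemma lips_of_lipschitz (c : R) v : 0 <= c -> periodic2pi v ->
  (forall x y, `|v x - v y| <= c * `|x - y|) -> lips (4 * c) v.
Proof.
move=> c0 pv lv x y; have [k hk] := mod_2pi (x - y).
rewrite -(norm_sin_half_shift _ k) -[v y](periodic_int pv k).
rewrite (le_trans (lv _ _))//.
rewrite (_ : 4 * c * _ = c * (4 * `|sin ((x - y - k%:~R * (2 * pi)) / 2)|)); last by ring.
rewrite ler_wpM2l//.
rewrite opprD addrA; set z := _ - _ - _ in hk *.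
have := @sin_ge_half (`|z| / 2); move=> /(_ _ _)/wrap[||h].
- by rewrite divr_ge0.
- by rewrite ler_pM2r.
have -> : `|sin (z / 2)| = sin (`|z| / 2).
  have s0 : 0 <= sin (`|z| / 2) by rewrite (le_trans _ h)// !divr_ge0.
  case: (ger0P z) s0 => z0 s0; first by rewrite ger0_norm.
  by rewrite -normrN -sinN -mulNr ger0_norm.
lra.
Qed.

Lemma lips_continuous C v : lips C v -> continuous v.
Proof.
move=> lv x; apply/cvgrPdist_lt => e e0.
have cs : (fun y => C * `|sin ((x - y) / 2)|) @ x --> C * `|sin ((x - x) / 2)|.
  apply: cvgM; first exact: cvg_cst.
  apply: cvg_norm; apply: (@continuous_comp _ _ _ (fun y => (x - y) / 2) sin); last exact: continuous_sin.
  by apply: cvgM; [apply: cvgB; [exact: cvg_cst|exact: cvg_id]|exact: cvg_cst].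
rewrite subrr mul0r sin0 normr0 mulr0 in cs.
move/cvgrPdist_lt : cs => /(_ _ e0); apply: filterS => y.
rewrite sub0r normrN => /(le_lt_trans _); apply.
by rewrite (le_trans (lv _ _))// ler_norm.
Qed.

Lemma periodic_bounded v : continuous v -> periodic2pi v ->
  exists2 M : R, 0 <= M & forall x, `|v x| <= M.
Proof.
move=> cv pv; have [M hM] := continuous_bounded_circ cv.
have p0 := pi2_gt0 (R := R).
exists M; first by rewrite (le_trans _ (hM 0 _))// circE lexx ltW.
move=> x; pose k := Num.floor (x / (2 * pi)).
rewrite -[x](subrK (k%:~R * (2 * pi))) periodic_int//; apply: hM; rewrite circE.
have := floor_le (x / (2 * pi)); have := floorD1_gt (x / (2 * pi)); rewrite -/k.
rewrite intrD ltr_pdivrMr// ler_pdivlMr// => h1 h2.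
by move: h1; rewrite mulrDl mul1r => h1; apply/andP; split; lra.
Qed.

End lips.

(** * The singular integral, its commutators and their bilinear form *)

Section operators.
Context {R : realType}.
Implicit Types (v f g a b : R -> R) (k l : int).
Notation mu := (@lebesgue_measure R).

Lemma dist_ofE f phi : dist_of f phi = ip f phi.
Proof. by []. Qed.

Lemma L2_sqint f : L2 f -> sqint f.
Proof. by case=> pf mf i_f; split. Qed.

Lemma sqint_L2 f : periodic2pi f -> sqint f -> L2 f.
Proof. by move=> pf [mf i_f]; split. Qed.

Lemma fourier_dist_of f k : sqint f -> fourier (dist_of f) k =
  Complex ((hc k f + hc (- k) f) / 2) (- ((hc k f - hc (- k) f) / 2)).
Proof.
move=> sf; have sc l := sqint_cas (R := R) l.
rewrite /fourier !dist_ofE /hc; congr Complex.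
  rewrite -mulrDl -ipDr//.
  rewrite (eq_ip (f' := f) (g' := fun x => 2^-1 * (cas k x + cas (- k) x)))//; last first.
    by move=> x _; rewrite cosE_cas mulrC.
  by rewrite ipZr//; [ring|exact: sqintD].
rewrite -mulrBl -ipBr//.
rewrite (eq_ip (f' := f) (g' := fun x => 2^-1 * (cas k x - cas (- k) x)))//; last first.
  by move=> x _; rewrite sinE_cas mulrC.
by rewrite ipZr//; [ring|exact: sqintB].
Qed.

(** |k|^(1/2), with the exponent in the shape it takes in [is_fraclap] for s = 1/4. *)
Definition lam k : R := `|(k%:~R : R)| `^ (2 * 4^-1).

Lemma lamN k : lam (- k) = lam k.
Proof. by rewrite /lam mulrNz normrN. Qed.

Lemma lam_ge0 k : 0 <= lam k.
Proof. exact: powR_ge0. Qed.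

(** The real and imaginary parts of a Fourier coefficient are the even and odd parts in k of the
    Hartley coefficient, so the even multiplier [lam] acts in the same way on both. *)
Lemma is_fraclapP f g : sqint f -> is_fraclap 4^-1 f g <->
  L2 g /\ forall k, hc k g = lam k * hc k f.
Proof.
move=> sf; split=> -[L2g h]; split=> // k; have sg := L2_sqint L2g.
  have /eqP := h k; rewrite !fourier_dist_of// eq_complex/= !mul0r subr0 addr0.
  rewrite -/(lam k) => /andP[/eqP e1 /eqP e2].
  have : (hc k g + hc (- k) g) / 2 - - ((hc k g - hc (- k) g) / 2) = hc k g by field.
  by move=> <-; rewrite e1 e2; field.
apply/eqP; rewrite !fourier_dist_of// eq_complex/= !mul0r subr0 addr0 -/(lam k).
by rewrite !h lamN; apply/andP; split; apply/eqP; ring.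
Qed.

Lemma fraclap_ae f g : sqint f -> is_fraclap 4^-1 f g ->
  L2 (fraclap 4^-1 f) /\ aec (fun x => fraclap 4^-1 f x = g x).
Proof.
move=> sf fg; have h : is_fraclap 4^-1 f (fraclap 4^-1 f).
  exact: (@xgetPex _ _ [set g | is_fraclap 4^-1 f g] (ex_intro _ g fg)).
have [L2h hh] := (is_fraclapP _ sf).1 h; have [L2g hg] := (is_fraclapP _ sf).1 fg.
split=> //; apply: hc_inj; [exact: L2_sqint|exact: L2_sqint|].
by move=> k; rewrite hh hg.
Qed.

Variables (K : R -> R) (hK : is_K14 K).

(** For periodic Lipschitz v, a representative of (-Delta)^(1/4) v given by a formula at every
    point, unlike the chosen [fraclap]. *)
Definition LamK v x : R := cint (fun y => (v x - v y) * K (x - y)).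

(** For smooth v and b this is the commutator Lam(v b) - v Lam b, see [Tk_LamK]. In this form b
    enters without increments and need only be bounded. *)
Definition Tk v b x : R := cint (fun y => b y * ((v x - v y) * K (x - y))).

(** One coordinate of [fracdiv0] tested with v; for bounded b it is the pairing of a with
    [Tk v b]. *)
Definition Bk v a b : R :=
  cint2 (fun z => a z.1 * b z.2 * ((v z.1 - v z.2) * K (z.1 - z.2))).

Let pK : periodic2pi K. Proof. by case: hK => -[]. Qed.
Let mK : measurable_fun [set: R] K. Proof. by case: hK => -[]. Qed.
Let evK z : K (- z) = K z. Proof. by case: hK. Qed.

(** The increment of v contributes one power of the chord, which raises the exponent -3/2 to the
    integrable -1/2. Where the sine vanishes the increment vanishes too, so the value of K there is
    irrelevant. *)
Lemma kernel_bound : exists2 c : R, 0 <= c & forall v C, lips C v ->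
  forall x y, `|(v x - v y) * K (x - y)| <= C * c * kap (x - y).
Proof.
have [_ _ [c1 [c2 [c10 c20 Kb]]] _] := hK; exists c2; first exact: ltW.
move=> v C lv x y; have [s0|s0] := eqVneq (sin ((x - y) / 2)) 0.
  have := lv x y; rewrite s0 normr0 mulr0 normr_le0 => /eqP ->.
  by rewrite mul0r normr0 /kap s0 normr0 powR0 ?mulr0// oppr_eq0 gt_eqF// divr_gt0.
have /andP[K1 K2] := Kb _ s0.
have n0 : 0 < `|sin ((x - y) / 2)| by rewrite normr_gt0.
have K0 : 0 <= K (x - y) by rewrite (le_trans _ K1)// mulr_ge0 ?powR_ge0// ltW.
rewrite normrM (ger0_norm K0).
apply: le_trans (ler_pM (normr_ge0 _) K0 (lv x y) K2) _.
rewrite mulrACA /kap le_eqVlt; apply/orP; left; apply/eqP; congr (_ * _).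
rewrite -{1}[`|sin _|]powRr1// -powRD; last by rewrite (gt_eqF n0) implybT.
by congr (_ `^ _); field.
Qed.

Lemma absM_le (x y A k : R) : 0 <= A -> 0 <= k ->
  `|x * y| * (A * k) <= A * (x ^+ 2 * k + y ^+ 2 * k).
Proof.
move=> A0 k0; rewrite [leRHS](_ : _ = (x ^+ 2 + y ^+ 2) * (A * k)); last by ring.
rewrite ler_wpM2r ?mulr_ge0// normrM -(real_normK (num_real x)) -(real_normK (num_real y)).
have := sqr_ge0 (`|x| - `|y|); have := sqr_ge0 (`|x| + `|y|).
by rewrite sqrrD sqrrB; lra.
Qed.

Lemma lips_measurable C v : lips C v -> measurable_fun [set: R] v.
Proof. by move=> lv; apply: continuous_measurable_fun; exact: lips_continuous lv. Qed.

Lemma measurable_dv C v : lips C v ->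
  measurable_fun [set: R * R] (fun z => (v z.1 - v z.2) * K (z.1 - z.2)).
Proof.
move=> lv; have mv := lips_measurable lv; apply: measurable_funM; last exact: measurable_sub1.
by apply: measurable_funB; [exact: measurable_fst1|exact: measurable_snd1].
Qed.

Lemma Bk_integrable C v a b : lips C v -> sqint a -> sqint b ->
  cintegrable2 (fun z => a z.1 * b z.2 * ((v z.1 - v z.2) * K (z.1 - z.2))).
Proof.
move=> lv sa sb; have [c c0 hc] := kernel_bound.
have C0 := lips_ge0 lv.
have [i1 _] := kap_fst (sqint_sqr sa) (fun x => sqr_ge0 _).
have [i2 _] := kap_snd (sqint_sqr sb) (fun x => sqr_ge0 _).
apply: le_cintegrable2 (cintegrable2Z (C * c) (cintegrable2D i1 i2)) _.
  apply: measurable_funM; last exact: measurable_dv lv.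
  by apply: measurable_funM; [exact: measurable_fst1 sa.1|exact: measurable_snd1 sb.1].
move=> x y _ _ /=; rewrite normrM.
have k0 := kap_ge0 (x - y); have := hc _ _ lv x y; set k := _ * K _ => hk.
rewrite [leRHS]ger0_norm; last by rewrite mulr_ge0 ?(mulr_ge0 C0 c0)// addr_ge0// mulr_ge0// sqr_ge0.
apply: le_trans (ler_wpM2l (normr_ge0 _) hk) _.
by apply: absM_le => //; exact: mulr_ge0.
Qed.

(** The inequality |a b| <= a^2 + b^2 and the kernel bound give the additive estimate D (sqn a + sqn
    b); homogeneity in a then makes it a product. *)
Lemma Bk_bound C v : lips C v -> exists2 D, 0 <= D & forall a b, sqint a -> sqint b ->
  Bk v a b ^+ 2 <= D * (sqn a * sqn b).
Proof.
move=> lv; have [c c0 hc] := kernel_bound.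
have C0 := lips_ge0 lv.
pose D := C * c * (6 * pi).
have D0 : 0 <= D by rewrite !mulr_ge0// pi_ge0.
have key a b : sqint a -> sqint b -> `|Bk v a b| <= D * (sqn a + sqn b).
  move=> sa sb.
  have [i1 h1] := kap_fst (sqint_sqr sa) (fun x => sqr_ge0 _).
  have [i2 h2] := kap_snd (sqint_sqr sb) (fun x => sqr_ge0 _).
  apply: le_trans (norm_cint2_le (Bk_integrable lv sa sb)
    (cintegrable2Z (C * c) (cintegrable2D i1 i2)) _) _.
    move=> x y _ _ /=; rewrite normrM.
    have k0 := kap_ge0 (x - y); have := hc _ _ lv x y; set k := _ * K _ => hk.
    apply: le_trans (ler_wpM2l (normr_ge0 _) hk) _.
    by apply: absM_le => //; exact: mulr_ge0.
  rewrite cint2Z ?cint2D//; last exact: cintegrable2D.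
  by rewrite /D -[leRHS]mulrA ler_wpM2l ?(mulr_ge0 C0 c0)// mulrDr lerD.
exists (4 * D ^+ 2); first by rewrite mulr_ge0// sqr_ge0.
move=> a b sa sb.
(* The additive estimate for t a and b is nonnegativity of a quadratic in t with middle coefficient
   Bk / 2; squaring this half produces the constant 4 D^2. *)
have := @discr_le R (D * sqn b) (Bk v a b / 2) (D * sqn a).
move=> /(_ _ _)/wrap[||h].
- move=> t; have := key _ _ (sqintZ t sa) sb; rewrite sqnZ//.
  have -> : Bk v (fun x => t * a x) b = t * Bk v a b.
    rewrite /Bk -cint2Z; last exact: Bk_integrable lv sa sb.
    by apply: eq_cint2 => x y _ _ /=; rewrite !mulrA.
  rewrite ler_norml => /andP[h _]; move: h.
  by rewrite -subr_ge0; congr (0 <= _); field.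
- by rewrite mulr_ge0// sqn_ge0.
move: h; rewrite exprMn exprVn; move: (Bk _ _ _ ^+ 2) => B; rewrite ler_pdivrMr// => h.
by rewrite (le_trans h)// le_eqVlt; apply/orP; left; apply/eqP; ring.
Qed.

Lemma Bk_swap C v a b : lips C v -> sqint a -> sqint b -> Bk v a b = - Bk v b a.
Proof.
move=> lv sa sb; have ih := Bk_integrable lv sb sa.
rewrite -mulN1r /Bk -(cint2_swap ih).2 -cint2Z; last exact: (cint2_swap ih).1.
by apply: eq_cint2 => x y _ _ /=; rewrite -(opprB x y) evK; ring.
Qed.

Lemma kernel_cintegrable C v x : lips C v -> cintegrable (fun y => (v x - v y) * K (x - y)).
Proof.
move=> lv; have [c c0 hc] := kernel_bound.
apply: (le_cintegrable _ (cintegrableZ (C * c) (kap_cint x).1)).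
  apply: measurable_funM.
    by apply: measurable_funB => //; exact: lips_measurable lv.
  by apply: (measurableT_comp mK); exact: measurable_funB.
by move=> y _; rewrite (le_trans (hc _ _ lv x y))// ler_norm.
Qed.

Lemma Tk_integrable C v b M x : lips C v -> measurable_fun [set: R] b ->
  (forall y, circ R y -> `|b y| <= M) ->
  cintegrable (fun y => b y * ((v x - v y) * K (x - y))).
Proof.
move=> lv mb bM; have := cintegrableM_bounded (kernel_cintegrable x lv) mb bM.
by under eq_fun do rewrite mulrC.
Qed.

Lemma sqint_Tk C v b M : lips C v -> measurable_fun [set: R] b ->
  (forall y, circ R y -> `|b y| <= M) -> sqint (Tk v b).
Proof.
move=> lv mb bM; have [c c0 hc] := kernel_bound.
have C0 := lips_ge0 lv.
have M0 : 0 <= M.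
  by apply: le_trans (bM 0 _) => //; rewrite circE lexx ltW// pi2_gt0.
apply: (@sqint_bounded _ _ (M * (C * c * (6 * pi)))).
  apply: (measurable_cint_param (h := fun z => b z.2 * ((v z.1 - v z.2) * K (z.1 - z.2)))).
  by apply: measurable_funM; [exact: measurable_snd1|exact: measurable_dv lv].
move=> x Cx; apply: le_trans (le_norm_cint (Tk_integrable x lv mb bM)) _.
have [ik k6] := kap_cint x.
apply: (@le_trans _ _ (cint (fun y => M * (C * c * kap (x - y))))).
  apply: le_cint.
  - exact/cintegrable_norm/(Tk_integrable x lv mb bM).
  - by do 2 apply: cintegrableZ.
  - by move=> y Cy; rewrite normrM ler_pM// ?bM// hc.
rewrite cintZ; last exact: cintegrableZ.
by rewrite cintZ// ler_wpM2l// ler_wpM2l// mulr_ge0.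
Qed.

Lemma Bk_Tk C v a b M : lips C v -> sqint a -> measurable_fun [set: R] b ->
  (forall y, circ R y -> `|b y| <= M) -> Bk v a b = ip a (Tk v b).
Proof.
move=> lv sa mb bM; have sb : sqint b := sqint_bounded mb bM.
rewrite /Bk (cint2_fubini (Bk_integrable lv sa sb)).2; apply: eq_cint => x _ /=.
rewrite /Tk -cintZ; last exact: Tk_integrable bM.
by apply: eq_cint => y _; rewrite -mulrA.
Qed.

Lemma LamKE v x : LamK v x = Tk v (fun=> 1) x.
Proof. by apply: eq_cint => y _; rewrite mul1r. Qed.

Lemma sqint_LamK C v : lips C v -> sqint (LamK v).
Proof.
move=> lv; rewrite (_ : LamK v = Tk v (fun=> 1)); last by apply/funext => x; exact: LamKE.
by apply: (@sqint_Tk C _ _ 1) => // y _; rewrite normr1.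
Qed.

(** Since K is even, symmetrisation turns twice either side into the double integral of (v x - v y)
    (w x - w y) K(x - y), which is symmetric in v and w. *)
Lemma ip_LamK C C' v w : lips C v -> lips C' w -> ip v (LamK w) = ip w (LamK v).
Proof.
move=> lv lw.
have sv : sqint v by apply: continuous_sqint; exact: lips_continuous lv.
have sw : sqint w by apply: continuous_sqint; exact: lips_continuous lw.
have s1 : sqint (fun=> 1 : R) := sqint_cst 1.
have E D f g : lips D f -> sqint g -> ip g (LamK f) = Bk f g (fun=> 1).
  move=> lf sg; rewrite (@Bk_Tk D _ _ _ 1)//; last by move=> y _; rewrite normr1.
  by apply: eq_ip => // x _; exact: LamKE.
rewrite (E _ _ _ lw sv) (E _ _ _ lv sw).
have H D f g : lips D f -> sqint g -> 2 * Bk f g (fun=> 1) =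
    cint2 (fun z => (f z.1 - f z.2) * (g z.1 - g z.2) * K (z.1 - z.2)).
  move=> lf sg; rewrite mulr2n mulrDl mul1r {2}(Bk_swap lf sg s1) -mulN1r /Bk.
  rewrite -cint2Z -?cint2D; last 3 first.
  - exact: Bk_integrable lf sg s1.
  - by apply: cintegrable2Z; exact: Bk_integrable lf s1 sg.
  - exact: Bk_integrable lf s1 sg.
  by apply: eq_cint2 => x y _ _ /=; ring.
suff : 2 * Bk w v (fun=> 1) = 2 * Bk v w (fun=> 1) by move=> /mulfI; apply.
rewrite (H _ _ _ lw sv) (H _ _ _ lv sw); apply: eq_cint2 => x y _ _ /=.
by ring.
Qed.

Lemma Cinf_derive v x : Cinf v -> is_derive x (1 : R) v (derive1 v x).
Proof.
by move=> [_ /(_ 0 x)] dv; rewrite derive1E; apply: DeriveDef.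
Qed.

Lemma Cinf_derive1 v : Cinf v -> Cinf (derive1 v).
Proof.
move=> [pv dv]; split.
  move=> x; rewrite !derive1E /derive.
  suff -> : (fun h : R => h^-1 *: ((v \o shift (x + 2 * pi)) (h *: 1) - v (x + 2 * pi))) =
    (fun h : R => h^-1 *: ((v \o shift x) (h *: 1) - v x)) by [].
  by apply/funext => h /=; rewrite addrA !pv.
by move=> n x; rewrite -derive1Sn; exact: dv.
Qed.

Lemma Cinf_continuous v : Cinf v -> continuous v.
Proof. by move=> cv; apply: is_derive_continuous => x; exact: Cinf_derive. Qed.

Lemma Cinf_periodic v : Cinf v -> periodic2pi v.
Proof. by case. Qed.

Lemma Cinf_lipschitz v : Cinf v ->
  exists2 c : R, 0 <= c & forall x y, `|v x - v y| <= c * `|x - y|.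
Proof.
move=> cv; have cv1 := Cinf_derive1 cv.
have [M M0 hM] := periodic_bounded (Cinf_continuous cv1) (Cinf_periodic cv1).
exists M => // x y.
wlog xy : x y / y < x.
  move=> h; have [xy|xy|->] := ltgtP x y; [|exact: h|by rewrite !subrr normr0 mulr0].
  by rewrite distrC (distrC x); exact: h.
have [||c _ ->] := @MVT R v (derive1 v) y x xy.
- by move=> z _; exact: Cinf_derive.
- by apply: continuous_subspaceT; exact: Cinf_continuous.
by rewrite normrM ler_wpM2r.
Qed.

Lemma Cinf_lips v : Cinf v -> exists C, lips C v.
Proof.
move=> cv; have [c c0 lc] := Cinf_lipschitz cv.
by exists (4 * c); exact: lips_of_lipschitz (Cinf_periodic cv) lc.
Qed.

Lemma Cinf_cas k : Cinf (cas k : R -> R).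
Proof.
split; first exact: cas_periodic.
move=> n; have [c [l ->]] : exists (c : R) l, derive1n n (cas k) = (fun x => c * cas l x).
  elim: n => [|n [c [l ih]]]; first by exists 1, k; apply/funext => x; rewrite mul1r.
  exists (c * l%:~R), (- l); rewrite derive1nS ih; apply/funext => x.
  have d := is_deriveZ c (is_derive_cas l x).
  by rewrite derive1E (@derive_val _ _ _ _ _ _ _ d) /GRing.scale/= mulrA.
move=> x; have d := is_deriveZ c (is_derive_cas l x).
exact: (@ex_derive _ _ _ _ _ _ _ d).
Qed.

Lemma LamK_periodic v : periodic2pi v -> periodic2pi (LamK v).
Proof.
by move=> pv x; apply: eq_cint => y _; rewrite pv addrAC pK.
Qed.

Lemma LamK_cas k : aec (fun x => LamK (cas k) x = lam k * cas k x).
Proof.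
have [_ _ _ h] := hK; have sc := sqint_cas (R := R) k.
have [L2L hL] := (is_fraclapP _ sc).1 (h _ (Cinf_cas k)).
apply: hc_inj; [exact: L2_sqint L2L|exact: sqintZ|].
move=> l; rewrite hL hcZ//; have [->//|lk] := eqVneq l k.
by rewrite /hc ip_cas eq_sym (negbTE lk) mulr0 mul0r !mulr0.
Qed.

(** [is_K14] gives the kernel formula for smooth functions only. Moving the operator onto [cas k] by
    symmetry extends it to Lipschitz functions, the regularity that is established for w o phi_t. *)
Lemma LamK_fraclap C v : lips C v -> periodic2pi v -> is_fraclap 4^-1 v (LamK v).
Proof.
move=> lv pv; have sv : sqint v by apply: continuous_sqint; exact: lips_continuous lv.
apply/(is_fraclapP _ sv); split.
  by apply: sqint_L2; [exact: LamK_periodic|exact: sqint_LamK lv].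
move=> k; have [C' lk] := Cinf_lips (Cinf_cas k).
rewrite /hc ipC (ip_LamK lk lv) mulrA; congr (_ / _).
rewrite -ipZr//; last exact: sqint_cas.
apply: eq_cint_ae.
- by apply: measurable_funM; [exact: sv.1|exact: (sqint_LamK lk).1].
- by apply: measurable_funM; [exact: sv.1|exact: (sqintZ _ (sqint_cas _)).1].
- by apply: aecS (LamK_cas k) => x _ ->.
Qed.

End operators.

(** * Schur test and smooth multipliers *)

Section schur.
Context {R : realType}.
Implicit Types (f g : R -> R) (k l : int) (b c : int -> R) (s t : seq int).

Lemma ler_sum_subset (T : eqType) (s t : seq T) (F : T -> R) : uniq s -> uniq t ->
  {subset s <= t} -> (forall x, 0 <= F x) -> \sum_(k <- s) F k <= \sum_(k <- t) F k.
Proof.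
move=> us ut st F0; rewrite [leRHS](bigID (fun i => i \in s))/=.
rewrite -[leLHS]addr0 lerD ?sumr_ge0//.
have h : perm_eq [seq k <- t | k \in s] s.
  apply: uniq_perm; [by rewrite filter_uniq|by []|].
  by move=> k; rewrite mem_filter; apply/idP/idP => [/andP[]//|ks]; rewrite ks st.
by rewrite -[leRHS]big_filter (perm_big _ h) lexx.
Qed.

Lemma subset_irange s : exists n, {subset s <= irange n}.
Proof.
elim: s => [|k s [n ih]]; first by exists 0%N.
exists (`|k| + n)%N => l; rewrite inE => /orP[/eqP ->|/ih].
  by rewrite mem_irange leq_addr.
by rewrite !mem_irange => h; rewrite (leq_trans h)// leq_addl.
Qed.

Lemma big_irangeS n (F : int -> R) :
  \sum_(k <- irange n.+1) F k = F n.+1%:Z + (F (- n.+1%:Z) + \sum_(k <- irange n) F k).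
Proof.
transitivity (\sum_(k <- [:: n.+1%:Z, - n.+1%:Z & irange n]) F k); last by rewrite !big_cons.
apply: perm_big.
apply: uniq_perm.
- exact: irange_uniq.
- apply/andP; split; last by apply/andP; split; [rewrite mem_irange; lia|exact: irange_uniq].
  by rewrite inE mem_irange; apply/norP; split; lia.
- by move=> k; rewrite mem_irange 2!in_cons mem_irange; lia.
Qed.

Lemma big_irange0 (F : int -> R) : \sum_(k <- irange 0) F k = F 0.
Proof. by rewrite /irange/= big_seq1. Qed.

Lemma big_irangeN n (F : int -> R) :
  \sum_(k <- irange n) F (- k) = \sum_(k <- irange n) F k.
Proof.
elim: n => [|n ih]; first by rewrite !big_irange0 oppr0.
by rewrite !big_irangeS ih opprK addrCA.
Qed.

Definition ja k : R := `|(k%:~R : R)|.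

Lemma ja_ge0 k : 0 <= ja k.
Proof. exact: normr_ge0. Qed.

Lemma jaN k : ja (- k) = ja k.
Proof. by rewrite /ja mulrNz normrN. Qed.

Lemma jaD k l : ja (k + l) <= ja k + ja l.
Proof. by rewrite /ja intrD ler_normD. Qed.

Lemma ja_nat (n : nat) : ja n%:Z = n%:R.
Proof. by rewrite /ja normr_nat. Qed.

Lemma ja_ge1 k : k != 0 -> 1 <= ja k.
Proof. by move=> k0; rewrite /ja -intr_norm ler1z -gtz0_ge1 normr_gt0. Qed.

Definition pw k : R := ((1 + ja k) ^+ 2)^-1.

Lemma pw_ge0 k : 0 <= pw k.
Proof. by rewrite /pw invr_ge0 sqr_ge0. Qed.

(** The correction -2 / (n + 1) makes the induction close: the two new terms 2 / (n + 2)^2 are at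
    most 2 / (n + 1) - 2 / (n + 2). *)
Lemma sum_pw_irange n : \sum_(k <- irange n) pw k <= 3 - 2 / n.+1%:R.
Proof.
elim: n => [|n ih].
  by rewrite big_irange0 /pw /ja normr0 addr0 expr1n invr1; lra.
rewrite big_irangeS /pw jaN ja_nat -/(pw _) addrA.
apply: le_trans (lerD (lexx _) ih) _.
rewrite addrCA lerD2l -subr_ge0 -!natr1 -/(n%:R).
have n0 : 0 <= n%:R :> R by [].
move: (n%:R : R) n0 => x x0.
rewrite [leRHS](_ : _ = 2 / ((x + 1) * (x + 1 + 1) ^+ 2)).
  by rewrite divr_ge0// mulr_ge0 ?sqr_ge0//; lra.
by field; apply/andP; split; lra.
Qed.

Lemma sum_pw s : uniq s -> \sum_(k <- s) pw k <= 3.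
Proof.
move=> us; have [n sn] := subset_irange s.
rewrite (le_trans (ler_sum_subset us (irange_uniq n) sn pw_ge0))//.
rewrite (le_trans (sum_pw_irange n))// gerBl.
by rewrite divr_ge0.
Qed.

Lemma sum_pw_inj s (h : int -> int) : injective h -> uniq s -> \sum_(k <- s) pw (h k) <= 3.
Proof.
by move=> ih us; rewrite -(big_map h xpredT pw) sum_pw// map_inj_uniq.
Qed.

Lemma sum_cauchy (T : Type) (r : seq T) (W b : T -> R) : (forall i, 0 <= W i) ->
  (\sum_(l <- r) W l * b l) ^+ 2 <= (\sum_(l <- r) W l * b l ^+ 2) * \sum_(l <- r) W l.
Proof.
move=> W0; apply: discr_le; last by apply: sumr_ge0.
move=> t; rewrite !mulr_sumr -!big_split/=; apply: sumr_ge0 => l _.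
rewrite [leRHS](_ : _ = W l * (b l + t) ^+ 2); last by ring.
by rewrite mulr_ge0// sqr_ge0.
Qed.

(** For fixed k or fixed l, both k - l and k + l run injectively through the integers, so every row
    and every column of |A| sums to at most (3 + 3) D. *)
Lemma schur (A : int -> int -> R) (D : R) b s t : uniq s -> uniq t -> 0 <= D ->
  (forall k l, `|A k l| <= D * (pw (k - l) + pw (k + l))) ->
  \sum_(k <- t) (\sum_(l <- s) A k l * b l) ^+ 2 <= (6 * D) ^+ 2 * \sum_(l <- s) b l ^+ 2.
Proof.
move=> us ut D0 hA.
have row k : \sum_(l <- s) `|A k l| <= 6 * D.
  apply: (@le_trans _ _ (\sum_(l <- s) D * (pw (k - l) + pw (k + l)))).
    exact: ler_sum.
  rewrite -mulr_sumr mulrC ler_wpM2r// big_split/= (_ : 6 = 3 + 3); last by ring.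
  by apply: lerD; apply: sum_pw_inj => // x y; lia.
have col l : \sum_(k <- t) `|A k l| <= 6 * D.
  apply: (@le_trans _ _ (\sum_(k <- t) D * (pw (k - l) + pw (k + l)))).
    exact: ler_sum.
  rewrite -mulr_sumr mulrC ler_wpM2r// big_split/= (_ : 6 = 3 + 3); last by ring.
  by apply: lerD; apply: sum_pw_inj => // x y; lia.
apply: (@le_trans _ _ (\sum_(k <- t) (6 * D * \sum_(l <- s) `|A k l| * b l ^+ 2))).
  apply: ler_sum => k _.
  apply: (@le_trans _ _ ((\sum_(l <- s) `|A k l| * `|b l|) ^+ 2)).
    rewrite -[leLHS]real_normK ?num_real// ler_pXn2r ?nnegrE//; last first.
      by apply: sumr_ge0 => l _; rewrite mulr_ge0.
    rewrite (le_trans (ler_norm_sum _ _ _))// ler_sum// => l _.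
    by rewrite normrM.
  apply: le_trans (sum_cauchy _ _ _) _ => //.
  rewrite mulrC ler_pM ?sumr_ge0//.
  by apply: ler_sum => l _; rewrite real_normK ?num_real.
rewrite -mulr_sumr expr2 -[leRHS]mulrA ler_wpM2l ?mulr_ge0//.
rewrite exchange_big/= mulr_sumr; apply: ler_sum => l _.
by rewrite -mulr_suml ler_wpM2r ?sqr_ge0.
Qed.

End schur.

(** * Decay of the coefficients of smooth functions *)

Section decay.
Context {R : realType}.
Implicit Types (f g v : R -> R) (k l : int).

Lemma hc_derive f f' k : periodic2pi f -> (forall x, is_derive x (1 : R) f (f' x)) ->
  continuous f' -> hc k f' = - k%:~R * hc (- k) f.
Proof.
move=> pf df cf'; have cf : continuous f := is_derive_continuous df.
have d x : is_derive x (1 : R) (fun x => f x * cas k x)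
    (f' x * cas k x + k%:~R * (f x * cas (- k) x)).
  have dc := is_derive_cas k x; have dfx := df x.
  apply: (is_derive_eq (is_deriveM dfx dc)).
  by rewrite /GRing.scale/=; ring.
have c1 : continuous (fun x => f' x * cas k x).
  by move=> x; apply: cvgM; [exact: cf'|exact: continuous_cas].
have c2 : continuous (fun x => k%:~R * (f x * cas (- k) x)).
  move=> x; apply: cvgM; first exact: cvg_cst.
  by apply: cvgM; [exact: cf|exact: continuous_cas].
have := @cint_is_derive R _ _ d; move=> /(_ _)/wrap[|].
  by move=> x; apply: cvgD; [exact: c1|exact: c2].
rewrite cintD; [|exact: continuous_cintegrable|exact: continuous_cintegrable].
rewrite -{1}(add0r (2 * pi)) pf -{1}(add0r (2 * pi)) cas_periodic subrr.
rewrite cintZ; last first.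
  by apply: continuous_cintegrable => x; apply: cvgM; [exact: cf|exact: continuous_cas].
rewrite -[cint _]/(ip f' (cas k)) -[cint (fun x => f x * _)]/(ip f (cas (- k))) => /eqP.
by rewrite addr_eq0 => /eqP e; rewrite /hc e; ring.
Qed.

Lemma Cinf_hc_derive1 v k : Cinf v -> hc k (derive1 v) = - k%:~R * hc (- k) v.
Proof.
move=> cv; apply: hc_derive; first exact: Cinf_periodic.
  by move=> x; exact: Cinf_derive.
exact: Cinf_continuous (Cinf_derive1 cv).
Qed.

Lemma hc_bounded f M : measurable_fun [set: R] f ->
  (forall x, circ R x -> `|f x| <= M) -> forall k, `|hc k f| <= 2 * M.
Proof.
move=> mf fM k; have p0 := pi2_gt0 (R := R).
rewrite /hc normrM normfV (gtr0_norm p0) ler_pdivrMr//.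
have sf : sqint f := sqint_bounded mf fM.
have i1 := sqint_ip sf (sqint_cas k).
apply: le_trans (le_norm_cint i1) _.
rewrite -cint_cst; apply: le_cint; [exact: cintegrable_norm|exact: cintegrable_cst|].
move=> x Cx; rewrite normrM mulrC ler_pM ?fM//; exact: norm_cas_le2.
Qed.

(** Three powers, because one of them will be spent on the symbol or on a Sobolev weight and the
    other two have to form the summable [pw]. *)
Lemma Cinf_decay v : Cinf v ->
  exists2 D : R, 0 <= D & forall k, `|hc k v| <= D / (1 + ja k) ^+ 3.
Proof.
move=> cv; have cv1 := Cinf_derive1 cv; have cv2 := Cinf_derive1 cv1.
have cv3 := Cinf_derive1 cv2.
have bd w : Cinf w -> exists2 M : R, 0 <= M & forall k, `|hc k w| <= 2 * M.
  move=> cw; have [M M0 hM] := periodic_bounded (Cinf_continuous cw) (Cinf_periodic cw).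
  exists M => //; apply: hc_bounded => //.
  by apply: continuous_measurable_fun; exact: Cinf_continuous.
have [M0 M00 h0] := bd _ cv; have [M3 M30 h3] := bd _ cv3.
(* For k <> 0 one has (1 + |k|)^3 <= 8 |k|^3 and the third derivative is used; M0 covers k = 0. *)
exists (8 * (2 * M0 + 2 * M3)); first by rewrite mulr_ge0// addr_ge0// mulr_ge0.
move=> k; have j0 : 0 < 1 + ja k :> R by rewrite ltr_wpDr// ja_ge0.
rewrite ler_pdivlMr ?exprn_gt0//.
have [->|k0] := eqVneq k 0.
  rewrite /ja normr0 addr0 expr1n mulr1 (le_trans (h0 _))//; lra.
have h : `|hc k v| * ja k ^+ 3 <= 2 * M3.
  rewrite (le_trans _ (h3 (- k)))// !Cinf_hc_derive1// !opprK !normrM !normrN -!/(ja _) !jaN.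
  by rewrite le_eqVlt; apply/orP; left; apply/eqP; ring.
have j1 := ja_ge1 (R := R) k0.
apply: (@le_trans _ _ (8 * (`|hc k v| * ja k ^+ 3))).
  rewrite [leRHS]mulrCA ler_wpM2l// (_ : 8 = 2 ^+ 3); last by ring.
  by rewrite -exprMn lerXn2r ?nnegrE//; lra.
rewrite ler_wpM2l// (le_trans h)//; lra.
Qed.

Lemma hcM_cas v k l : sqint v -> hc k (fun x => v x * cas l x) =
  (hc (k - l) v + hc (- (k - l)) v) / 2 + (hc (k + l) v - hc (- (k + l)) v) / 2.
Proof.
move=> sv; have sc j := sqint_cas (R := R) j.
rewrite {1}/hc /ip.
rewrite (eq_cint (g := fun x => 2^-1 * (v x * (cas (k - l) x + cas (- (k - l)) x))
    + 2^-1 * (v x * (cas (k + l) x - cas (- (k + l)) x)))); last first.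
  by move=> x _; rewrite -mulrA (mulrC (cas l x)) casM cosE_cas sinE_cas; field.
have s1 : sqint (fun x : R => cas (k - l) x + cas (- (k - l)) x) by exact: sqintD.
have s2 : sqint (fun x : R => cas (k + l) x - cas (- (k + l)) x) by exact: sqintB.
have i1 := sqint_ip sv s1; have i2 := sqint_ip sv s2.
rewrite cintD; [|exact: cintegrableZ|exact: cintegrableZ].
rewrite !cintZ// -[cint _]/(ip v (fun x => _ + _)).
rewrite -[cint (fun x => v x * (_ - _))]/(ip v (fun x => _ - _)).
by rewrite ipDr// ipBr// /hc; ring.
Qed.

Lemma Cinf_offdiag v : Cinf v -> exists2 D : R, 0 <= D & forall k l,
  `|hc k (fun x => v x * cas l x)| <= D * (((1 + ja (k - l)) ^+ 3)^-1 + ((1 + ja (k + l)) ^+ 3)^-1).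
Proof.
move=> cv; have [D D0 hD] := Cinf_decay cv; exists D => // k l.
have sv := continuous_sqint (Cinf_continuous cv).
rewrite hcM_cas// mulrDr (le_trans (ler_normD _ _))// lerD//.
  rewrite normrM [X in _ * X]ger0_norm// ler_pdivrMr// (le_trans (ler_normD _ _))//.
  by have := hD (k - l); have := hD (- (k - l)); rewrite jaN; lra.
rewrite normrM [X in _ * X]ger0_norm// ler_pdivrMr// (le_trans (ler_normB _ _))//.
by have := hD (k + l); have := hD (- (k + l)); rewrite jaN; lra.
Qed.

End decay.

(** * Products and sums of smooth functions *)

Section smooth_algebra.
Context {R : realType}.
Implicit Types (f g v : R -> R) (k l : int).

(** Recursion through the first derivative lets an induction on n range over all functions, as the
    product rule requires. *)
Fixpoint smoothn (n : nat) f : Prop :=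
  (forall x, derivable f x 1) /\ (if n is n'.+1 then smoothn n' (derive1 f) else True).

Lemma smoothnW n f : smoothn n.+1 f -> smoothn n f.
Proof.
elim: n f => [|n ih] f; first by case=> df _; split.
by move=> [df /ih sf]; split.
Qed.

Lemma smoothnP f : (forall n x, derivable (derive1n n f) x 1) <-> (forall n, smoothn n f).
Proof.
split=> [h n|h n x].
  elim: n f h => [|n ih] f h; first by split=> //; exact: (h 0%N).
  split; first exact: (h 0%N).
  by apply: ih => m x; rewrite -derive1Sn; exact: h.
move: f h x; elim: n => [|n ih] f h x; first by case: (h 0%N) => + _; apply.
by rewrite derive1Sn; apply: ih => m; case: (h m.+1).
Qed.

Lemma smoothnD n f g : smoothn n f -> smoothn n g -> smoothn n (fun x => f x + g x).
Proof.
elim: n f g => [|n ih] f g [df sf] [dg sg].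
  by split=> // x; apply: derivableD.
split; first by move=> x; apply: derivableD.
have -> : derive1 (fun x => f x + g x) = fun x => derive1 f x + derive1 g x.
  by apply/funext => x; rewrite !derive1E deriveD.
exact: ih.
Qed.

Lemma smoothnM n f g : smoothn n f -> smoothn n g -> smoothn n (fun x => f x * g x).
Proof.
elim: n f g => [|n ih] f g.
  by move=> [df sf] [dg sg]; split=> // x; apply: derivableM.
move=> Sf Sg; have [df sf] := Sf; have [dg sg] := Sg.
split; first by move=> x; apply: derivableM.
have -> : derive1 (fun x => f x * g x) = fun x => f x * derive1 g x + g x * derive1 f x.
  by apply/funext => x; rewrite !derive1E deriveM.
by apply: smoothnD; apply: ih => //; exact: smoothnW.
Qed.

Lemma CinfM f g : Cinf f -> Cinf g -> Cinf (fun x => f x * g x).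
Proof.
move=> [pf sf] [pg sg]; split; first by move=> x; rewrite pf pg.
by apply/smoothnP => n; apply: smoothnM; exact: (smoothnP _).1.
Qed.

Lemma CinfD f g : Cinf f -> Cinf g -> Cinf (fun x => f x + g x).
Proof.
move=> [pf sf] [pg sg]; split; first by move=> x; rewrite pf pg.
by apply/smoothnP => n; apply: smoothnD; exact: (smoothnP _).1.
Qed.

Lemma Cinf_cst (a : R) : Cinf (fun=> a).
Proof.
split=> // n; have [b ->] : exists b : R, derive1n n (fun=> a) = (fun=> b :> R).
  elim: n => [|n [b ih]]; first by exists a.
  by exists 0; rewrite derive1nS ih; apply/funext => x; rewrite derive1_cst.
by move=> x; apply: derivable_cst.
Qed.

Lemma CinfZ (a : R) f : Cinf f -> Cinf (fun x => a * f x).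
Proof. by move=> cf; apply: CinfM => //; exact: Cinf_cst. Qed.

Lemma Cinf_trig s (c : int -> R) : Cinf (trig s c).
Proof.
rewrite /trig; elim: s => [|k s ih].
  by under eq_fun do rewrite big_nil; exact: Cinf_cst.
under eq_fun do rewrite big_cons.
by apply: CinfD => //; apply: CinfZ; exact: Cinf_cas.
Qed.

Lemma cvg_le_bound (u : nat -> R) (l M : R) : u n @[n --> \oo] --> l ->
  (forall n, u n <= M) -> l <= M.
Proof.
move=> ul uM; rewrite -(cvg_lim (@Rhausdorff R) ul); apply: limr_le.
  by apply/cvg_ex; exists l.
by near=> n; exact: uM.
Unshelve. all: by end_near. Qed.

Lemma cvg_bigsum (I : Type) (s : seq I) (u : I -> nat -> R) (a : I -> R) :
  (forall i, u i n @[n --> \oo] --> a i) ->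
  \sum_(i <- s) u i n @[n --> \oo] --> \sum_(i <- s) a i.
Proof.
move=> ua; elim: s => [|i s ih].
  by under eq_fun do rewrite big_nil; rewrite big_nil; exact: cvg_cst.
by under eq_fun do rewrite big_cons; rewrite big_cons; exact: cvgD.
Qed.

Lemma cvg_sqr_le_bound (u : nat -> R) (l M : R) : u n @[n --> \oo] --> l ->
  (forall n, u n ^+ 2 <= M) -> l ^+ 2 <= M.
Proof.
move=> ul uM; apply: (@cvg_le_bound (fun n => u n ^+ 2)) => //.
by under eq_fun do rewrite expr2; rewrite expr2; exact: cvgM.
Qed.

End smooth_algebra.

(** * Commutator and multiplication estimates in H^(-1/2) *)

Section negative_sobolev.
Context {R : realType}.
Implicit Types (f g v a b : R -> R) (k l : int) (c : int -> R).

Definition qw k : R := (1 + k%:~R ^+ 2) `^ 2^-1.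
(** Square root of the H^(1/2) weight: scaling rows or columns of a matrix by it turns weighted
    norms into the plain l^2 norms of [schur]. *)
Definition rw k : R := Num.sqrt (qw k).

Lemma one_sqr_gt0 k : 0 < 1 + k%:~R ^+ 2 :> R.
Proof. by rewrite ltr_pwDl// sqr_ge0. Qed.

Lemma qw_gt0 k : 0 < qw k.
Proof. by rewrite powR_gt0// one_sqr_gt0. Qed.

Lemma qwN k : qw (- k) = qw k.
Proof. by rewrite /qw mulrNz sqrrN. Qed.

Lemma qwV k : (1 + k%:~R ^+ 2) `^ (- 2^-1) = (qw k)^-1.
Proof. by rewrite powRN. Qed.

Lemma qw_sqr k : qw k ^+ 2 = 1 + ja k ^+ 2.
Proof.
rewrite /qw powR12_sqrt; last exact: ltW (one_sqr_gt0 k).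
by rewrite sqr_sqrtr ?real_normK ?num_real// ltW// one_sqr_gt0.
Qed.

Lemma rw_gt0 k : 0 < rw k.
Proof. by rewrite sqrtr_gt0 qw_gt0. Qed.

Lemma rw_sqr k : rw k ^+ 2 = qw k.
Proof. by rewrite sqr_sqrtr// ltW// qw_gt0. Qed.

Lemma rw_exp4 k : rw k ^+ 4 = 1 + ja k ^+ 2.
Proof. by rewrite (exprM _ 2 2) rw_sqr qw_sqr. Qed.

Lemma lam_sqr k : lam k ^+ 2 = ja k :> R.
Proof.
rewrite /lam (_ : 2 * 4^-1 = 2^-1); last by field.
by rewrite powR12_sqrt// sqr_sqrtr.
Qed.

(** The gain of half a derivative: |k| - |l| factors as (lam k - lam l) (lam k + lam l), and rw l <=
    2 lam l once l <> 0. For l = 0 it is lam k <= lam k ^ 2 on integers. *)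
Lemma lam_rw k l : `|lam k - lam l| * rw l <= 2 * `|ja k - ja l| :> R.
Proof.
have := lam_ge0 (R := R) k; have := lam_ge0 (R := R) l => l0 k0.
have [->|ln0] := eqVneq l 0.
  rewrite {2}/ja normr0 subr0 (_ : lam 0 = 0) ?subr0; last first.
    by apply/eqP; rewrite -sqrf_eq0 lam_sqr /ja normr0.
  rewrite (_ : rw 0 = 1) ?mulr1; last first.
    by rewrite /rw /qw expr0n addr0 powR1 sqrtr1.
  rewrite (ger0_norm k0) (ger0_norm (ja_ge0 _)).
  have [->|kn0] := eqVneq k 0.
    by rewrite (_ : lam 0 = 0) ?mulr_ge0 ?ja_ge0//; apply/eqP; rewrite -sqrf_eq0 lam_sqr /ja normr0.
  have := ja_ge1 (R := R) kn0; rewrite -lam_sqr => h.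
  by nra.
have h : rw l <= 2 * lam l.
  rewrite -(@ler_pXn2r _ 4) ?nnegrE ?mulr_ge0//; last exact: sqrtr_ge0.
  rewrite rw_exp4 exprMn (exprM (lam l) 2 2) lam_sqr.
  have := ja_ge1 (R := R) ln0; move: (ja l) => x x1.
  by nra.
rewrite -!lam_sqr subr_sqr normrM.
rewrite (le_trans (ler_wpM2l (normr_ge0 _) h))//.
rewrite mulrCA ler_wpM2l// ler_wpM2l// ger0_norm ?addr_ge0//.
by rewrite lerDr.
Qed.

Lemma ja_subl k l : `|ja k - ja l| <= ja (k - l) :> R.
Proof. by rewrite /ja intrB ler_dist_dist. Qed.

Lemma ja_subr k l : `|ja k - ja l| <= ja (k + l) :> R.
Proof. by rewrite -(jaN l) -{2}(opprK l) ja_subl. Qed.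

(** Peetre's inequality for this weight, proved for fourth powers, where [rw] becomes a polynomial
    in |k|. *)
Lemma rw_le k l j : ja l <= ja k + ja j :> R -> rw l <= 2 * rw k * (1 + ja j) :> R.
Proof.
move=> h; have := ja_ge0 (R := R) k; have := ja_ge0 (R := R) l.
have := ja_ge0 (R := R) j => j0 l0 k0.
have rl0 := rw_gt0 l; have rk0 := rw_gt0 k.
rewrite -(@ler_pXn2r _ 4) ?nnegrE ?mulr_ge0 ?addr_ge0//; [|exact: ltW|exact: ltW].
rewrite !exprMn !rw_exp4; move: (ja l) (ja k) (ja j) h j0 l0 k0 => x y z h z0 x0 y0.
apply: (@le_trans _ _ ((1 + y + z) ^+ 2)); first by nra.
apply: (@le_trans _ _ (((1 + y) * (1 + z)) ^+ 2)); first by rewrite lerXn2r ?nnegrE; nra.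
rewrite exprMn; apply: ler_pM; rewrite ?sqr_ge0//; first by nra.
rewrite (exprM _ 2 2); have : 1 <= (1 + z) ^+ 2 by nra.
by move: ((1 + z) ^+ 2) => t; nra.
Qed.

Lemma sum_qw_le (c : int -> R) n N : (n <= N)%N ->
  \sum_(k <- irange n) qw k * c k ^+ 2 <= \sum_(k <- irange N) qw k * c k ^+ 2.
Proof.
move=> nN; apply: (@ler_sum_subset R int).
- exact: irange_uniq.
- exact: irange_uniq.
- by move=> k; rewrite !mem_irange => /leq_trans; apply.
- by move=> k; rewrite mulr_ge0 ?sqr_ge0// ltW// qw_gt0.
Qed.

Lemma sum_qw_cvg (c : int -> R) (M : R) : (forall n, \sum_(k <- irange n) qw k * c k ^+ 2 <= M) ->
  cvgn (fun n => \sum_(k <- irange n) qw k * c k ^+ 2).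
Proof.
move=> hM; apply: nondecreasing_is_cvgn; first by move=> a b; exact: sum_qw_le.
by exists M => _ [n _ <-]; exact: hM.
Qed.

Lemma pw_ja1 j : (1 + ja j) * ((1 + ja j) ^+ 3)^-1 = pw j :> R.
Proof.
have := ja_ge0 (R := R) j; rewrite /pw; move: (ja j) => x x0.
by field; lra.
Qed.

Lemma pw_ja j : ja j * ((1 + ja j) ^+ 3)^-1 <= pw j :> R.
Proof.
rewrite -pw_ja1 ler_wpM2r ?lerDr// invr_ge0 exprn_ge0// addr_ge0//; exact: ja_ge0.
Qed.

Lemma lipsM C C' f g (M M' : R) : lips C f -> lips C' g -> (forall x, `|f x| <= M) ->
  (forall x, `|g x| <= M') -> lips (M * C' + M' * C) (fun x => f x * g x).
Proof.
move=> lf lg fM gM x y.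
rewrite (_ : _ - _ = f x * (g x - g y) + g y * (f x - f y)); last by ring.
rewrite (le_trans (ler_normD _ _))// mulrDl -!mulrA lerD// normrM ler_pM//.
Qed.

Variables (K : R -> R) (hK : is_K14 K).

(** In Lam(v cas_l) - v Lam(cas_l) the first operator acts on the output frequency k, and the second
    on the eigenfunction [cas l]. *)
Lemma hc_Tk_cas v k l : Cinf v -> hc k (Tk K v (cas l)) = (lam k - lam l) * hc k (fun x => v x * cas l x).
Proof.
move=> cv; have [C lv] := Cinf_lips cv; have [C' lc] := @Cinf_lips R _ (Cinf_cas l).
have [M M0 vM] := periodic_bounded (Cinf_continuous cv) (Cinf_periodic cv).
have lvc := lipsM lv lc vM (norm_cas_le2 l).
have cvc := CinfM cv (Cinf_cas l); have pvc := Cinf_periodic cvc.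
have svc := continuous_sqint (Cinf_continuous cvc).
have sL := sqint_LamK hK lvc; have sLc := sqint_LamK hK lc.
have [_ hL] := (is_fraclapP _ svc).1 (LamK_fraclap hK lvc pvc).
have E x : Tk K v (cas l) x = LamK K (fun x => v x * cas l x) x - v x * LamK K (cas l) x.
  rewrite /Tk /LamK -cintZ; last exact: kernel_cintegrable lc.
  rewrite -cintB; [|exact: kernel_cintegrable lvc|apply: cintegrableZ; exact: kernel_cintegrable lc].
  by apply: eq_cint => y _; ring.
rewrite (funext E).
have sT : sqint (fun x => v x * LamK K (cas l) x).
  under eq_fun do rewrite mulrC.
  by apply: (sqintM sLc) => //; exact: lips_measurable lv.
rewrite hcB// hL mulrBl; congr (_ - _).
rewrite -hcZ//; congr (_ / _); apply: eq_cint_ae.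
- by apply: measurable_funM; [exact: sT.1|exact: measurable_cas].
- by apply: measurable_funM; [exact: (sqintZ _ svc).1|exact: measurable_cas].
- by apply: aecS (LamK_cas hK l) => x _ ->; ring.
Qed.

Lemma Tk_trig v s c x : Cinf v -> Tk K v (trig s c) x = \sum_(l <- s) c l * Tk K v (cas l) x.
Proof.
move=> cv; have [C lv] := Cinf_lips cv.
have ic l : cintegrable (fun y => cas l y * ((v x - v y) * K (x - y))).
  by apply: (Tk_integrable hK x lv (measurable_cas l)) => y _; exact: norm_cas_le2.
rewrite /Tk; under [in RHS]eq_bigr do rewrite -cintZ//.
rewrite -cint_sum; last by move=> l; exact: cintegrableZ.
by apply: eq_cint => y _; rewrite /trig mulr_suml; apply: eq_bigr => l _; rewrite -mulrA.
Qed.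

Lemma sqint_Tk_continuous v b : Cinf v -> continuous b -> sqint (Tk K v b).
Proof.
move=> cv cb; have [C lv] := Cinf_lips cv; have [M bM] := continuous_bounded_circ cb.
by apply: (sqint_Tk hK lv _ bM); exact: continuous_measurable_fun.
Qed.

Lemma Tk_trig_bound v : Cinf v -> exists2 D, 0 <= D & forall s c, uniq s ->
  sqn (Tk K v (trig s c)) <= D * \sum_(l <- s) (qw l)^-1 * c l ^+ 2.
Proof.
move=> cv; have [C lv] := Cinf_lips cv; have [D D0 hD] := Cinf_offdiag cv.
pose A k l := (lam k - lam l) * hc k (fun x => v x * cas l x) * rw l.
exists (2 * pi * (6 * (2 * D)) ^+ 2); first by rewrite mulr_ge0 ?sqr_ge0// ltW// pi2_gt0.
move=> s c us; apply: parseval_le.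
  by apply: sqint_Tk_continuous => //; exact: continuous_trig.
move=> n; rewrite -[leRHS]mulrA ler_wpM2l//; first exact: ltW (pi2_gt0).
have E k : hc k (Tk K v (trig s c)) = \sum_(l <- s) A k l * (c l / rw l).
  rewrite (_ : Tk K v (trig s c) = fun x => \sum_(l <- s) c l * Tk K v (cas l) x); last first.
    by apply/funext => x; exact: Tk_trig.
  have sT l : sqint (Tk K v (cas l)).
    by apply: sqint_Tk_continuous => //; exact: continuous_cas.
  rewrite /hc ip_suml; [|by move=> l; exact: sqintZ|exact: sqint_cas].
  rewrite mulr_suml; apply: eq_bigr => l _.
  rewrite -[_ / _]/(hc k _) hcZ// hc_Tk_cas// /A; field.
  by rewrite gt_eqF// rw_gt0.
under eq_bigr do rewrite E.
apply: le_trans (schur (D := 2 * D) _ us (irange_uniq n) _ _) _.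
- by rewrite mulr_ge0.
- move=> k l; rewrite /A mulrAC normrM [`|_ * rw l|]normrM (ger0_norm (ltW (rw_gt0 l))).
  (* The factor ||k| - |l|| is bounded by |k - l| or by |k + l|, according to the decaying term it
     multiplies; it uses up one of the three powers and leaves [pw]. *)
  rewrite (le_trans (ler_pM _ _ (lam_rw k l) (hD k l)))// ?mulr_ge0//; first exact: sqrtr_ge0.
  rewrite -!mulrA ler_wpM2l// mulrCA ler_wpM2l// mulrDr; apply: lerD.
    apply: le_trans (pw_ja _); apply: ler_wpM2r; last exact: ja_subl.
    by rewrite invr_ge0 exprn_ge0// addr_ge0// ja_ge0.
  apply: le_trans (pw_ja _); apply: ler_wpM2r; last exact: ja_subr.
  by rewrite invr_ge0 exprn_ge0// addr_ge0// ja_ge0.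
rewrite ler_wpM2l ?sqr_ge0//; apply: ler_sum => l _.
by rewrite expr_div_n rw_sqr mulrC.
Qed.

Lemma BkB v a b b' : Cinf v -> sqint a -> sqint b -> sqint b' ->
  Bk K v a (fun x => b x - b' x) = Bk K v a b - Bk K v a b'.
Proof.
move=> cv sa sb sb'; have [C lv] := Cinf_lips cv.
have i1 := Bk_integrable hK lv sa sb; have i2 := Bk_integrable hK lv sa sb'.
by rewrite /Bk -cint2B//; apply: eq_cint2 => x y _ _ /=; ring.
Qed.

Lemma Bk_cvg v a (F : nat -> R -> R) b : Cinf v -> sqint a -> (forall n, sqint (F n)) -> sqint b ->
  L2cvg F b -> Bk K v a (F n) @[n --> \oo] --> Bk K v a b.
Proof.
move=> cv sa sF sb Fb; have [C lv] := Cinf_lips cv; have [D D0 hD] := Bk_bound hK lv.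
apply/cvgrPdist_le => e e0.
have s1 : 0 < D * sqn a + 1 by rewrite ltr_wpDl// mulr_ge0// sqn_ge0.
have [n0 hn0] := Fb (e ^+ 2 / (D * sqn a + 1)) (divr_gt0 (exprn_gt0 2 e0) s1).
exists n0 => // n /= n0n; rewrite distrC -BkB//.
apply: (normr_le_of_sqr (ltW e0)).
apply: (le_trans (hD _ _ sa (sqintB (sF n) sb))); rewrite mulrA.
apply: (le_trans (ler_wpM2l (mulr_ge0 D0 (sqn_ge0 a)) (hn0 n n0n))).
by rewrite mulrA ler_pdivrMr// mulrC ler_wpM2l ?sqr_ge0// lerDl.
Qed.

(* The matrix of [Tk K v] is (lam k - lam l) hc k (v cas_l), and the factor lam k - lam l gains the half derivative. *)
Lemma Bk_Hm12 v : Cinf v -> exists2 D, 0 <= D & forall a b M, sqint a -> sqint b ->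
  (forall n, \sum_(k <- irange n) (qw k)^-1 * hc k b ^+ 2 <= M) ->
  Bk K v a b ^+ 2 <= D * (sqn a * M).
Proof.
move=> cv; have [C lv] := Cinf_lips cv; have [D D0 hD] := Tk_trig_bound cv; exists D => //.
move=> a b M sa sb hM.
apply: cvg_sqr_le_bound (Bk_cvg cv sa (fun n => sqint_trig _ _) sb (trig_cvg sb)) _ => n.
have ct := @continuous_trig R (irange n) (hc^~ b).
have [N hN] := continuous_bounded_circ ct.
rewrite (Bk_Tk hK lv sa (continuous_measurable_fun ct) hN).
apply: le_trans (ip_sqr_le sa (sqint_Tk_continuous cv ct)) _.
rewrite mulrCA ler_wpM2l ?sqn_ge0//.
rewrite (le_trans (hD _ _ (irange_uniq n)))//.
by rewrite ler_wpM2l.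
Qed.

(** The pairings are those of -X v' with [cas k], so this bounds the H^(-1/2) norm of X v' by the
    H^(1/2) norm of v; testing with (X cas_k)' avoids differentiating v. *)
Lemma mulX_Hm12 X : Cinf X -> exists2 D, 0 <= D & forall v M, sqint v ->
  (forall n, \sum_(k <- irange n) qw k * hc k v ^+ 2 <= M) ->
  forall n, \sum_(k <- irange n) (qw k)^-1 * ip v (derive1 (fun x => X x * cas k x)) ^+ 2 <= D * M.
Proof.
move=> cX; have [D D0 hD] := Cinf_offdiag cX.
pose g k := derive1 (fun x => X x * cas k x).
have cg k : Cinf (fun x => X x * cas k x) by apply: CinfM => //; exact: Cinf_cas.
have cg1 k : continuous (g k) := Cinf_continuous (Cinf_derive1 (cg k)).
have sg k : sqint (g k) := continuous_sqint (cg1 k).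
have hg k l : hc l (g k) = - l%:~R * hc (- l) (fun x => X x * cas k x).
  exact: Cinf_hc_derive1.
pose A k l := (2 * pi) * (- l%:~R * hc (- l) (fun x => X x * cas k x)) / (rw k * rw l).
exists ((6 * (2 * pi * (2 * D))) ^+ 2); first exact: sqr_ge0.
move=> v M sv hM n.
have := @cvg_le_bound R (fun N => \sum_(k <- irange n) (qw k)^-1 * ip (trig (irange N) (hc^~ v)) (g k) ^+ 2).
apply.
  apply: cvg_bigsum => k.
  apply: cvgM; first exact: cvg_cst.
  have h : ip (trig (irange N) (hc^~ v)) (g k) @[N --> \oo] --> ip v (g k).
    by apply: L2cvg_ip => //; [move=> N; exact: sqint_trig|exact: trig_cvg].
  by under eq_fun do rewrite expr2; rewrite expr2; exact: cvgM.
move=> N.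
have E k : (qw k)^-1 * ip (trig (irange N) (hc^~ v)) (g k) ^+ 2 =
    (\sum_(l <- irange N) A k l * (rw l * hc l v)) ^+ 2.
  rewrite -rw_sqr -exprVn -exprMn ip_trig//; congr (_ ^+ 2).
  rewrite mulr_sumr; apply: eq_bigr => l _.
  rewrite ipC ip_hc hg /A; field.
  by rewrite !gt_eqF// rw_gt0.
under eq_bigr do rewrite E.
have p0 := pi2_gt0 (R := R).
apply: le_trans (schur (D := 2 * pi * (2 * D)) _ (irange_uniq N) (irange_uniq n) _ _) _.
- by rewrite !mulr_ge0// pi_ge0.
- move=> k l; have rk := rw_gt0 k; have rl := rw_gt0 l.
  rewrite /A normrM normfV (ger0_norm (ltW (mulr_gt0 rk rl))) ler_pdivrMr ?mulr_gt0//.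
  rewrite normrM (ger0_norm (ltW p0)) -!(mulrA (2 * pi)) ler_wpM2l ?(ltW p0)// normrM normrN.
  rewrite -/(ja l); have lr : ja l <= rw l ^+ 2.
    rewrite rw_sqr -(@ler_pXn2r _ 2) ?nnegrE ?ja_ge0//; last exact: ltW (qw_gt0 _).
    by rewrite qw_sqr lerDr.
  apply: le_trans (ler_pM _ _ lr (hD (- l) k)) _; rewrite ?ja_ge0//.
  rewrite -jaN opprB opprK (addrC (- l)).
  have a1 : rw l <= 2 * rw k * (1 + ja (k + l)).
    apply: rw_le; rewrite -(jaN k); apply: le_trans (jaD _ _); by rewrite addrA addNr add0r.
  have a2 : rw l <= 2 * rw k * (1 + ja (k - l)).
    by apply: rw_le; rewrite -(jaN (k - l)); apply: le_trans (jaD _ _); rewrite opprB addrCA subrr addr0.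
  rewrite -!pw_ja1; have w0 j : 0 <= ((1 + ja j) ^+ 3)^-1 :> R.
    by rewrite invr_ge0 exprn_ge0// addr_ge0// ja_ge0.
  (* The frequency |l| was bounded by rw l ^ 2; one of its factors is exchanged for rw k by [rw_le],
     at the cost of the factor 1 + |j| that the cubic decay absorbs. *)
  have key j : rw l <= 2 * rw k * (1 + ja j) ->
      rw l ^+ 2 * (D * ((1 + ja j) ^+ 3)^-1) <= 2 * D * ((1 + ja j) / (1 + ja j) ^+ 3) * (rw k * rw l).
    move=> h; have := ler_wpM2l (mulr_ge0 (mulr_ge0 D0 (w0 j)) (ltW rl)) h.
    by congr (_ <= _); ring.
  rewrite mulrDr [leLHS]mulrDr mulrDr [leRHS]mulrDl [leRHS]addrC.
  by apply: lerD; apply: key.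
- rewrite ler_wpM2l ?sqr_ge0//; rewrite (le_trans _ (hM N))// ler_sum// => l _.
  by rewrite exprMn rw_sqr.
Qed.

End negative_sobolev.

(** * Lorentz and Sobolev norms, fractional divergence *)

Section lorentz.
Context {R : realType}.
Implicit Types (f : R -> R) (t : R).
Notation mu := (@lebesgue_measure R).
Let mC : measurable (circ R) := @measurable_circ R.
Hint Resolve mC : core.

Definition distrib f t : R := fine (mu (circ R `&` [set x | t < `|f x|])).

Let mlevel f t : measurable_fun [set: R] f -> measurable [set x | t < `|f x|].
Proof.
move=> mf; have := measurableT_comp (@normr_measurable R setT) mf.
move=> /(_ measurableT _ (measurable_itv `]t, +oo[)); rewrite setTI.
by congr (measurable _); apply/seteqP; split=> x /=; rewrite in_itv/= andbT.
Qed.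

Let msub f t : measurable_fun [set: R] f -> measurable (circ R `&` [set x | t < `|f x|]).
Proof.
by move=> mf; apply: measurableI => //; exact: mlevel.
Qed.

Lemma distribE f t : measurable_fun [set: R] f ->
  mu (circ R `&` [set x | t < `|f x|]) = (distrib f t)%:E.
Proof.
move=> mf; rewrite /distrib fineK// ge0_fin_numE ?measure_ge0//.
apply: (@le_lt_trans _ _ (mu (circ R))); last exact: mu_circ_fin.
by apply: le_measure; rewrite ?inE//; exact: msub.
Qed.

Lemma distrib_ge0 f t : 0 <= distrib f t.
Proof. by rewrite /distrib fine_ge0// measure_ge0. Qed.

Lemma distrib_le f t t' : measurable_fun [set: R] f -> t <= t' -> distrib f t' <= distrib f t.
Proof.
move=> mf tt; rewrite -lee_fin -!distribE//.
apply: le_measure; rewrite ?inE; [exact: msub|exact: msub|].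
by move=> x [Cx] /= h; split=> //=; exact: le_lt_trans h.
Qed.

Lemma distrib_le2pi f t : measurable_fun [set: R] f -> distrib f t <= 2 * pi.
Proof.
move=> mf; rewrite -lee_fin -distribE// -mu_circ.
by apply: le_measure; rewrite ?inE//; exact: msub.
Qed.

Lemma cint_indic_distrib f t : measurable_fun [set: R] f ->
  cint (\1_[set x | t < `|f x|] : R -> R) = distrib f t.
Proof.
move=> mf; rewrite /cint /Rintegral /distrib; congr fine.
have := msub t mf; rewrite setIC => m.
have mt := mlevel t mf.
by rewrite integral_indic// setIC.
Qed.

Let sd f t : R := distrib f t `^ 2^-1.

Let sd_ge0 f t : 0 <= sd f t. Proof. exact: powR_ge0. Qed.

Let sd_le f t t' : measurable_fun [set: R] f -> t <= t' -> sd f t' <= sd f t.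
Proof.
move=> mf tt; apply: ge0_ler_powR; rewrite ?nnegrE ?distrib_ge0//.
exact: distrib_le.
Qed.

Let sd_mf f D : measurable D -> measurable_fun [set: R] f ->
  measurable_fun D (fun t => (sd f t)%:E).
Proof.
move=> mD mf; apply/measurable_EFinP; apply: nonincreasing_measurable => //.
by move=> x y; exact: sd_le.
Qed.

Let L21E f : measurable_fun [set: R] f ->
  L21norm f = (\int[mu]_(t in `[0%R, +oo[) (sd f t)%:E)%E.
Proof.
move=> mf; apply: eq_integral => t _.
by rewrite distribE// poweR_EFin.
Qed.

Lemma bounded_L21 f (M : R) : periodic2pi f -> measurable_fun [set: R] f ->
  (forall x, `|f x| <= M) -> L21 f.
Proof.
move=> pf mf fM; split=> //; rewrite L21E//.
pose c := (2 * pi : R) `^ 2^-1.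
apply: (@le_lt_trans _ _ (\int[mu]_(t in `[0%R, +oo[) ((fun=> c%:E) \_ (`[0%R, M]%classic : set R)) t)%E).
  apply: ge0_le_integral => //.
  - by move=> t _; rewrite lee_fin.
  - exact: sd_mf.
  - apply: (measurable_funS measurableT) => //.
    by apply: (@measurable_restrictT _ _ _ _ _ _ (measurable_itv `[0%R, M])).1; exact: measurable_cst.
  - move=> t /=; rewrite in_itv/= andbT => t0; rewrite patchE; case: ifPn => h.
      by rewrite lee_fin /sd ge0_ler_powR ?nnegrE ?distrib_ge0 ?mulr_ge0 ?pi_ge0 ?distrib_le2pi.
    have Mt : M < t.
      by rewrite ltNge; apply/negP => tM; move/negP: h; apply; rewrite inE/= in_itv/= t0.
    rewrite lee_fin /sd /distrib (_ : _ `&` _ = set0) ?measure0 ?powR0//.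
    apply/seteqP; split=> // x [_ /=].
    by move=> /lt_le_trans /(_ (fM x)) /(lt_trans Mt); rewrite ltxx.
rewrite -integral_mkcondr integral_cst//; last exact: measurableI.
apply: lte_mul_pinfty; rewrite ?lee_fin ?powR_ge0//.
apply: (@le_lt_trans _ _ (mu `[0, M])); last by rewrite lebesgue_measure_itv/=; case: ifP => _; rewrite ?ltry.
by apply: le_measure; rewrite ?inE//; exact: measurableI.
Qed.

Lemma ler_sqr_mono (x y : R) : 0 <= x -> x <= y -> x ^+ 2 <= y ^+ 2.
Proof. by move=> x0 xy; rewrite !expr2 ler_pM. Qed.

Let sd_layers f n : measurable_fun [set: R] f ->
  ((\sum_(i < n) 2 ^+ i * sd f (2 ^+ i.+1))%:E <= \int[mu]_(t in `[0%R, (2 ^+ n)%R]) (sd f t)%:E)%E.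
Proof.
move=> mf; elim: n => [|n ih].
  by rewrite big_ord0 integral_ge0// => t _; rewrite lee_fin.
have l1 : 0 <= 2 ^+ n :> R by [].
have l2 : 2 ^+ n <= 2 ^+ n.+1 :> R by rewrite exprS ler_peMl// ler1n.
have U : `[0, 2 ^+ n.+1]%classic = `[0, 2 ^+ n]%classic `|` `]2 ^+ n, 2 ^+ n.+1]%classic :> set R.
  by rewrite -itv_bndbnd_setU// bnd_simp.
rewrite U ge0_integral_setU//; first last.
- apply/disj_setPS => t [/=]; rewrite !in_itv/= => /andP[_ h] /andP[h' _].
  by have := le_lt_trans h h'; rewrite ltxx.
- by move=> t _; rewrite lee_fin.
- by apply: sd_mf => //; exact: measurableU.
rewrite big_ord_recr/= EFinD leeD//.
apply: (@le_trans _ _ (\int[mu]_(t in `](2 ^+ n)%R, (2 ^+ n.+1)%R]) (sd f (2 ^+ n.+1))%:E)%E).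
  have l3 : 2 ^+ n < 2 ^+ n.+1 :> R by rewrite exprS ltr_pMl ?ltr1n// exprn_gt0.
  have mE : mu `](2 ^+ n)%R, (2 ^+ n.+1)%R] = (2 ^+ n)%:E.
    by rewrite lebesgue_measure_itv/= lte_fin l3 -EFinB; congr EFin; rewrite exprS; ring.
  rewrite integral_cst//.
  by rewrite [X in (_ <= _ * X)%E]mE -EFinM mulrC.
apply: ge0_le_integral => //.
- by move=> t _; rewrite lee_fin.
- exact: sd_mf.
- by move=> t /=; rewrite in_itv/= => /andP[_ h]; rewrite lee_fin; exact: sd_le.
Qed.

Lemma sum_sqr_le (n : nat) (x : 'I_n -> R) : (forall i, 0 <= x i) ->
  \sum_(i < n) x i ^+ 2 <= (\sum_(i < n) x i) ^+ 2.
Proof.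
elim: n x => [|n ih] x x0; first by rewrite !big_ord0 expr0n.
rewrite !big_ord_recr/= sqrrD.
have := ih (fun i => x (widen_ord (leqnSn n) i)) (fun i => x0 _).
have s0 : 0 <= \sum_(i < n) x (widen_ord (leqnSn n) i) by apply: sumr_ge0.
have := x0 ord_max; move: (x ord_max) (\sum_(i < n) x _) s0 => a s s0 a0.
by move: (\sum_(i < n) _) => q; nra.
Qed.

(** Raising the truncation level from 2^(n+1) to 2^(n+2) matters only if a > 2^(n+1), and then the
    square is at most 4^(n+2) = 16 * 4^n. *)
Lemma min_layers (a : R) n : 0 <= a -> Num.min a (2 ^+ n.+1) ^+ 2 <=
  4 + 16 * \sum_(i < n) 4 ^+ i * (2 ^+ i.+1 < a)%R%:R.
Proof.
move=> a0; elim: n => [|n ih].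
  rewrite big_ord0 mulr0 addr0 expr1 (_ : 4 = 2 ^+ 2); last by ring.
  by apply: ler_sqr_mono; [rewrite le_min a0/=|rewrite ge_min lexx orbT].
rewrite big_ord_recr/=; have [h|h] := ltP (2 ^+ n.+1) a.
  have s0 : 0 <= \sum_(i < n) 4 ^+ i * (2 ^+ i.+1 < a)%R%:R :> R by apply: sumr_ge0 => i _; rewrite mulr_ge0// exprn_ge0.
  apply: (@le_trans _ _ ((2 ^+ n.+2) ^+ 2)).
    by apply: ler_sqr_mono; [rewrite le_min a0 exprn_ge0|rewrite ge_min lexx orbT].
  rewrite exprAC (_ : 2 ^+ 2 = 4 :> R); last by ring.
  rewrite !exprS mulr1.
  by move: (\sum_(i < n) _) s0 (4 ^+ n) => s s0 t; lra.
rewrite mulr0 addr0 (le_trans _ ih)//; apply: ler_sqr_mono; first by rewrite le_min a0 exprn_ge0.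
by rewrite (min_l h) ge_min lexx.
Qed.

(* 4^i |{|f| > 2^(i+1)}| is the square of a lower bound for the part of the L^(2,1) integral over ]2^i, 2^(i+1)]. *)
Lemma L21_sqint f : L21 f -> sqint f.
Proof.
move=> [pf mf]; rewrite L21E// => fin.
pose N := fine (\int[mu]_(t in `[0%R, +oo[) (sd f t)%:E)%E.
have NE : (\int[mu]_(t in `[0%R, +oo[) (sd f t)%:E)%E = N%:E.
  rewrite /N fineK// ge0_fin_numE//.
  by apply: integral_ge0 => t _; rewrite lee_fin.
have hN n : \sum_(i < n) 4 ^+ i * distrib f (2 ^+ i.+1) <= N ^+ 2.
  have h : \sum_(i < n) 2 ^+ i * sd f (2 ^+ i.+1) <= N.
    rewrite -lee_fin -NE (le_trans (sd_layers n mf))//.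
    apply: ge0_subset_integral => //; first exact: sd_mf.
      by move=> t _; rewrite lee_fin.
    by move=> t /=; rewrite !in_itv/= => /andP[->].
  have p0 : 0 <= \sum_(i < n) 2 ^+ i * sd f (2 ^+ i.+1) by apply: sumr_ge0 => i _; rewrite mulr_ge0.
  apply: (@le_trans _ _ ((\sum_(i < n) 2 ^+ i * sd f (2 ^+ i.+1)) ^+ 2)); last first.
    by rewrite lerXn2r// nnegrE// (le_trans p0).
  apply: le_trans (sum_sqr_le _); last by move=> i; rewrite mulr_ge0.
  rewrite le_eqVlt; apply/orP; left; apply/eqP; apply: eq_bigr => i _.
  rewrite exprMn exprAC (_ : 2 ^+ 2 = 4 :> R); last by ring.
  by rewrite /sd powR12_sqrt ?distrib_ge0// sqr_sqrtr// distrib_ge0.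
split=> //; apply: (cintegrable_int (f := fun x => f x ^+ 2)).
have mm n : measurable_fun [set: R] (fun x => Num.min `|f x| (2 ^+ n.+1) ^+ 2).
  apply: measurable_funX; apply: measurable_minr => //.
  exact: measurableT_comp.
have iF n : cintegrable (fun x => Num.min `|f x| (2 ^+ n.+1) ^+ 2).
  apply: (bounded_cintegrable (M := (2 ^+ n.+1) ^+ 2)) => // x _.
  rewrite ger0_norm ?sqr_ge0//; apply: ler_sqr_mono; first by rewrite le_min normr_ge0 exprn_ge0.
  by rewrite ge_min lexx orbT.
have mt t : measurable_fun [set: R] (\1_[set x | t < `|f x|] : R -> R).
  by apply: measurable_indic; exact: mlevel.
have it t : cintegrable (\1_[set x | t < `|f x|] : R -> R).
  apply: (bounded_cintegrable (M := 1)) => // x _.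
  by rewrite indicE ger0_norm// lern1 leq_b1.
(* Truncations are integrable beforehand; their squares have integrals bounded uniformly through
   [min_layers], and Fatou's lemma removes the truncation. *)
have [] := @fatou_circ R (fun n x => Num.min `|f x| (2 ^+ n.+1) ^+ 2)
  (fun x => f x ^+ 2) (4 * (2 * pi) + 16 * N ^+ 2) iF _ _ _ _; last by [].
- by move=> n x _; exact: sqr_ge0.
- exact: measurable_funX.
- apply: aecW => x _; rewrite -(real_normK (num_real (f x))).
  apply: cvg_near_cst; near=> n.
  congr (_ ^+ 2); apply: min_l.
  have : `|f x| <= n%:R by near: n; exact: nbhs_infty_ger.
  move=> /le_trans; apply; rewrite -natrX ler_nat ltnW//.
  by rewrite (leq_ltn_trans (leqnSn n))// ltn_expl.
- move=> n.
  apply: (@le_trans _ _ (cint (fun x => 4 + 16 * \sum_(i < n) 4 ^+ i * \1_[set x | 2 ^+ i.+1 < `|f x|] x))).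
    have iS : cintegrable (fun x => \sum_(i < n) 4 ^+ i * \1_[set x | 2 ^+ i.+1 < `|f x|] x).
      by apply: cintegrable_sum => i; exact: cintegrableZ.
    apply: le_cint => //.
      by apply: cintegrableD; [exact: cintegrable_cst|exact: cintegrableZ].
    move=> x _; apply: le_trans (min_layers _ _) _ => //.
    rewrite lerD2l ler_wpM2l// ler_sum// => i _.
    by rewrite indicE ler_wpM2l// mem_setE.
  have iS : cintegrable (fun x => \sum_(i < n) 4 ^+ i * \1_[set x | 2 ^+ i.+1 < `|f x|] x).
    by apply: cintegrable_sum => i; exact: cintegrableZ.
  rewrite cintD; [|exact: cintegrable_cst|exact: cintegrableZ].
  rewrite cint_cst cintZ// lerD2l ler_wpM2l// cint_sum; last by move=> i; exact: cintegrableZ.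
  rewrite (le_trans _ (hN n))// ler_sum// => i _.
  by rewrite cintZ// cint_indic_distrib.
Unshelve. all: by end_near. Qed.

End lorentz.

(** * Sobolev norms in Hartley coefficients *)

Section sobolev_norms.
Context {R : realType}.
Implicit Types (T : distr R) (k : int) (f : R -> R).

Lemma sqmodC_ge0 (z : R[i]) : 0 <= sqmodC z.
Proof. by rewrite addr_ge0// sqr_ge0. Qed.

Lemma Hterm_ge0 (s : R) T k : 0 <= (1 + (k%:~R : R) ^+ 2) `^ s * sqmodC (fourier T k).
Proof. by rewrite mulr_ge0// ?powR_ge0// sqmodC_ge0. Qed.

Lemma Hnorm2_ge0 (s : R) T : (0 <= Hnorm2 s T)%E.
Proof. by apply: esum_ge0 => k _; rewrite lee_fin Hterm_ge0. Qed.

Lemma Hnorm2_le (s M : R) T :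
  (forall n, \sum_(k <- irange n) (1 + (k%:~R : R) ^+ 2) `^ s * sqmodC (fourier T k) <= M) ->
  (Hnorm2 s T <= M%:E)%E.
Proof.
move=> hM; apply: ge_ereal_sup => /= _ [A [fA _] <-].
rewrite fsbig_finite//= sumEFin lee_fin.
have [n sn] := subset_irange (finmap.enum_fset (fset_set A)).
apply: le_trans (hM n); apply: (@ler_sum_subset R int) => //.
- exact: finmap.fset_uniq.
- exact: irange_uniq.
- by move=> k; exact: Hterm_ge0.
Qed.

Lemma Hnorm2_ge (s M : R) T n : (Hnorm2 s T <= M%:E)%E ->
  \sum_(k <- irange n) (1 + (k%:~R : R) ^+ 2) `^ s * sqmodC (fourier T k) <= M.
Proof.
move=> hM; rewrite -lee_fin; apply: le_trans hM; rewrite -sumEFin.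
apply: esum_ge; exists [set` irange n].
  by split=> //; exact: finite_seq.
by rewrite -fsbig_seq//; exact: irange_uniq.
Qed.

(** Even weights over a symmetric range do not see the average over k and -k in [sqmodC_dist_of], so
    Sobolev sums may be computed from [hc]. *)
Lemma sum_sym_sqr n (w h : int -> R) : (forall k, w (- k) = w k) ->
  \sum_(k <- irange n) w k * ((h k ^+ 2 + h (- k) ^+ 2) / 2) =
  \sum_(k <- irange n) w k * h k ^+ 2.
Proof.
move=> we; under eq_bigr do rewrite mulrDl mulrDr.
rewrite big_split/= -(big_irangeN n (fun k => w k * (h (- k) ^+ 2 / 2))).
rewrite -big_split/=; apply: eq_bigr => k _.
by rewrite we opprK; field.
Qed.

Lemma sqmodC_dist_of f k : sqint f ->
  sqmodC (fourier (dist_of f) k) = (hc k f ^+ 2 + hc (- k) f ^+ 2) / 2.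
Proof. by move=> sf; rewrite fourier_dist_of// /sqmodC/=; field. Qed.

Lemma weightN (s : R) k : (1 + ((- k)%:~R : R) ^+ 2) `^ s = (1 + (k%:~R : R) ^+ 2) `^ s.
Proof. by rewrite mulrNz sqrrN. Qed.

Lemma sum_sqmodC_dist_of (s : R) f n : sqint f ->
  \sum_(k <- irange n) (1 + (k%:~R : R) ^+ 2) `^ s * sqmodC (fourier (dist_of f) k) =
  \sum_(k <- irange n) (1 + (k%:~R : R) ^+ 2) `^ s * hc k f ^+ 2.
Proof.
move=> sf; under eq_bigr do rewrite sqmodC_dist_of//.
by rewrite (@sum_sym_sqr n (fun k => (1 + (k%:~R : R) ^+ 2) `^ s) (hc^~ f))// => k; exact: weightN.
Qed.

Lemma Hnorm2_cvg0P (s : R) (T : nat -> distr R) :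
  (Hnorm2 s (T n) @[n --> \oo] --> 0%E) <->
  (forall e, 0 < e -> exists n0, forall n, (n0 <= n)%N -> (Hnorm2 s (T n) <= e%:E)%E).
Proof.
split=> [/fine_cvgP[fin /cvgrPdist_le h] e e0|h].
  have [n1 _ h1] := fin; have [n2 _ h2] := h _ e0.
  exists (n1 + n2)%N => n nn.
  have f1 := h1 n (leq_trans (leq_addr _ _) nn).
  have := h2 n (leq_trans (leq_addl _ _) nn); rewrite /= sub0r normrN => h3.
  by rewrite -(fineK f1) lee_fin (le_trans (ler_norm _)).
apply/fine_cvgP; split.
  have [n0 h0] := h 1 ltr01; exists n0 => // n /h0 hn.
  by rewrite ge0_fin_numE ?Hnorm2_ge0// (le_lt_trans hn) ?ltry.
apply/cvgrPdist_le => e e0; have [n0 h0] := h e e0; exists n0 => // n /h0 hn /=.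
rewrite sub0r normrN ger0_norm ?fine_ge0 ?Hnorm2_ge0//.
by rewrite -lee_fin fineK// ge0_fin_numE ?Hnorm2_ge0// (le_lt_trans hn) ?ltry.
Qed.

End sobolev_norms.

(** * Evaluation of the fractional divergence *)

Section fractional_divergence.
Context {R : realType}.
Implicit Types (f g v a b : R -> R) (k l : int).
Variables (K : R -> R) (hK : is_K14 K).

Lemma fracdiv0E (m : nat) (a b : R -> 'rV[R]_m) v : Cinf v ->
  (forall j, sqint (compj a j)) -> (forall j, sqint (compj b j)) ->
  fracdiv0 K a b v = \sum_(j < m) Bk K v (compj a j) (compj b j).
Proof.
move=> cv sa sb; have [C lv] := Cinf_lips cv.
rewrite /fracdiv0 -[LHS]/(cint2 _).
rewrite -(cint2_sum (index_enum 'I_m) (fun j => Bk_integrable hK lv (sa j) (sb j))).2.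
apply: eq_cint2 => x y _ _ /=; rewrite /dotv -mulrA mulr_suml.
by apply: eq_bigr => j _.
Qed.

(** This is |p - q|^2 <= 2 |p - b|^2 + 2 |q - b|^2. Since a [distr] is an arbitrary functional,
    additivity is assumed just for the cosine and the sine that enter. *)
Lemma sqmodC_sub (T T' : distr R) (B : distr R) f k : sqint f ->
  ip f (fun x => cos (k%:~R * x)) = T (fun x => cos (k%:~R * x)) - T' (fun x => cos (k%:~R * x)) ->
  ip f (fun x => sin (k%:~R * x)) = T (fun x => sin (k%:~R * x)) - T' (fun x => sin (k%:~R * x)) ->
  sqmodC (fourier (dist_of f) k) <= 2 * sqmodC (fourier (distr_sub T B) k) + 2 * sqmodC (fourier (distr_sub T' B) k).
Proof.
move=> sf h1 h2; rewrite /sqmodC /fourier /= !dist_ofE h1 h2 /distr_sub.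
set i2 := (2 * pi)^-1; move: (T _) (T' _) (B _) (T _) (T' _) (B _) => x x' y z z' w.
rewrite -subr_ge0 [leRHS](_ : _ = (((x - y) + (x' - y)) * i2) ^+ 2 + (((z - w) + (z' - w)) * i2) ^+ 2).
  by rewrite addr_ge0// sqr_ge0.
by ring.
Qed.

Lemma sqint_cosk k : sqint (fun x : R => cos (k%:~R * x)).
Proof. by apply: continuous_sqint; exact: continuous_cosk. Qed.

Lemma sqint_sink k : sqint (fun x : R => sin (k%:~R * x)).
Proof. by apply: continuous_sqint; exact: continuous_sink. Qed.

Lemma Hnorm2_sub (B : distr R) f g (M M' : R) : sqint f -> sqint g ->
  (Hnorm2 (- 2^-1) (distr_sub (dist_of f) B) <= M%:E)%E ->
  (Hnorm2 (- 2^-1) (distr_sub (dist_of g) B) <= M'%:E)%E ->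
  forall n, \sum_(k <- irange n) (qw k)^-1 * hc k (fun x => f x - g x) ^+ 2 <= 2 * M + 2 * M'.
Proof.
move=> sf sg hM hM' n; have sfg := sqintB sf sg.
under eq_bigr do rewrite -qwV.
rewrite -sum_sqmodC_dist_of//.
apply: le_trans (lerD (ler_wpM2l (ler0n _ 2) (Hnorm2_ge n hM)) (ler_wpM2l (ler0n _ 2) (Hnorm2_ge n hM'))).
rewrite !mulr_sumr -big_split/=; apply: ler_sum => k _.
rewrite !(mulrCA 2) -mulrDr ler_wpM2l ?powR_ge0//.
apply: sqmodC_sub => //; rewrite !dist_ofE ipBl//.
- exact: sqint_cosk.
- exact: sqint_sink.
Qed.

Lemma Bk_cvg0 (B : distr R) v a (f g : nat -> R -> R) : Cinf v -> sqint a ->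
  (forall n, sqint (f n)) -> (forall n, sqint (g n)) ->
  Hnorm2 (- 2^-1) (distr_sub (dist_of (f n)) B) @[n --> \oo] --> 0%E ->
  Hnorm2 (- 2^-1) (distr_sub (dist_of (g n)) B) @[n --> \oo] --> 0%E ->
  Bk K v a (f n) - Bk K v a (g n) @[n --> \oo] --> 0.
Proof.
move=> cv sa sf sg /Hnorm2_cvg0P hf /Hnorm2_cvg0P hg.
have [D D0 hD] := Bk_Hm12 hK cv.
apply/cvgrPdist_le => e e0.
(* Two distances at most d give 2 d + 2 d in [Hnorm2_sub], hence the 4; the added 1 keeps the
   denominator positive. *)
have s1 : 0 < 4 * (D * sqn a) + 1 by rewrite ltr_wpDl// !mulr_ge0// sqn_ge0.
have d0 : 0 < e ^+ 2 / (4 * (D * sqn a) + 1) by rewrite divr_gt0// exprn_gt0.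
have [n1 h1] := hf _ d0; have [n2 h2] := hg _ d0.
exists (n1 + n2)%N => // n /= nn; rewrite sub0r normrN -BkB//.
apply: (normr_le_of_sqr (ltW e0)).
have m1 := h1 n (leq_trans (leq_addr _ _) nn); have m2 := h2 n (leq_trans (leq_addl _ _) nn).
apply: le_trans (hD _ _ _ sa (sqintB (sf n) (sg n)) (Hnorm2_sub (sf n) (sg n) m1 m2)) _.
set d := e ^+ 2 / _; rewrite [leLHS](_ : _ = 4 * (D * sqn a) * d); last by ring.
rewrite /d [leLHS]mulrA ler_pdivrMr// mulrC ler_wpM2l ?sqr_ge0//.
by rewrite lerDl.
Qed.

(* All admissible sequences give the same limit by [Bk_cvg0], so one of them suffices to compute [fracdiv]. *)
Lemma fracdiv_eq (m : nat) (a : R -> 'rV[R]_m) (b : 'I_m -> distr R)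
    (b_ : nat -> R -> 'rV[R]_m) v (l : R) : Cinf v -> (forall j, sqint (compj a j)) ->
  (forall n j, L21 (compj (b_ n) j)) ->
  (forall j, Hnorm2 (- 2^-1) (distr_sub (dist_of (compj (b_ n) j)) (b j)) @[n --> \oo] --> 0%E) ->
  fracdiv0 K a (b_ n) v @[n --> \oo] --> l -> fracdiv K a b v = l.
Proof.
move=> cv sa Lb hb hl; rewrite /fracdiv; set S := (X in xget _ X).
suff Sl : S l.
  have /= := @xgetPex _ 0 S (ex_intro _ l Sl) b_ Lb hb.
  by move=> h; exact: (cvg_unique _ h hl).
move=> c Lc hc.
have sb n j : sqint (compj (b_ n) j) := L21_sqint (Lb n j).
have sc n j : sqint (compj (c n) j) := L21_sqint (Lc n j).
have -> : (fun n => fracdiv0 K a (c n) v) = (fun n => fracdiv0 K a (b_ n) v +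
    \sum_(j < m) (Bk K v (compj a j) (compj (c n) j) - Bk K v (compj a j) (compj (b_ n) j))).
  by apply/funext => n; rewrite !fracdiv0E// sumrB addrCA subrr addr0.
have z : \sum_(j < m) (0 : R) = 0 by rewrite big1.
rewrite -[l]addr0; apply: cvgD => //; rewrite -[X in _ --> X]z; apply: cvg_bigsum => j.
exact: (@Bk_cvg0 (b j)).
Qed.

Lemma H12_bound (m : nat) (u : R -> 'rV[R]_m) j : H12 u ->
  sqint (compj u j) /\ exists M : R, forall n, \sum_(k <- irange n) qw k * hc k (compj u j) ^+ 2 <= M.
Proof.
move=> /(_ j)[L2u fin]; have su := L2_sqint L2u; split=> //.
exists (fine (Hnorm2 2^-1 (dist_of (compj u j)))) => n.
rewrite /qw -sum_sqmodC_dist_of//; apply: Hnorm2_ge.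
by rewrite fineK// ge0_fin_numE ?Hnorm2_ge0.
Qed.

Lemma trig_H12 (m : nat) (w : R -> 'rV[R]_m) :
  (forall j, exists s c, uniq s /\ compj w j = trig s c) -> H12 w.
Proof.
move=> hw j; have [s [c [us ->]]] := hw j; split.
  by apply: sqint_L2; [exact: trig_periodic|exact: sqint_trig].
apply: (@le_lt_trans _ _ (\sum_(k <- s) qw k * c k ^+ 2)%:E); last exact: ltry.
apply: Hnorm2_le => n; rewrite sum_sqmodC_dist_of; last exact: sqint_trig.
under eq_bigr => k _.
  rewrite hc_trig// -/(qw k) (_ : qw k * (if k \in s then c k else 0) ^+ 2 = if k \in s then qw k * c k ^+ 2 else 0); last first.
    by case: ifP => // _; rewrite expr0n mulr0.
  over.
rewrite -big_mkcond/= -big_filter; apply: (@ler_sum_subset R int) => //.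
- by rewrite filter_uniq// irange_uniq.
- by move=> k; rewrite mem_filter => /andP[].
- by move=> k; rewrite mulr_ge0 ?sqr_ge0// ltW// qw_gt0.
Qed.

Lemma ip_derive_cos X v k : Cinf X -> sqint v ->
  let e l := ip v (derive1 (fun x => X x * cas l x)) in
  ip v (derive1 (fun x => X x * cos (k%:~R * x))) = (e k + e (- k)) / 2 /\
  ip v (derive1 (fun x => X x * sin (k%:~R * x))) = (e k - e (- k)) / 2.
Proof.
move=> cX sv e; have cXc l : Cinf (fun x => X x * cas l x) by apply: CinfM => //; exact: Cinf_cas.
have d l x := Cinf_derive x (cXc l).
have sd l : sqint (derive1 (fun x => X x * cas l x)).
  by apply: continuous_sqint; exact: Cinf_continuous (Cinf_derive1 _).
have E1 : derive1 (fun x => X x * cos (k%:~R * x)) =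
    fun x => 2^-1 * (derive1 (fun x => X x * cas k x) x + derive1 (fun x => X x * cas (- k) x) x).
  apply/funext => x.
  have -> : (fun x => X x * cos (k%:~R * x)) = (fun x => 2^-1 * (X x * cas k x + X x * cas (- k) x)).
    by apply/funext => y; rewrite cosE_cas; field.
  have dd := is_deriveZ (2^-1 : R) (is_deriveD (d k x) (d (- k) x)).
  by rewrite derive1E (@derive_val _ _ _ _ _ _ _ dd).
have E2 : derive1 (fun x => X x * sin (k%:~R * x)) =
    fun x => 2^-1 * (derive1 (fun x => X x * cas k x) x - derive1 (fun x => X x * cas (- k) x) x).
  apply/funext => x.
  have -> : (fun x => X x * sin (k%:~R * x)) = (fun x => 2^-1 * (X x * cas k x - X x * cas (- k) x)).
    by apply/funext => y; rewrite sinE_cas; field.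
  have dd := is_deriveZ (2^-1 : R) (is_deriveB (d k x) (d (- k) x)).
  by rewrite derive1E (@derive_val _ _ _ _ _ _ _ dd).
split; rewrite ?E1 ?E2 ipZr//; [|exact: sqintD| |exact: sqintB].
  by rewrite ipDr// mulrC.
by rewrite ipBr// mulrC.
Qed.

(** Integration by parts writes the error tested with psi as the pairing of the tail u - w_n with (X
    psi)', and [mulX_Hm12] bounds it by the H^(1/2) norm of the tail. It serves u' X, and u' itself
    with X = 1. *)
Lemma Hnorm2_approx X u (M : R) (B : distr R) : Cinf X -> sqint u ->
  (forall n, \sum_(k <- irange n) qw k * hc k u ^+ 2 <= M) ->
  (forall psi, Cinf psi -> B psi = - ip u (derive1 (fun x => X x * psi x))) ->
  Hnorm2 (- 2^-1) (distr_sub (dist_of (fun x => X x * derive1 (trig (irange n) (hc^~ u)) x)) B)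
    @[n --> \oo] --> 0%E.
Proof.
move=> cX su hM hB; have [D D0 hD] := mulX_Hm12 cX.
pose P n := \sum_(k <- irange n) qw k * hc k u ^+ 2.
have /cvg_ex[l hl] : cvgn P := sum_qw_cvg hM.
pose w n := trig (irange n) (hc^~ u); pose v n x := u x - w n x.
have sw n : sqint (w n) := sqint_trig _ _.
have sv n : sqint (v n) := sqintB su (sw n).
(* The tail has exactly the coefficients of u beyond n, so its norm is at most what P n lacks to its
   limit l. *)
have vP n N : \sum_(k <- irange N) qw k * hc k (v n) ^+ 2 <= l - P n.
  have E k : qw k * hc k (v n) ^+ 2 = if k \notin irange n then qw k * hc k u ^+ 2 else 0.
    rewrite hcB// hc_trig ?irange_uniq//; case: ifP => kn /=; last by rewrite subr0.
    by rewrite subrr expr0n mulr0.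
  under eq_bigr do rewrite E.
  rewrite -big_mkcond/=.
  have h : P n + \sum_(k <- irange N | k \notin irange n) qw k * hc k u ^+ 2 <= P (N + n)%N.
    rewrite [leRHS]/P [leRHS](bigID (fun k => k \in irange n))/=; apply: lerD.
      rewrite -big_filter; apply: (@ler_sum_subset R int).
      - exact: irange_uniq.
      - by rewrite filter_uniq// irange_uniq.
      - by move=> k kn; rewrite mem_filter kn /= mem_irange (leq_trans _ (leq_addl _ _))// -mem_irange.
      - by move=> k; rewrite mulr_ge0 ?sqr_ge0// ltW// qw_gt0.
    rewrite -!(big_filter _ (fun k => k \notin _)); apply: (@ler_sum_subset R int).
    - by rewrite filter_uniq// irange_uniq.
    - by rewrite filter_uniq// irange_uniq.
    - move=> k; rewrite !mem_filter => /andP[-> kN] /=.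
      by rewrite mem_irange (leq_trans _ (leq_addr _ _))// -mem_irange.
    - by move=> k; rewrite mulr_ge0 ?sqr_ge0// ltW// qw_gt0.
  rewrite lerBrDl (le_trans h)//.
  rewrite -(cvg_lim (@Rhausdorff R) hl); apply: nondecreasing_cvgn_le; first by move=> a b; exact: sum_qw_le.
  by apply/cvg_ex; exists l.
have key n : (Hnorm2 (- 2^-1)
    (distr_sub (dist_of (fun x => (X x * derive1 (w n) x)%R)) B) <= (D * (l - P n))%:E)%E.
  apply: Hnorm2_le => N.
  pose e k := ip (v n) (derive1 (fun x => X x * cas k x)).
  have T psi : Cinf psi -> distr_sub (dist_of (fun x => X x * derive1 (w n) x)) B psi =
      ip (v n) (derive1 (fun x => X x * psi x)).
    move=> cp; rewrite /distr_sub dist_ofE hB// opprK.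
    have cXp : Cinf (fun x => X x * psi x) := CinfM cX cp.
    have cw : Cinf (w n) := Cinf_trig _ _.
    have sXp : sqint (derive1 (fun x => X x * psi x)).
      by apply: continuous_sqint; exact: Cinf_continuous (Cinf_derive1 _).
    rewrite ipBl// addrC; congr (_ + _).
    have cwp : Cinf (fun x => w n x * (X x * psi x)) := CinfM cw cXp.
    have d x : is_derive x (1 : R) (fun x => w n x * (X x * psi x))
        (w n x * derive1 (fun x => X x * psi x) x + X x * derive1 (w n) x * psi x).
      have d1 := Cinf_derive x cw; have d2 := Cinf_derive x cXp.
      apply: (is_derive_eq (is_deriveM d1 d2)).
      by rewrite /GRing.scale/=; ring.
    have c1 : continuous (fun x => w n x * derive1 (fun x => X x * psi x) x).
      move=> x; apply: cvgM; first exact: Cinf_continuous.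
      exact: Cinf_continuous (Cinf_derive1 cXp) x.
    have c2 : continuous (fun x => X x * derive1 (w n) x * psi x).
      move=> x; apply: cvgM; last exact: Cinf_continuous.
      by apply: cvgM; [exact: Cinf_continuous|exact: Cinf_continuous (Cinf_derive1 cw) x].
    have := @cint_is_derive R _ _ d; move=> /(_ _)/wrap[|].
      by move=> x; apply: cvgD; [exact: c1|exact: c2].
    rewrite cintD; [|exact: continuous_cintegrable|exact: continuous_cintegrable].
    have := Cinf_periodic cwp 0; rewrite add0r => ->; rewrite subrr => /eqP.
    by rewrite addrC addr_eq0 => /eqP.
  have E k : sqmodC (fourier (distr_sub (dist_of (fun x => X x * derive1 (w n) x)) B) k) =
      (2 * pi) ^- 2 * ((e k ^+ 2 + e (- k) ^+ 2) / 2).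
    rewrite /sqmodC /fourier /= !T.
    - have [-> ->] := ip_derive_cos k cX (sv n); rewrite -/(e k) -/(e (- k)).
      have pn : (2 * pi : R) != 0 by rewrite gt_eqF// pi2_gt0.
      by move: (2 * pi : R) (e k) (e (- k)) pn => p x y pn; field.
    - have -> : (fun x : R => sin (k%:~R * x)) = (fun x => 2^-1 * (cas k x + (-1) * cas (- k) x)).
        by apply/funext => x; rewrite sinE_cas; field.
      exact: (CinfZ _ (CinfD (Cinf_cas k) (CinfZ (-1) (Cinf_cas (- k))))).
    - have -> : (fun x : R => cos (k%:~R * x)) = (fun x => 2^-1 * (cas k x + cas (- k) x)).
        by apply/funext => x; rewrite cosE_cas; field.
      exact: (CinfZ _ (CinfD (Cinf_cas k) (Cinf_cas (- k)))).
  under eq_bigr do rewrite E mulrCA.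
  rewrite -mulr_sumr (sum_sym_sqr N e (@weightN R (- 2^-1))).
  under eq_bigr do rewrite qwV.
  have := hD (v n) (l - P n) (sv n) (vP n) N; rewrite -/e => h.
  (* The normalisation (2 pi)^-2 of the Fourier coefficients is at most 1 and is discarded. *)
  apply: le_trans h; rewrite -[leRHS]mul1r ler_wpM2r//.
    by apply: sumr_ge0 => k _; rewrite mulr_ge0 ?sqr_ge0// invr_ge0 ltW// qw_gt0.
  rewrite invf_le1 ?exprn_gt0 ?pi2_gt0// -[leLHS](expr1n _ 2) ler_sqr_mono//.
  by have := pi_ge2 R; lra.
apply/Hnorm2_cvg0P => e e0.
have d0 : 0 < e / (D + 1) by rewrite divr_gt0// ltr_wpDl.
move/cvgrPdist_le : hl => /(_ _ d0)[n0 _ h0]; exists n0 => n /h0 hn.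
apply: le_trans (key n) _; rewrite lee_fin.
have {}hn := le_trans (ler_norm _) hn.
apply: le_trans (ler_wpM2l D0 hn) _.
by rewrite mulrA ler_pdivrMr ?ltr_wpDl// mulrC ler_wpM2l ?ltW// ltrDl.
Qed.

End fractional_divergence.

(** * Null sets and flows *)

Section null_sets.
Context {R : realType}.
Implicit Types (g : R -> R) (P : R -> Prop).
Notation mu := (@lebesgue_measure R).

(** Two points of the preimage are at distance at most (b - a) / c, so it lies within that distance
    of any one of its points; the two sides give the factor 2. *)
Let preimage_itv g (c a b : R) : 0 < c -> continuous g ->
  (forall x y, c * `|x - y| <= `|g x - g y|) -> a <= b ->
  (mu (g @^-1` `]a, b[) <= (2 / c * (b - a))%:E)%E.
Proof.
move=> c0 cg gc ab; have [->|/set0P[x0 gx0]] := eqVneq (g @^-1` `]a, b[) set0.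
  by rewrite measure0 lee_fin mulr_ge0 ?divr_ge0 ?subr_ge0// ltW.
pose d := (b - a) / c.
have d0 : 0 <= d by rewrite divr_ge0 ?subr_ge0// ltW.
apply: (@le_trans _ _ (mu `[x0 - d, x0 + d]%classic)).
  apply: le_measure; rewrite ?inE; [|exact: measurable_itv|].
    have /(_ measurableT _ (measurable_itv `]a, b[)) := continuous_measurable_fun cg.
    by rewrite setTI.
  move=> x /= gx; rewrite in_itv/= -ler_distlC.
  move: gx gx0; rewrite /= !in_itv/= => /andP[g1 g2] /andP[g3 g4].
  have := gc x0 x; rewrite -ler_pdivlMl// mulrC => /le_trans; apply.
  by rewrite /d ler_pM2r ?invr_gt0// ler_norml; apply/andP; split; lra.
rewrite lebesgue_measure_itv/= lte_fin; case: ifP => h.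
  by rewrite -EFinB lee_fin /d le_eqVlt; apply/orP; left; apply/eqP; ring.
by rewrite lee_fin mulr_ge0 ?divr_ge0 ?subr_ge0// ltW.
Qed.

(** A null set is covered by open intervals of small total length, and preimages of intervals
    lengthen by at most the factor 2 / c. *)
Lemma null_preimage g (c : R) (B : set R) : 0 < c -> continuous g ->
  (forall x y, c * `|x - y| <= `|g x - g y|) -> measurable B -> mu B = 0 ->
  measurable (g @^-1` B) /\ mu (g @^-1` B) = 0.
Proof.
move=> c0 cg gc mB B0.
have mp (A : set R) : measurable A -> measurable (g @^-1` A).
  move=> mA; have /(_ measurableT _ mA) := continuous_measurable_fun cg.
  by rewrite setTI.
split; first exact: mp.
apply/eqP; rewrite eq_le measure_ge0 andbT.
apply/lee_addgt0Pr => e e0; rewrite add0e.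
have d0 : 0 < e * (c / 2) by rewrite mulr_gt0 ?divr_gt0.
have [F [Fi BF] Fe] : exists2 F, open_itv_cover B F &
    (\sum_(0 <= k <oo) (@wlength R idfun) (F k) <= (e * (c / 2))%:E)%E.
  have : (@wlength R idfun)^*%mu B \is a fin_num by rewrite [X in X \is a fin_num]B0.
  rewrite outer_measure_open_itv_cover.
  move=> /lb_ereal_inf_adherent-/(_ _ d0)[_/= [F]] AF <- Fe.
  exists F => //; rewrite (le_trans (ltW Fe))//.
  by rewrite -outer_measure_open_itv_cover [X in (X + _ <= _)%E]B0 add0e.
have mF k : measurable (F k).
  by have [[a b] ->] := Fi k; exact: (measurable_itv `]a, b[).
apply: (@le_trans _ _ (mu (\bigcup_k (g @^-1` F k)))).
  apply: le_measure; rewrite ?inE; [exact: mp|apply: bigcupT_measurable => k; exact: mp|].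
  by move=> x /BF [k _ Fk]; exists k.
apply: (le_trans (outer_measure_sigma_subadditive mu _)).
apply: (@le_trans _ _ (\sum_(0 <= k <oo) (2 / c)%:E * (@wlength R idfun) (F k))%E).
  apply: lee_nneseries => [k _ _|k _]; first exact: measure_ge0.
  have [[a b] -> /=] := Fi k.
  have [ba|ab] := ltP b a.
    rewrite (_ : `]a, b[%classic = set0) ?preimage_set0 ?measure0.
      by rewrite mule0 outer_measure0.
    by apply/eqP; rewrite set_itv_ge// bnd_simp -leNgt ltW.
  rewrite wlength_itv_bnd//= -EFinM; exact: preimage_itv.
rewrite nneseriesZl; last by move=> k _; exact: wlength_ge0.
apply: (@le_trans _ _ ((2 / c)%:E * (e * (c / 2))%:E)%E).
  by apply: lee_wpmul2l => //; rewrite lee_fin divr_ge0// ltW.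
by rewrite -EFinM lee_fin le_eqVlt; apply/orP; left; apply/eqP; field; rewrite gt_eqF.
Qed.

Lemma ae_comp g (c : R) P : 0 < c -> continuous g ->
  (forall x y, c * `|x - y| <= `|g x - g y|) ->
  {ae mu, forall x, P x} -> {ae mu, forall x, P (g x)}.
Proof.
move=> c0 cg gc [A [mA A0 PA]]; have [m0 n0] := null_preimage c0 cg gc mA A0.
by exists (g @^-1` A); split=> // x Px; apply: PA.
Qed.

(** The lifted flow may leave [0, 2 pi], so a property known on the circle is spread over the line,
    by countably many translations, before composing with phi_t. *)
Lemma ae_periodic P : (forall x, P (x + 2 * pi) <-> P x) -> aec P -> {ae mu, forall x, P x}.
Proof.
move=> pP aP.
have pPk (k : int) x : P (x + k%:~R * (2 * pi)) <-> P x.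
  have pn (n : nat) y : P (y + n%:R * (2 * pi)) <-> P y.
    elim: n y => [|n ih] y; first by rewrite mul0r addr0.
    by rewrite -natr1 mulrDl mul1r addrA pP; exact: ih.
  case: k => n; first exact: pn.
  by rewrite NegzE mulrNz mulNr -(pn n.+1 (x - _)) subrK.
have h (k : int) : {ae mu, forall x, circ R (x - k%:~R * (2 * pi)) -> P (x - k%:~R * (2 * pi))}.
  apply: (@ae_comp (fun x => x - k%:~R * (2 * pi)) 1 (fun x => circ R x -> P x)) => //.
    by move=> x; apply: cvgB; [exact: cvg_id|exact: cvg_cst].
  by move=> x y; rewrite mul1r opprB addrA subrK.
have h1 := @ae_foralln _ _ _ mu (fun (n : nat) x => circ R (x - n%:~R * (2 * pi)) -> P (x - n%:~R * (2 * pi))) (fun n => h n%:Z).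
have h2 := @ae_foralln _ _ _ mu (fun (n : nat) x => circ R (x - (- n%:Z)%:~R * (2 * pi)) -> P (x - (- n%:Z)%:~R * (2 * pi))) (fun n => h (- n%:Z)).
apply: filterS2 h1 h2 => x h1x h2x.
have hx (k : int) : circ R (x - k%:~R * (2 * pi)) -> P (x - k%:~R * (2 * pi)).
  by case: k => n; [exact: h1x|rewrite NegzE; exact: (h2x n.+1)].
pose k := Num.floor (x / (2 * pi)).
apply/(pPk (- k)); rewrite mulrNz mulNr; apply: hx; rewrite circE.
have p0 := pi2_gt0 (R := R).
have := floor_le (x / (2 * pi)); have := floorD1_gt (x / (2 * pi)); rewrite -/k.
rewrite intrD ltr_pdivrMr// ler_pdivlMr// => h1 h2.
by move: h1; rewrite mulrDl mul1r => h1; apply/andP; split; lra.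
Qed.

End null_sets.

(** * Gronwall inequalities *)

Section gronwall.
Context {R : realType}.
Implicit Types (f E e : R -> R).

Lemma nonincreasing_from0 f f' (t : R) : (forall x, is_derive x (1 : R) f (f' x)) ->
  (forall x, 0 <= x <= t -> f' x <= 0) -> 0 <= t -> f t <= f 0.
Proof.
move=> df f0 t0; have [c + e] := @MVT_segment R f f' 0 t t0 (fun x _ => df x)
  (continuous_subspaceT (is_derive_continuous df)).
rewrite in_itv/= => ct; rewrite -subr_le0 e subr0.
by rewrite mulr_le0_ge0// f0.
Qed.

Lemma gronwall E E' (c t : R) : (forall x, is_derive x (1 : R) E (E' x)) ->
  (forall x, 0 <= x <= t -> E' x <= c * E x) -> 0 <= t -> E t <= E 0 * expR (c * t).
Proof.
move=> dE hE t0.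
have dl (x : R) : is_derive x (1 : R) (fun x => (- c) * x) (- c).
  apply: (is_derive_eq (is_deriveZ (- c) (is_derive_id x (1 : R)))).
  by rewrite /GRing.scale/= mulr1.
have d x : is_derive x (1 : R) (fun x => E x * expR ((- c) * x))
    ((E' x - c * E x) * expR (- c * x)).
  have de := is_derive1_comp (is_derive_expR (- c * x)) (dl x).
  apply: (is_derive_eq (is_deriveM (dE x) de)).
  by rewrite /GRing.scale/=; ring.
have := nonincreasing_from0 d _ t0; move=> /(_ _)/wrap[|].
  by move=> x x0; rewrite mulr_le0_ge0 ?expR_ge0// subr_le0 hE.
rewrite mulr0 expR0 mulr1 mulNr expRN ler_pdivrMr ?expR_gt0//.
Qed.

(** |e| need not be differentiable at its zeros, so Gronwall's inequality is applied to e^2 for the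
    upper bound and to -e^2 for the lower one, at rate 2 A. *)
Lemma gronwall_abs e e' (A t : R) : (forall s, is_derive s (1 : R) e (e' s)) ->
  (forall s, `|e' s| <= A * `|e s|) -> 0 <= t ->
  `|e t| <= expR (A * t) * `|e 0| /\ expR (- (A * t)) * `|e 0| <= `|e t|.
Proof.
move=> de hA t0.
have d s : is_derive s (1 : R) (fun s => e s * e s) (2 * (e s * e' s)).
  apply: (is_derive_eq (is_deriveM (de s) (de s))).
  by rewrite /GRing.scale/=; ring.
have dN s : is_derive s (1 : R) (fun s => - (e s * e s)) (- (2 * (e s * e' s))).
  exact: is_deriveN.
have b s : `|e s * e' s| <= A * (e s * e s).
  rewrite normrM -[X in _ <= _ * X]ger0_norm -?expr2 ?sqr_ge0// normrX.
  by rewrite (le_trans (ler_wpM2l (normr_ge0 _) (hA s)))// mulrCA expr2.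
split.
  rewrite -(@ler_pXn2r _ 2) ?nnegrE ?mulr_ge0 ?expR_ge0//.
  rewrite exprMn !real_normK ?num_real// -expRM_natl [leRHS]mulrC.
  have := gronwall d (c := 2 * A) _ t0; move=> /(_ _)/wrap[|].
    by move=> s _; rewrite -mulrA ler_wpM2l// (le_trans (ler_norm _)).
  by rewrite -!expr2 -mulrA.
rewrite -(@ler_pXn2r _ 2) ?nnegrE ?mulr_ge0 ?expR_ge0//.
rewrite exprMn !real_normK ?num_real// -expRM_natl [leLHS]mulrC.
have := gronwall dN (c := - (2 * A)) _ t0; move=> /(_ _)/wrap[|].
  move=> s _; rewrite mulrNN -mulrN -mulrA ler_wpM2l//.
  by rewrite (le_trans _ (b s))// -normrN ler_norm.
by rewrite mulNr lerN2 -!expr2 mulrN mulrA mulNr.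
Qed.

Lemma gronwall_eq0 e e' (A : R) : (forall s, is_derive s (1 : R) e (e' s)) ->
  (forall s, `|e' s| <= A * `|e s|) -> e 0 = 0 -> forall t, e t = 0.
Proof.
move=> de hA e0 t; wlog t0 : e e' de hA e0 t / 0 <= t.
  move=> h; have [t0|/ltW t0] := leP 0 t; first exact: h de hA e0 t t0.
  have d s : is_derive s (1 : R) (fun s => e (- s)) (- e' (- s)).
    have dn := is_deriveN (is_derive_id s (1 : R)).
    apply: (is_derive_eq (is_derive1_comp (de (- s)) dn)).
    by rewrite mulrN1.
  have := h _ _ d _ _ (- t); rewrite opprK; apply.
  - by move=> s; rewrite normrN.
  - by rewrite oppr0.
  - by rewrite oppr_ge0.
have [h _] := gronwall_abs de hA t0.
by apply/eqP; rewrite -normr_le0 (le_trans h)// e0 normr0 mulr0.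
Qed.

Lemma is_derive_quadratic f (x d Q : R) :
  (forall h, `|f (x + h) - f x - d * h| <= Q * h ^+ 2) -> is_derive x (1 : R) f d.
Proof.
move=> hQ; have c : (fun h => h^-1 *: ((f \o shift x) (h *: 1) - f x)) @ 0^' --> d.
  apply/cvgrPdist_le => e e0.
  have q0 : 0 < `|Q| + 1 by rewrite ltr_wpDl.
  near=> h; have h0 : h != 0 by near: h; exact: nbhs_dnbhs_neq.
  rewrite /= distrC /GRing.scale/= mulr1 (addrC h).
  have -> : h^-1 * (f (x + h) - f x) - d = h^-1 * (f (x + h) - f x - d * h) by field.
  rewrite normrM normfV ler_pdivrMl ?normr_gt0//.
  rewrite (le_trans (hQ h))// -(real_normK (num_real h)) expr2 mulrCA ler_wpM2l//.
  have he : `|h| <= e / (`|Q| + 1).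
    near: h; apply: dnbhs0_le; exact: divr_gt0.
  rewrite (le_trans (ler_wpM2r (normr_ge0 _) (ler_norm _)))//.
  rewrite (le_trans (ler_wpM2l (normr_ge0 _) he))// mulrA ler_pdivrMr// mulrC ler_pM2l//.
  by rewrite lerDl.
apply: DeriveDef; first by apply/cvg_ex; exists d.
exact: cvg_lim c.
Unshelve. all: by end_near. Qed.

End gronwall.

(** * Regularity of the flow *)

Section flow.
Context {R : realType}.
Variables (X : R -> R) (phi : R -> R -> R).
Hypotheses (cX : Cinf X) (hphi : is_flow X phi).

Lemma flow0 x : phi 0 x = x. Proof. by case: hphi. Qed.

Lemma is_derive_flow t x : is_derive t (1 : R) (phi^~ x) (X (phi t x)).
Proof. by case: hphi. Qed.

(** The upper bound yields continuity of phi_t and Lipschitz bounds for w o phi_t, the lower one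
    yields preservation of null sets in [ae_flow]. *)
Lemma flow_lipschitz : exists2 A : R, 0 <= A & forall t x y, 0 <= t ->
  `|phi t x - phi t y| <= expR (A * t) * `|x - y| /\
  expR (- (A * t)) * `|x - y| <= `|phi t x - phi t y|.
Proof.
have [A A0 hA] := Cinf_lipschitz cX; exists A => // t x y t0.
have d s : is_derive s (1 : R) (fun s => phi s x - phi s y) (X (phi s x) - X (phi s y)).
  exact: (is_deriveB (is_derive_flow s x) (is_derive_flow s y)).
by have := gronwall_abs d (fun s => hA _ _) t0; rewrite !flow0.
Qed.

Lemma flow_shift t x : phi t (x + 2 * pi) = phi t x + 2 * pi.
Proof.
have [A A0 hA] := Cinf_lipschitz cX.
have d s : is_derive s (1 : R) (fun s => phi s (x + 2 * pi) - phi s x - 2 * pi)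
    (X (phi s (x + 2 * pi)) - X (phi s x) - 0).
  have d1 := is_deriveB (is_derive_flow s (x + 2 * pi)) (is_derive_flow s x).
  exact: (is_deriveB d1 (is_derive_cst (2 * pi) s 1)).
apply/eqP; rewrite -subr_eq0 opprD addrA; apply/eqP.
apply: (gronwall_eq0 d (A := A)); last by rewrite !flow0; ring.
move=> s; rewrite subr0 -[X (phi s x)](Cinf_periodic cX).
by rewrite (le_trans (hA _ _))// opprD addrA.
Qed.

Lemma flow_fixed t x : X x = 0 -> phi t x = x.
Proof.
move=> X0; have [A A0 hA] := Cinf_lipschitz cX.
have d s : is_derive s (1 : R) (fun s => phi s x - x) (X (phi s x) - 0).
  exact: (is_deriveB (is_derive_flow s x) (is_derive_cst x s 1)).
apply/eqP; rewrite -subr_eq0; apply/eqP.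
apply: (gronwall_eq0 d (A := A)); last by rewrite flow0 subrr.
by move=> s; rewrite -X0 hA.
Qed.

(** Explicit formulas replace an existence theorem: X(phi_t(x)) / X(x) where X(x) <> 0, and an
    exponential at a zero of X, where the flow stands still. *)
Lemma variational_solution x : exists M : R -> R, M 0 = 1 /\
  forall t, is_derive t (1 : R) M (derive1 X (phi t x) * M t).
Proof.
have [X0|X0] := eqVneq (X x) 0.
  exists (fun t => expR (t * derive1 X x)); split; first by rewrite mul0r expR0.
  move=> t; rewrite flow_fixed//.
  have dl : is_derive t (1 : R) (fun t => t * derive1 X x) (derive1 X x).
    apply: (is_derive_eq (is_deriveM (is_derive_id t (1 : R)) (is_derive_cst (derive1 X x) t 1))).
    by rewrite /GRing.scale/=; ring.
  have de := @is_derive1_comp R expR (fun t => t * derive1 X x) t _ _ (is_derive_expR _) dl.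
  apply: (is_derive_eq de).
  by rewrite mulrC.
exists (fun t => (X x)^-1 * X (phi t x)); split; first by rewrite flow0 mulVf.
move=> t; have d1 := is_derive1_comp (Cinf_derive (phi t x) cX) (is_derive_flow t x).
apply: (is_derive_eq (is_deriveZ ((X x)^-1) d1)).
by rewrite /GRing.scale/=; ring.
Qed.

Lemma taylor1_Cinf : exists2 B : R, 0 <= B & forall a b,
  `|X b - X a - derive1 X a * (b - a)| <= B * (b - a) ^+ 2.
Proof.
have [B B0 hB] := Cinf_lipschitz (Cinf_derive1 cX); exists B => // a b.
have cXX := continuous_subspaceT (Cinf_continuous cX).
have [c [hc e]] : exists c, `|c - a| <= `|b - a| /\ X b - X a = derive1 X c * (b - a).
  have [ab|/ltW ab] := leP a b.
    have [c + e] := @MVT_segment R X (derive1 X) a b ab (fun x _ => Cinf_derive x cX) (cXX _).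
    rewrite in_itv/= => /andP[c1 c2]; exists c; split=> //.
    by rewrite !ger0_norm ?subr_ge0// lerD2r.
  have [c + e] := @MVT_segment R X (derive1 X) b a ab (fun x _ => Cinf_derive x cX) (cXX _).
  rewrite in_itv/= => /andP[c1 c2]; exists c; split; last first.
    by rewrite -[LHS]opprB e -mulrN opprB.
  by rewrite !ler0_norm ?subr_le0// lerN2 lerD2r.
rewrite e -mulrBl normrM expr2 -[X in _ <= _ * X]ger0_norm -?expr2 ?sqr_ge0//.
rewrite normrX expr2 mulrA ler_wpM2r//.
by rewrite (le_trans (hB _ _))// ler_wpM2l.
Qed.

Lemma flow_derive x : exists M : R -> R, [/\ M 0 = 1, is_derive 0 (1 : R) M (derive1 X x) &
  forall t, 0 <= t <= 1 -> derive1 (phi t) x = M t].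
Proof.
have [M [M0 dM]] := variational_solution x; exists M; split=> //.
  by have := dM 0; rewrite flow0 M0 mulr1.
have [A A0 hA] := flow_lipschitz; have [B B0 hB] := taylor1_Cinf.
have [N N0 hN] := periodic_bounded (Cinf_continuous (Cinf_derive1 cX)) (Cinf_periodic (Cinf_derive1 cX)).
(* The Taylor remainder of X along two trajectories is B d^2, and their distance d is at most e^A
   |h| for times up to 1. *)
pose D := B * expR (A * 1) ^+ 2; have D0 : 0 <= D by rewrite mulr_ge0 ?sqr_ge0.
move=> t /andP[t0 t1]; rewrite derive1E; apply: derive_val.
apply: (@is_derive_quadratic _ _ _ _ (expR (2 * N + D))) => h.
(* Gronwall for e^2 + h^4, where e is the linearisation error, gives e = O(h^2). *)
pose e s := phi s (x + h) - phi s x - M s * h.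
pose e' s := X (phi s (x + h)) - X (phi s x) - derive1 X (phi s x) * M s * h.
have de s : is_derive s (1 : R) e (e' s).
  apply: is_deriveB; first by apply: is_deriveB; exact: is_derive_flow.
  apply: (is_derive_eq (is_deriveM (dM s) (is_derive_cst h s 1))).
  by rewrite /GRing.scale/=; ring.
have be s : 0 <= s <= t -> `|e' s| <= D * h ^+ 2 + N * `|e s|.
  move=> /andP[s0 st]; set d := phi s (x + h) - phi s x.
  have -> : e' s = (X (phi s (x + h)) - X (phi s x) - derive1 X (phi s x) * d) +
      derive1 X (phi s x) * e s by rewrite /e' /e /d; ring.
  rewrite (le_trans (ler_normD _ _))// lerD//; last by rewrite normrM ler_wpM2r.
  rewrite (le_trans (hB _ _))// /D -mulrA ler_wpM2l// -exprMn.
  rewrite -[leLHS]real_normK ?num_real// -[leRHS]real_normK ?num_real//.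
  apply: ler_sqr_mono => //; rewrite normrM [`|expR _|]ger0_norm ?expR_ge0//.
  have [h1 _] := hA s (x + h) x s0; rewrite (le_trans h1)// addrC addKr.
  rewrite ler_wpM2r// ler_expR ler_wpM2l//; exact: le_trans t1.
have dE s : is_derive s (1 : R) (fun s => e s * e s + h ^+ 4) (2 * (e s * e' s) + 0).
  have d1 := is_deriveD (is_deriveM (de s) (de s)) (is_derive_cst (h ^+ 4) s 1).
  by apply: (is_derive_eq d1); rewrite /GRing.scale/=; ring.
have := gronwall dE (c := 2 * N + D) _ t0; move=> /(_ _)/wrap[|].
  move=> s st; rewrite addr0.
  have b1 : e s * e' s <= `|e s| * (D * h ^+ 2 + N * `|e s|).
    by rewrite (le_trans (ler_norm _))// normrM ler_wpM2l// be.
  have n2 : e s * e s = `|e s| ^+ 2 by rewrite real_normK ?num_real// expr2.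
  have n4 : h ^+ 4 = (h ^+ 2) ^+ 2 by rewrite -exprM.
  rewrite n2 n4; move: b1; have : 0 <= h ^+ 2 by exact: sqr_ge0.
  move: (e s * e' s) (h ^+ 2) (`|e s|) (normr_ge0 (e s)) => z y a a0 y0 zb.
  apply: (@le_trans _ _ (2 * (a * (D * y + N * a)))); first by rewrite ler_wpM2l.
  rewrite -subr_ge0 [leRHS](_ : _ = 2 * N * y ^+ 2 + D * (a - y) ^+ 2); last by ring.
  by rewrite addr_ge0// mulr_ge0 ?sqr_ge0 ?mulr_ge0.
rewrite {2 3}/e !flow0 M0 mul1r (_ : x + h - x - h = 0); last by ring.
rewrite mul0r add0r => hE.
apply: normr_le_of_sqr; first by rewrite mulr_ge0 ?expR_ge0 ?sqr_ge0.
have E1 : 1 <= expR (2 * N + D) by rewrite -expR0 ler_expR addr_ge0// mulr_ge0.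
apply: (@le_trans _ _ (h ^+ 4 * expR ((2 * N + D) * t))).
  rewrite (le_trans _ hE)// -[leLHS]addr0 lerD ?exprn_even_ge0//.
apply: (@le_trans _ _ (h ^+ 4 * expR (2 * N + D))).
  rewrite ler_wpM2l ?exprn_even_ge0// ler_expR ler_piMr// addr_ge0// mulr_ge0//.
rewrite exprMn -exprM mulrC ler_wpM2r ?exprn_even_ge0//.
by rewrite expr2 ler_peMr// (le_trans _ E1).
Qed.

Lemma flow_continuous t : 0 <= t -> continuous (phi t).
Proof.
move=> t0 x; have [A A0 hA] := flow_lipschitz.
apply/cvgrPdist_lt => e e0; near=> y.
have [h _] := hA t x y t0; rewrite (le_lt_trans h)// mulrC -ltr_pdivlMr ?expR_gt0//.
near: y; apply/nbhs_ballP; exists (e / expR (A * t)) => //=.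
by rewrite divr_gt0 ?expR_gt0.
Unshelve. all: by end_near. Qed.

Lemma ae_flow (P : R -> Prop) t : 0 <= t ->
  {ae @lebesgue_measure R, forall x, P x} -> {ae @lebesgue_measure R, forall x, P (phi t x)}.
Proof.
move=> t0; have [A A0 hA] := flow_lipschitz.
apply: (ae_comp (expR_gt0 (- (A * t))) (flow_continuous t0)) => x y.
by have [] := hA t x y t0.
Qed.

End flow.

(** * Differentiating the invariance *)

Section sequential_calculus.
Context {R : realType}.

Lemma cvg_row (m : nat) (p : nat -> 'rV[R]_m) (q : 'rV[R]_m) :
  (forall j, p n 0 j @[n --> \oo] --> q 0 j) -> p n @[n --> \oo] --> q.
Proof.
move=> h; rewrite (row_sum_delta q).
rewrite (_ : p = fun n => \sum_j p n 0 j *: delta_mx 0 j); last first.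
  by apply/funext => n; exact: row_sum_delta.
elim: (index_enum _) => [|j s ih].
  by under eq_fun do rewrite big_nil; rewrite big_nil; exact: cvg_cst.
under eq_fun do rewrite big_cons; rewrite big_cons.
by apply: cvgD => //; apply: cvgZr_tmp; exact: h.
Qed.

Lemma is_derive_seq (f : R -> R) (d : R) (t : nat -> R) : is_derive 0 (1 : R) f d ->
  (forall n, t n != 0) -> t n @[n --> \oo] --> 0 ->
  (f (t n) - f 0) / t n @[n --> \oo] --> d.
Proof.
move=> df tn0 t0; have c : (fun h => h^-1 *: ((f \o shift 0) (h *: 1) - f 0)) @ 0^' --> d.
  have e := @ex_derive _ _ _ _ _ _ _ df; have <- := @derive_val _ _ _ _ _ _ _ df.
  exact: e.
have t0' : t n @[n --> \oo] --> 0^'.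
  move=> A hA; have h : \forall n \near \oo, t n != 0 -> A (t n) := t0 _ hA.
  suff : \forall n \near \oo, A (t n) by [].
  by apply: filterS h => n; apply.
have -> : (fun n => (f (t n) - f 0) / t n) =
    (fun h => h^-1 *: ((f \o shift 0) (h *: 1) - f 0)) \o t.
  by apply/funext => n /=; rewrite /GRing.scale/= mulr1 addr0 mulrC.
exact: cvg_comp t0' c.
Qed.

Variables (m : nat) (L : 'rV[R]_m * 'rV[R]_m -> R).
Hypothesis hL : Ck 2 L.

Lemma Ck_continuous : continuous L.
Proof. by case: hL. Qed.

Lemma Ck_derive_continuous v : continuous (fun p => 'D_v L p).
Proof. by have [_ /(_ v)[_ []]] := hL. Qed.

Lemma is_derive_line (z v : 'rV[R]_m * 'rV[R]_m) (s : R) :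
  is_derive s (1 : R) (fun s => L (z + s *: v)) ('D_v L (z + s *: v)).
Proof.
have [_ /(_ v)[dL _]] := hL.
have E : (fun h : R => h^-1 *: (((fun s => L (z + s *: v)) \o shift s) (h *: 1) - L (z + s *: v))) =
    (fun h : R => h^-1 *: ((L \o shift (z + s *: v)) (h *: v) - L (z + s *: v))).
  apply/funext => h /=; congr (_ *: (L _ - _)).
  by rewrite scalerDl /GRing.scale/= mulr1 addrCA addrC.
apply: DeriveDef; first by rewrite /derivable E; exact: dL.
by rewrite /derive E.
Qed.

Lemma partial_mvt (z v : 'rV[R]_m * 'rV[R]_m) (h : R) :
  exists th : R, `|th| <= `|h| /\ L (z + h *: v) - L z = 'D_v L (z + th *: v) * h.
Proof.
have cl : {within `[0, h], continuous (fun s => L (z + s *: v))}.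
  exact: continuous_subspaceT (is_derive_continuous (is_derive_line z v)).
have cl' : {within `[h, 0], continuous (fun s => L (z + s *: v))}.
  exact: continuous_subspaceT (is_derive_continuous (is_derive_line z v)).
have [h0|/ltW h0] := leP 0 h.
  have [c + e] := MVT_segment h0 (fun x _ => is_derive_line z v x) cl.
  rewrite in_itv/= => /andP[c1 c2]; exists c; split.
    by rewrite !ger0_norm.
  by rewrite scale0r addr0 subr0 in e.
have [c + e] := MVT_segment h0 (fun x _ => is_derive_line z v x) cl'.
rewrite in_itv/= => /andP[c1 c2]; exists c; split.
  by rewrite !ler0_norm// lerN2.
by rewrite scale0r addr0 sub0r mulrN in e; rewrite -[LHS]opprB e opprK.
Qed.

(* Both arguments of [hp] share the first component [W n], so only the derivative in the second one appears. *)
Lemma chain_rule_seq (W p q : nat -> 'rV[R]_m) (W0 P0 tau : 'rV[R]_m) (t M : nat -> R) (a : R) :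
  (forall n, t n != 0) -> t n @[n --> \oo] --> 0 ->
  W n @[n --> \oo] --> W0 -> q n @[n --> \oo] --> P0 ->
  (forall j, (p n 0 j - q n 0 j) / t n @[n --> \oo] --> tau 0 j) ->
  (M n - 1) / t n @[n --> \oo] --> a ->
  (forall n, L (W n, p n) = L (W n, q n) * M n) ->
  \sum_j gradp L W0 P0 0 j * tau 0 j = L (W0, P0) * a.
Proof.
move=> tn0 t0 W0' q0 pq Ma hp.
have pq0 j : p n 0 j - q n 0 j @[n --> \oo] --> 0.
  have -> : (fun n => p n 0 j - q n 0 j) = (fun n => (p n 0 j - q n 0 j) / t n * t n).
    by apply/funext => n; rewrite divfK.
  by rewrite -(mulr0 (tau 0 j)); apply: cvgM => //; exact: pq.
have q0j j : q n 0 j @[n --> \oo] --> P0 0 j.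
  exact: (cvg_comp _ _ q0 (@coord_continuous _ _ _ 0 j P0)).
(* Hybrid points turn q into p one coordinate at a time, so that the mean value theorem is only used
   along coordinate directions and continuity of the partial derivatives suffices. *)
pose hyb n (i : nat) : 'rV[R]_m := \row_j (if (j < i)%N then p n 0 j else q n 0 j).
have hyb0 n : hyb n 0%N = q n by apply/rowP => j; rewrite mxE.
have hybm n : hyb n m = p n by apply/rowP => j; rewrite mxE ltn_ord.
pose v (i : 'I_m) : 'rV[R]_m * 'rV[R]_m := (0, delta_mx 0 i).
have hybS n (i : 'I_m) : (W n, hyb n i.+1) = (W n, hyb n i) + (p n 0 i - q n 0 i) *: v i.
  congr (_, _); first by rewrite /= scaler0 addr0.
  apply/rowP => j; rewrite /= !mxE eqxx/=; have [->|ji] := eqVneq j i.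
    by rewrite ltnSn ltnn mulr1 addrCA subrr addr0.
  by rewrite mulr0 addr0 ltnS leq_eqVlt (inj_eq val_inj) (negbTE ji).
have hth n (i : 'I_m) : exists th : R, `|th| <= `|p n 0 i - q n 0 i| /\
    L (W n, hyb n i.+1) - L (W n, hyb n i) = 'D_(v i) L ((W n, hyb n i) + th *: v i) * (p n 0 i - q n 0 i).
  by rewrite hybS; exact: partial_mvt.
pose th n i := projT1 (cid (hth n i)).
have thP n i : `|th n i| <= `|p n 0 i - q n 0 i| /\
    L (W n, hyb n i.+1) - L (W n, hyb n i) = 'D_(v i) L ((W n, hyb n i) + th n i *: v i) * (p n 0 i - q n 0 i).
  exact: (projT2 (cid (hth n i))).
have th0 i : th n i @[n --> \oo] --> 0.
  apply/norm_cvg0P; apply: (@squeeze_cvgr _ _ _ _ (fun=> 0) (fun n => `|p n 0 i - q n 0 i|)).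
  - by near=> n; rewrite normr_ge0 (thP n i).1.
  - exact: cvg_cst.
  - by have h := cvg_norm (pq0 i); rewrite normr0 in h; exact: h.
have hyb_cvg (i : nat) : hyb n i @[n --> \oo] --> P0.
  apply: cvg_row => j; under eq_fun do rewrite mxE.
  have [ji|ij] := boolP (j < i)%N; last exact: q0j.
  have -> : (fun n => p n 0 j) = (fun n => (p n 0 j - q n 0 j) + q n 0 j).
    by apply/funext => n; rewrite subrK.
  by have h := cvgD (pq0 j) (q0j j); rewrite add0r in h; exact: h.
have arg (i : 'I_m) : (W n, hyb n i) + th n i *: v i @[n --> \oo] --> (W0, P0).
  have -> : (fun n => (W n, hyb n i) + th n i *: v i) = (fun n => (W n, hyb n i + th n i *: delta_mx 0 i)).
    by apply/funext => n; congr (_, _); rewrite /= scaler0 addr0.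
  have h2 : hyb n i + th n i *: delta_mx 0 i @[n --> \oo] --> P0.
    rewrite -[P0]addr0; apply: cvgD; first exact: hyb_cvg.
    by rewrite -(scale0r (delta_mx 0 i)); apply: cvgZr_tmp; exact: th0.
  exact: (cvg_pair W0' h2).
have tel n : L (W n, p n) - L (W n, q n) = \sum_(i < m) (L (W n, hyb n i.+1) - L (W n, hyb n i)).
  rewrite -(big_mkord xpredT (fun i => L (W n, hyb n i.+1) - L (W n, hyb n i))).
  by rewrite telescope_sumr// hyb0 hybm.
have l1 : (L (W n, p n) - L (W n, q n)) / t n @[n --> \oo] --> \sum_j gradp L W0 P0 0 j * tau 0 j.
  under eq_fun do rewrite tel mulr_suml.
  apply: cvg_bigsum => i; under eq_fun => n do rewrite (thP n i).2 -mulrA.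
  apply: cvgM; last exact: pq.
  rewrite /gradp mxE.
  exact: (cvg_comp _ _ (arg i) (@Ck_derive_continuous (v i) (W0, P0))).
have l2 : (L (W n, p n) - L (W n, q n)) / t n @[n --> \oo] --> L (W0, P0) * a.
  have -> : (fun n => (L (W n, p n) - L (W n, q n)) / t n) =
      (fun n => L (W n, q n) * ((M n - 1) / t n)).
    by apply/funext => n; rewrite hp; ring.
  apply: cvgM => //.
  have c : (W n, q n) @[n --> \oo] --> (W0, P0) by exact: (cvg_pair W0' q0).
  exact: (cvg_comp _ _ c (@Ck_continuous (W0, P0))).
exact: (cvg_unique _ l1 l2).
Unshelve. all: by end_near. Qed.

End sequential_calculus.

(** * The identity for trigonometric polynomials *)

Section flow_derivative.
Context {R : realType}.
Variables (K : R -> R) (hK : is_K14 K) (X : R -> R) (phi : R -> R -> R).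
Hypotheses (cX : Cinf X) (hphi : is_flow X phi).
Implicit Types (v : R -> R).

Lemma is_fraclap_trig s (c : int -> R) : uniq s ->
  is_fraclap 4^-1 (trig s c) (trig s (fun k => lam k * c k)).
Proof.
move=> us; apply/is_fraclapP; first exact: sqint_trig.
split; first by apply: sqint_L2; [exact: trig_periodic|exact: sqint_trig].
by move=> k; rewrite !hc_trig//; case: ifP; rewrite ?mulr0.
Qed.

(** Differentiation reverses the frequency, but [lam] is even, so the two operators commute. *)
Lemma is_fraclap_trig_derive s (c : int -> R) : uniq s ->
  is_fraclap 4^-1 (derive1 (trig s c)) (derive1 (trig s (fun k => lam k * c k))).
Proof.
move=> us; have c1 := Cinf_trig s c; have c2 := Cinf_trig s (fun k => lam k * c k).
apply/is_fraclapP; first by apply: continuous_sqint; exact: Cinf_continuous (Cinf_derive1 c1).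
split.
  apply: sqint_L2; first exact: Cinf_periodic (Cinf_derive1 c2).
  by apply: continuous_sqint; exact: Cinf_continuous (Cinf_derive1 c2).
move=> k; rewrite !Cinf_hc_derive1// !hc_trig// lamN; case: ifP => _; rewrite ?mulr0//.
by rewrite mulrCA.
Qed.

Lemma LamK_ae C v g : lips C v -> periodic2pi v -> is_fraclap 4^-1 v g ->
  aec (fun x => LamK K v x = g x).
Proof.
move=> lv pv h; have sv : sqint v by apply: continuous_sqint; exact: lips_continuous lv.
have [_ h1] := fraclap_ae sv h; have [_ h2] := fraclap_ae sv (LamK_fraclap hK lv pv).
by apply: aecS2 h1 h2 => x _ -> <-.
Qed.

Lemma comp_flow_lips v t : Cinf v -> 0 <= t -> exists2 C : R, lips C (v \o phi t) & periodic2pi (v \o phi t).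
Proof.
move=> cv t0; have [c c0 lc] := Cinf_lipschitz cv; have [A A0 hA] := flow_lipschitz cX hphi.
have pp : periodic2pi (v \o phi t) by move=> x /=; rewrite (flow_shift cX hphi) (Cinf_periodic cv).
exists (4 * (c * expR (A * t))) => //.
apply: lips_of_lipschitz => //; first by rewrite mulr_ge0 ?expR_ge0.
move=> x y /=; rewrite (le_trans (lc _ _))// -mulrA ler_wpM2l//.
by have [] := hA t x y t0.
Qed.

Lemma is_derive_comp_flow v s x : Cinf v ->
  is_derive s (1 : R) (fun s => v (phi s x)) (X (phi s x) * derive1 v (phi s x)).
Proof.
move=> cv; have d := is_derive1_comp (Cinf_derive (phi s x) cv) (is_derive_flow hphi s x).
by apply: (is_derive_eq d); rewrite mulrC.
Qed.

(** Dominated convergence under the singular integral: the difference quotients in time are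
    Lipschitz in space uniformly in n, so their increments times K are bounded by a multiple of
    [kap]. *)
Lemma LamK_flow_cvg v (t : nat -> R) x : Cinf v -> (forall n, 0 < t n <= 1) ->
  t n @[n --> \oo] --> 0 ->
  (LamK K (v \o phi (t n)) x - LamK K v x) / t n @[n --> \oo] -->
  LamK K (fun y => X y * derive1 v y) x.
Proof.
move=> cv t01 t0; have cXv := CinfM cX (Cinf_derive1 cv).
have tp n : 0 < t n by case/andP: (t01 n).
have tn0 n : t n != 0 by rewrite gt_eqF.
have [B B0 hB] := Cinf_lipschitz cXv; have [A A0 hA] := flow_lipschitz cX hphi.
have [C lv] := Cinf_lips cv; have [C' lXv] := Cinf_lips cXv.
pose g n y := (v (phi (t n) y) - v y) / t n.
pose G := 4 * (B * expR (A * 1)).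
have lg n : lips G (g n).
  apply: lips_of_lipschitz; first by rewrite mulr_ge0 ?expR_ge0.
    by move=> y; rewrite /g (flow_shift cX hphi) !(Cinf_periodic cv).
  (* The mean value theorem in time, applied to the difference of two trajectories, expresses an
     increment of g n through one of X v' at an intermediate time; t n <= 1 makes e^A a uniform
     constant. *)
  move=> y z; have dF s : is_derive s (1 : R) (fun s => v (phi s y) - v (phi s z))
     (X (phi s y) * derive1 v (phi s y) - X (phi s z) * derive1 v (phi s z)).
    exact: (is_deriveB (is_derive_comp_flow s y cv) (is_derive_comp_flow s z cv)).
  have [c + e] := @MVT_segment R _ _ 0 (t n) (ltW (tp n)) (fun x _ => dF x)
    (continuous_subspaceT (is_derive_continuous dF)).
  rewrite in_itv/= !(flow0 hphi) subr0 in e * => /andP[c0 ct].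
  have -> : g n y - g n z = X (phi c y) * derive1 v (phi c y) - X (phi c z) * derive1 v (phi c z).
    apply: (mulIf (tn0 n)); rewrite -e /g; field; exact: tn0.
  rewrite (le_trans (hB _ _))// -mulrA ler_wpM2l//.
  have [h _] := hA c y z c0; rewrite (le_trans h)// ler_wpM2r// ler_expR ler_wpM2l//.
  by rewrite (le_trans ct)//; case/andP: (t01 n).
have E n : (LamK K (v \o phi (t n)) x - LamK K v x) / t n = LamK K (g n) x.
  have [C1 l1 _] := comp_flow_lips cv (ltW (tp n)).
  rewrite /LamK mulrC -cintB; [|exact: (kernel_cintegrable hK x l1)|exact: (kernel_cintegrable hK x lv)].
  rewrite -cintZ; last first.
    by apply: cintegrableB; [exact: (kernel_cintegrable hK x l1)|exact: (kernel_cintegrable hK x lv)].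
  by apply: eq_cint => y _ /=; rewrite /g; ring.
under eq_fun do rewrite E.
have [c c0 hc] := kernel_bound hK.
apply: (@cint_cvg0_dom R (fun n y => (g n x - g n y) * K (x - y))
   (fun y => (X x * derive1 v x - X y * derive1 v y) * K (x - y)) (fun y => G * c * kap (x - y))).
- by move=> n; exact: (kernel_cintegrable hK x (lg n)).
- exact: (kernel_cintegrable hK x lXv).
- by apply: cintegrableZ; exact: (kap_cint x).1.
- have gc y : g n y @[n --> \oo] --> X y * derive1 v y.
    have d := is_derive_comp_flow 0 y cv; rewrite !(flow0 hphi) in d.
    have := is_derive_seq d tn0 t0; rewrite /= (flow0 hphi).
    exact: cvg_trans.
  apply: aecW => y _; apply: cvgM; last exact: cvg_cst.
  by apply: cvgB; exact: gc.
- by apply: aecW => y _ n; exact: hc (lg n) x y.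
Qed.

Lemma Tk_LamK v w x : Cinf v -> Cinf w ->
  Tk K v w x = LamK K (fun y => v y * w y) x - v x * LamK K w x.
Proof.
move=> cv cw; have [C lw] := Cinf_lips cw; have [C' lvw] := Cinf_lips (CinfM cv cw).
rewrite /Tk /LamK -cintZ; last exact: (kernel_cintegrable hK x lw).
rewrite -cintB; [|exact: (kernel_cintegrable hK x lvw)|apply: cintegrableZ; exact: (kernel_cintegrable hK x lw)].
by apply: eq_cint => y _; ring.
Qed.

Variables (m : nat) (L : 'rV[R]_m * 'rV[R]_m -> R).
Hypothesis hL : Ck 2 L.
Hypothesis hinv : forall w : R -> 'rV[R]_m, H12 w ->
  \forall t \near (0 : R),
    {ae @lebesgue_measure R, forall x, circ R x ->
      L (w (phi t x), fraclapv 4^-1 (fun y => w (phi t y)) x) =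
      L (w (phi t x), fraclapv 4^-1 w (phi t x)) * (derive1 (phi t)) x}.

Lemma pointwise_identity s (c : 'I_m -> int -> R) : uniq s ->
  let w x := \row_j trig s (c j) x in
  let p x := \row_j trig s (fun k => lam k * c j k) x in
  aec (fun x => \sum_j gradp L (w x) (p x) 0 j * Tk K X (derive1 (trig s (c j))) x =
    L (w x, p x) * derive1 X x).
Proof.
move=> us w p; have wj j : compj w j = trig s (c j) by apply/funext => x; rewrite /compj mxE.
have hw : H12 w by apply: trig_H12 => j; exists s, (c j).
have [/= d d0 hd] := hinv hw.
have ct j : Cinf (trig s (c j)) := Cinf_trig _ _.
have cp j : Cinf (trig s (fun k => lam k * c j k)) := Cinf_trig _ _.
have [Cl lt] : exists Cl, forall j, lips (Cl j) (trig s (c j)).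
  by exists (fun j => projT1 (cid (Cinf_lips (ct j)))) => j; exact: (projT2 (cid (Cinf_lips (ct j)))).
have [Cl' lt'] : exists Cl, forall j, lips (Cl j) (derive1 (trig s (c j))).
  exists (fun j => projT1 (cid (Cinf_lips (Cinf_derive1 (ct j))))) => j.
  exact: (projT2 (cid (Cinf_lips (Cinf_derive1 (ct j))))).
have pt j : periodic2pi (trig s (c j)) := trig_periodic _ _.
(* Times stay in the neighbourhood of radius d where the invariance holds, and below 1, where
   [flow_derive] applies. *)
pose r := Num.min (d / 2) 1.
have r0 : 0 < r by rewrite lt_min ltr01 divr_gt0.
pose t n := r * n.+1%:R^-1.
have tp n : 0 < t n by rewrite mulr_gt0// invr_gt0.
have t1 n : t n <= r by rewrite ler_piMr ?(ltW r0)// invf_le1// ler1n.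
have t01 n : 0 < t n <= 1 by rewrite tp (le_trans (t1 n))// ge_min lexx orbT.
have td n : t n < d.
  have : t n <= d / 2 by rewrite (le_trans (t1 n))// ge_min lexx.
  by move=> /le_lt_trans; apply; rewrite ltr_pdivrMr// ltr_pMr// ltr1n.
have t0 : t n @[n --> \oo] --> 0.
  by rewrite -(mulr0 r); apply: cvgM; [exact: cvg_cst|exact: cvg_harmonic].
have a1 : aec (fun x => forall n,
    L (w (phi (t n) x), fraclapv 4^-1 (fun y => w (phi (t n) y)) x) =
    L (w (phi (t n) x), fraclapv 4^-1 w (phi (t n) x)) * derive1 (phi (t n)) x).
  apply: aec_foralln => n; apply: hd.
  by rewrite /= sub0r normrN gtr0_norm.
have a2 : aec (fun x => forall n j,
    fraclapv 4^-1 (fun y => w (phi (t n) y)) x 0 j = LamK K (trig s (c j) \o phi (t n)) x).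
  apply: aec_foralln => n; apply: aec_forall_fin => j.
  have [C lc pc] := comp_flow_lips (ct j) (ltW (tp n)).
  have sc : sqint (trig s (c j) \o phi (t n)) by apply: continuous_sqint; exact: lips_continuous lc.
  have [_] := fraclap_ae sc (LamK_fraclap hK lc pc).
  apply: aecS => x _ <-; rewrite mxE; congr (fraclap _ _ _).
  by apply/funext => y; rewrite /compj mxE.
(* The formula for [fraclap] holds almost everywhere on the circle; it is extended by periodicity to
   the line and then transported by phi_(t n). *)
have a3 : aec (fun x => forall n j,
    fraclapv 4^-1 w (phi (t n) x) 0 j = trig s (fun k => lam k * c j k) (phi (t n) x)).
  apply: aec_foralln => n; apply: aec_forall_fin => j.
  have [L2f h] := fraclap_ae (sqint_trig _ _) (is_fraclap_trig (c j) us).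
  have := ae_periodic _ h; move=> /(_ _)/wrap[|ha].
    by move=> x; case: L2f => -> _ _; rewrite trig_periodic.
  have := ae_flow cX hphi (ltW (tp n)) ha.
  by apply: filterS => x hx _; rewrite mxE wj.
have a4 : aec (fun x => forall j, LamK K (trig s (c j)) x = trig s (fun k => lam k * c j k) x).
  by apply: aec_forall_fin => j; apply: LamK_ae (lt j) (pt j) _; exact: is_fraclap_trig.
have a5 : aec (fun x => forall j, LamK K (derive1 (trig s (c j))) x =
    derive1 (trig s (fun k => lam k * c j k)) x).
  apply: aec_forall_fin => j; apply: LamK_ae (lt' j) (Cinf_periodic (Cinf_derive1 (ct j))) _.
  exact: is_fraclap_trig_derive.
apply: aecS2 (aecS2 (fun x _ h1 h2 => conj h1 h2) a1 a2)
  (aecS2 (fun x _ h1 h2 => conj h1 h2) a3 (aecS2 (fun x _ h1 h2 => conj h1 h2) a4 a5)).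
move=> x _ [h1 h2] [h3 [h4 h5]].
have [M [M0 dM hM]] := flow_derive cX hphi x.
have tn0 n : t n != 0 by rewrite gt_eqF.
pose pn n := fraclapv 4^-1 (fun y => w (phi (t n) y)) x.
pose qn n := p (phi (t n) x).
have qE n : fraclapv 4^-1 w (phi (t n) x) = qn n.
  by apply/rowP => j; rewrite h3 /qn mxE.
pose tau : 'rV[R]_m := \row_j Tk K X (derive1 (trig s (c j))) x.
have cphi : phi (t n) x @[n --> \oo] --> x.
  have c0 := is_derive_continuous (fun t => is_derive_flow hphi t x).
  by have := cvg_comp _ _ t0 (c0 0); rewrite (flow0 hphi).
have := @chain_rule_seq R m L hL (fun n => w (phi (t n) x)) pn qn (w x) (p x) tau t (fun n => M (t n)) (derive1 X x) tn0 t0.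
move=> /(_ _ _ _ _ _)/wrap[|||||].
- apply: cvg_row => j; under eq_fun do rewrite mxE; rewrite mxE.
  exact: (cvg_comp _ _ cphi (@continuous_trig _ _ _ x)).
- apply: cvg_row => j; under eq_fun do rewrite mxE; rewrite mxE.
  exact: (cvg_comp _ _ cphi (@continuous_trig _ _ _ x)).
(* The quotient of p_n - q_n splits into those of Lam(w o phi_t) and of (Lam w) o phi_t, with limits
   Lam(X w') and X (Lam w)'; the latter is X Lam(w') by a5. *)
- move=> j; rewrite mxE Tk_LamK//; last exact: Cinf_derive1.
  have l1 := LamK_flow_cvg (x := x) (ct j) t01 t0.
  have dq := is_derive_comp_flow 0 x (cp j); rewrite !(flow0 hphi) in dq.
  have l2 := is_derive_seq dq tn0 t0; rewrite /= (flow0 hphi) in l2.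
  have -> : (fun n => (pn n 0 j - qn n 0 j) / t n) = (fun n =>
     (LamK K (trig s (c j) \o phi (t n)) x - LamK K (trig s (c j)) x) / t n -
     (trig s (fun k => lam k * c j k) (phi (t n) x) - trig s (fun k => lam k * c j k) x) / t n).
    by apply/funext => n; rewrite /pn h2 /qn mxE h4; ring.
  by rewrite h5; exact: cvgB.
- by have := is_derive_seq dM tn0 t0; rewrite M0.
- move=> n; rewrite -qE /pn h1 hM//.
  by have /andP[/ltW -> ->] := t01 n.
move=> <-; apply: eq_bigr => j _; by rewrite [tau _ _]mxE.
Qed.

End flow_derivative.

(** * Passage to the limit *)

Section superposition.
Context {R : realType} (m : nat).

(** Any h is allowed, because a preimage is a countable union of fibres of r. *)
Lemma measurable_countable_comp (T : countType) (V : Type) (r : R -> T) (h : T -> R) :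
  (forall z, measurable [set x | r x = z]) -> measurable_fun [set: R] (h \o r).
Proof.
move=> mr _ A mA; rewrite setTI.
rewrite (_ : _ @^-1` _ = \bigcup_n (if unpickle n is Some z then
    [set x | r x = z /\ A (h z)] else set0)); last first.
  apply/seteqP; split=> [x /= Ax|x [n _]].
    by exists (pickle (r x)) => //; rewrite pickleK.
  by case: (unpickle n) => // z [/= ->].
apply: bigcupT_measurable => n; case: (unpickle n) => [z|]; last exact: measurable0.
have [Az|nAz] := pselect (A (h z)).
  rewrite (_ : [set x | _ /\ _] = [set x | r x = z]); first exact: mr.
  by apply/seteqP; split=> x /= => [[]|].
rewrite (_ : [set x | _ /\ _] = set0); first exact: measurable0.
by apply/seteqP; split=> x // [].
Qed.

Lemma measurable_floor_fiber (h : R -> R) (k : int) : measurable_fun [set: R] h ->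
  measurable [set x | Num.floor (h x) = k].
Proof.
move=> mh; have /(_ measurableT _ (measurable_itv `[(k%:~R : R), (k + 1)%:~R[)) := mh.
rewrite setTI; congr (measurable _); apply/seteqP; split=> x /=; rewrite in_itv/=.
  by move=> h1; apply: floor_def.
by move=> <-; rewrite floor_le floorD1_gt.
Qed.

Lemma floor_approx (y : R) : (Num.floor (n.+1%:R * y))%:~R / n.+1%:R @[n --> \oo] --> y.
Proof.
apply/cvgrPdist_le => e e0; near=> n.
have n0 : 0 < n.+1%:R :> R by [].
have -> : y - (Num.floor (n.+1%:R * y))%:~R / n.+1%:R =
  (n.+1%:R * y - (Num.floor (n.+1%:R * y))%:~R) / n.+1%:R by field.
rewrite normrM normfV (gtr0_norm n0) ler_pdivrMr//.
have h1 := floor_le (n.+1%:R * y); have h2 := floorD1_gt (n.+1%:R * y).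
rewrite ger0_norm ?subr_ge0//; rewrite intrD in h2.
apply: (@le_trans _ _ 1); first by rewrite lerBlDr addrC ltW.
rewrite -ler_pdivrMl// mulr1.
have : e^-1 <= n%:R by near: n; exact: nbhs_infty_ger.
by move=> /le_trans; apply; rewrite ler_nat.
Unshelve. all: by end_near. Qed.

(** Both arguments are rounded down to the grid of mesh 1 / (n + 1): the rounded superposition
    factors through a countable type, and continuity of F gives the pointwise limit. *)
Lemma measurable_superposition (F : 'rV[R]_m * 'rV[R]_m -> R) (a b : R -> 'rV[R]_m) :
  continuous F -> (forall j, measurable_fun [set: R] (compj a j)) ->
  (forall j, measurable_fun [set: R] (compj b j)) ->
  measurable_fun [set: R] (fun x => F (a x, b x)).
Proof.
move=> cF ma mb.
pose fl n (c : R -> 'rV[R]_m) x : 'rV[int]_m := \row_j Num.floor (n.+1%:R * c x 0 j).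
pose gr n (z : 'rV[int]_m) : 'rV[R]_m := \row_j ((z 0 j)%:~R / n.+1%:R).
apply: (@measurable_fun_cvg _ _ _ _ (fun n x => F (gr n (fl n a x), gr n (fl n b x)))).
  move=> n; apply: (@measurable_countable_comp ('rV[int]_m * 'rV[int]_m)%type unit
     (fun x => (fl n a x, fl n b x)) (fun z => F (gr n z.1, gr n z.2))).
  move=> [z z'].
  have mfl (c : R -> 'rV[R]_m) (y : 'rV[int]_m) : (forall j, measurable_fun [set: R] (compj c j)) ->
      measurable [set x | fl n c x = y].
    move=> mc; rewrite (_ : [set x | _] = \bigcap_(j in [set: 'I_m]) [set x | Num.floor (n.+1%:R * compj c j x) = y 0 j]).
      apply: fin_bigcap_measurable => // j _.
      by apply: measurable_floor_fiber; exact: measurable_funM.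
    apply/seteqP; split=> [x /= <- j _|x /= h]; first by rewrite /= mxE.
    by apply/rowP => j; rewrite mxE; exact: h.
  rewrite (_ : [set x | _] = [set x | fl n a x = z] `&` [set x | fl n b x = z']).
    by apply: measurableI; exact: mfl.
  by apply/seteqP; split=> x /= [-> ->].
move=> x _; have gc (c : R -> 'rV[R]_m) : gr n (fl n c x) @[n --> \oo] --> c x.
  by apply: cvg_row => j; under eq_fun do rewrite !mxE; exact: floor_approx.
have c : (gr n (fl n a x), gr n (fl n b x)) @[n --> \oo] --> (a x, b x).
  by exact: (cvg_pair (gc a) (gc b)).
exact: (cvg_comp _ _ c (cF (a x, b x))).
Qed.

End superposition.

(** * Convergence of the commutators of partial sums *)

Section trigonometric_approximation.
Context {R : realType}.
Variables (K : R -> R) (hK : is_K14 K).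

Lemma derive1_trig n (c : int -> R) :
  derive1 (trig (irange n) c) = trig (irange n) (fun k => - k%:~R * c (- k)).
Proof.
apply/funext => x.
have d s : is_derive x (1 : R) (trig s c) (\sum_(k <- s) c k * (k%:~R * cas (- k) x)).
  rewrite /trig; elim: s => [|k s ih].
    by rewrite big_nil; under eq_fun do rewrite big_nil; exact: is_derive_cst.
  rewrite big_cons; under eq_fun do rewrite big_cons.
  exact: (is_deriveD (is_deriveZ (c k) (is_derive_cas k x)) ih).
have dn := d (irange n); rewrite derive1E (@derive_val _ _ _ _ _ _ _ dn) /trig -big_irangeN.
by apply: eq_bigr => k _; rewrite mulrNz opprK; ring.
Qed.

(** The derivative contributes k^2 and the H^(-1/2) weight divides by [qw]; since k^2 <= qw^2, the
    H^(1/2) norm of the polynomial remains. *)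
Lemma Tk_trig_derive_bound v : Cinf v -> exists2 D, 0 <= D & forall n c,
  sqn (Tk K v (derive1 (trig (irange n) c))) <= D * \sum_(k <- irange n) qw k * c k ^+ 2.
Proof.
move=> cv; have [D D0 hD] := Tk_trig_bound hK cv; exists D => // n c.
rewrite derive1_trig (le_trans (hD _ _ (irange_uniq n)))// ler_wpM2l//.
rewrite -(big_irangeN n (fun k => qw k * c k ^+ 2)); apply: ler_sum => k _.
rewrite qwN exprMn mulrA ler_wpM2r ?sqr_ge0//.
rewrite ler_pdivrMl ?qw_gt0// -expr2 qw_sqr sqrrN -[leLHS]real_normK ?num_real//.
by rewrite -/(ja k) lerDr.
Qed.

Lemma TkB v (w w' : R -> R) : Cinf v -> continuous w -> continuous w' ->
  Tk K v (fun x => w x - w' x) = fun x => Tk K v w x - Tk K v w' x.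
Proof.
move=> cv cw cw'; have [C lv] := Cinf_lips cv; apply/funext => x.
have i (f : R -> R) : continuous f -> cintegrable (fun y => f y * ((v x - v y) * K (x - y))).
  move=> cf; have [M hM] := continuous_bounded_circ cf.
  by apply: (Tk_integrable hK x lv (continuous_measurable_fun cf) hM).
rewrite /Tk -cintB; [|exact: i|exact: i].
by apply: eq_cint => y _; ring.
Qed.

Lemma Tk_cauchy v u (M : R) : Cinf v ->
  (forall n, \sum_(k <- irange n) qw k * hc k u ^+ 2 <= M) ->
  L2cauchy (fun n => Tk K v (derive1 (trig (irange n) (hc^~ u)))).
Proof.
move=> cv hM; have [D D0 hD] := Tk_trig_derive_bound cv.
pose P n := \sum_(k <- irange n) qw k * hc k u ^+ 2.
have /cvg_ex[l hl] : cvgn P := sum_qw_cvg hM.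
have key a b : (a <= b)%N ->
    sqn (fun x => Tk K v (derive1 (trig (irange b) (hc^~ u))) x - Tk K v (derive1 (trig (irange a) (hc^~ u))) x)
    <= D * (P b - P a).
  (* The difference of two partial sums is itself a trigonometric polynomial, supported on the
     frequencies between a and b. *)
  move=> ab; pose c k := if k \in irange a then 0 else hc k u.
  have ct n e : Cinf (trig (irange n) e : R -> R) := Cinf_trig _ _.
  have sub k : k \in irange a -> k \in irange b.
    by rewrite !mem_irange => /leq_trans; apply.
  have E (F : int -> R) : \sum_(k <- irange b) F k - \sum_(k <- irange a) F k =
      \sum_(k <- irange b) (if k \in irange a then 0 else F k).
    rewrite (bigID (fun k => k \in irange a))/= addrC.
    have h : perm_eq [seq k <- irange b | k \in irange a] (irange a).
      apply: uniq_perm; [by rewrite filter_uniq// irange_uniq|exact: irange_uniq|].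
      by move=> k; rewrite mem_filter; apply/idP/idP => [/andP[]//|ks]; rewrite ks sub.
    rewrite -[X in _ + X - _]big_filter (perm_big _ h) addrK big_mkcond/=.
    by apply: eq_bigr => k _; case: (k \in irange a).
  have tE : (fun x => trig (irange b) (hc^~ u) x - trig (irange a) (hc^~ u) x) = trig (irange b) c.
    apply/funext => x; rewrite /trig E; apply: eq_bigr => k _.
    by rewrite /c; case: ifP; rewrite ?mul0r.
  have dE : derive1 (trig (irange b) c) = fun x =>
      derive1 (trig (irange b) (hc^~ u)) x - derive1 (trig (irange a) (hc^~ u)) x.
    apply/funext => x; rewrite -tE.
    have d1 := Cinf_derive x (ct b (hc^~ u)); have d2 := Cinf_derive x (ct a (hc^~ u)).
    by have d3 := is_deriveB d1 d2; rewrite [LHS]derive1E (@derive_val _ _ _ _ _ _ _ d3).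
  have cd n : continuous (derive1 (trig (irange n) (hc^~ u))).
    exact: Cinf_continuous (Cinf_derive1 (ct n _)).
  rewrite -(TkB cv (cd b) (cd a)) -dE (le_trans (hD _ _))// ler_wpM2l//.
  rewrite E le_eqVlt; apply/orP; left; apply/eqP; apply: eq_bigr => k _.
  by rewrite /c; case: ifP => // _; rewrite expr0n mulr0.
move=> e e0; have d0 : 0 < e / (D + 1) / 2 by rewrite !divr_gt0// ltr_wpDl.
move/cvgrPdist_le : hl => /(_ _ d0)[n0 _ h0]; exists n0.
suff H a b : (n0 <= a)%N -> (a <= b)%N ->
    sqn (fun x => Tk K v (derive1 (trig (irange b) (hc^~ u))) x - Tk K v (derive1 (trig (irange a) (hc^~ u))) x) <= e.
  move=> a b na nb; case/orP: (leq_total a b) => ab; last exact: H.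
  by rewrite sqnBC; exact: H.
move=> na ab; rewrite (le_trans (key a b ab))//.
have := h0 a na; have := h0 b (leq_trans na ab); rewrite /= !ler_norml => /andP[b1 b2] /andP[a1 a2].
have h : P b - P a <= e / (D + 1).
  by rewrite [e / (D + 1)](splitr (e / (D + 1))); lra.
rewrite (le_trans (ler_wpM2l D0 h))// mulrA ler_pdivrMr ?ltr_wpDl//.
by rewrite mulrC ler_wpM2l ?ltW// ltrDl.
Qed.

(** [fraclap] is a choice, so a witness is needed; Riesz-Fischer supplies it because lam^2 = |k| <=
    qw. *)
Lemma fraclap_H12 u (M : R) : sqint u ->
  (forall n, \sum_(k <- irange n) qw k * hc k u ^+ 2 <= M) ->
  L2 (fraclap 4^-1 u) /\ forall k, hc k (fraclap 4^-1 u) = lam k * hc k u.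
Proof.
move=> su hM; apply/(is_fraclapP _ su).
have [|g [sg pg hg _]] := @riesz_fischer R (fun k => lam k * hc k u) M.
  move=> n; rewrite (le_trans _ (hM n))// ler_sum// => k _.
  rewrite exprMn lam_sqr ler_wpM2r ?sqr_ge0//.
  rewrite -(@ler_pXn2r _ 2) ?nnegrE ?ja_ge0//; last exact: ltW (qw_gt0 _).
  by rewrite qw_sqr lerDr.
apply: (@xgetPex _ _ [set g | is_fraclap 4^-1 u g]); exists g.
by apply/(is_fraclapP _ su); split=> //; exact: sqint_L2.
Qed.

End trigonometric_approximation.

(** * The conservation law *)

Section main_argument.
Context {R : realType} (m : nat).
Implicit Types (q : 'rV[R]_m).

Lemma dotv_ge0 q : 0 <= dotv q q.
Proof. by apply: sumr_ge0 => j _; rewrite -expr2 sqr_ge0. Qed.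

Lemma enorm_sqr q : enorm q ^+ 2 = dotv q q.
Proof. by rewrite sqr_sqrtr// dotv_ge0. Qed.

Lemma enorm_ge0 q : 0 <= enorm q.
Proof. exact: sqrtr_ge0. Qed.

Lemma norm_coord_le_enorm q j : `|q 0 j| <= enorm q.
Proof.
apply: normr_le_of_sqr; first exact: enorm_ge0.
rewrite enorm_sqr /dotv (bigD1 j)//= -expr2 lerDl.
by apply: sumr_ge0 => i _; rewrite -expr2 sqr_ge0.
Qed.

Variables (K : R -> R) (hK : is_K14 K) (L : 'rV[R]_m * 'rV[R]_m -> R) (hL : Ck 2 L).
Variables (C : R).
Hypotheses (hL0 : forall x p, `|L (x, p)| <= C * (1 + enorm p ^+ 2))
  (hL1 : forall x p, enorm (gradp L x p) <= C * (1 + enorm p)).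
Variables (X : R -> R) (hX : Cinf X) (phi : R -> R -> R) (hphi : is_flow X phi).
Hypothesis hinv : forall w : R -> 'rV[R]_m, H12 w ->
  \forall t \near (0 : R),
    {ae @lebesgue_measure R, forall x, circ R x ->
      L (w (phi t x), fraclapv 4^-1 (fun y => w (phi t y)) x) =
      L (w (phi t x), fraclapv 4^-1 w (phi t x)) * (derive1 (phi t)) x}.
Variables (u : R -> 'rV[R]_m) (hu : H12 u).

Let p : R -> 'rV[R]_m := fraclapv 4^-1 u.
Let f x := L (u x, p x).
Let g j x := gradp L (u x) (p x) 0 j.
Let w n j := trig (irange n) (hc^~ (compj u j)) : R -> R.

Let su j : sqint (compj u j) := (H12_bound j hu).1.
Let bu j := (H12_bound j hu).2.

Let pE j : compj p j = fraclap 4^-1 (compj u j).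
Proof. by apply/funext => x; rewrite /compj mxE. Qed.

Let pP j : sqint (compj p j) /\ forall k, hc k (compj p j) = lam k * hc k (compj u j).
Proof.
have [M hM] := bu j; have [L2p h] := fraclap_H12 (su j) hM.
by rewrite pE; split=> //; exact: L2_sqint.
Qed.

Let sp2 : cintegrable (fun x => enorm (p x) ^+ 2).
Proof.
under eq_fun do rewrite enorm_sqr /dotv; apply: cintegrable_sum => j.
by under eq_fun do rewrite -expr2; exact: sqint_sqr (pP j).1.
Qed.

Let if_ : cintegrable f.
Proof.
have ib : cintegrable (fun x => C * (1 + enorm (p x) ^+ 2)).
  by apply: cintegrableZ; apply: cintegrableD => //; exact: cintegrable_cst.
apply: (le_cintegrable _ ib).
  apply: measurable_superposition (Ck_continuous hL) _ _ => j; first exact: (su j).1.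
  exact: (pP j).1.1.
by move=> x _; rewrite (le_trans (hL0 _ _))// ler_norm.
Qed.

Let sg j : sqint (g j).
Proof.
have mg : measurable_fun [set: R] (g j).
  have -> : g j = fun x => 'D_((0, delta_mx 0 j) : 'rV[R]_m * 'rV[R]_m) L (u x, p x).
    by apply/funext => x; rewrite /g mxE.
  apply: (measurable_superposition (F := fun z => 'D_((0, delta_mx 0 j) : 'rV[R]_m * 'rV[R]_m) L z)).
  - exact: (Ck_derive_continuous hL).
  - by move=> i; exact: (su i).1.
  - by move=> i; exact: (pP i).1.1.
split=> //; apply: (cintegrable_int (f := fun x => g j x ^+ 2)).
(* The factor 2 comes from (1 + r)^2 <= 2 (1 + r^2) with r = |p(x)|. *)
have ib : cintegrable (fun x => C ^+ 2 * 2 * (1 + enorm (p x) ^+ 2)).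
  by apply: cintegrableZ; apply: cintegrableD => //; exact: cintegrable_cst.
apply: (le_cintegrable _ ib); first exact: measurable_funX.
move=> x _; rewrite ger0_norm ?sqr_ge0// [leRHS]ger0_norm; last first.
  by apply: mulr_ge0; [apply: mulr_ge0 => //; exact: sqr_ge0|apply: addr_ge0 => //; exact: sqr_ge0].
have h := le_trans (norm_coord_le_enorm _ j) (hL1 (u x) (p x)).
rewrite -(real_normK (num_real (g j x))).
apply: le_trans (ler_sqr_mono (normr_ge0 _) h) _.
rewrite exprMn -mulrA ler_wpM2l ?sqr_ge0//.
have := sqr_ge0 (1 - enorm (p x)); rewrite sqrrB sqrrD expr1n; lra.
Qed.

Let cw n j : Cinf (w n j). Proof. exact: Cinf_trig. Qed.
Let cdw n j : continuous (derive1 (w n j)) := Cinf_continuous (Cinf_derive1 (cw n j)).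

(** As u' is only a distribution, its commutator with v is obtained as the L^2 limit along the
    partial sums. *)
Let Tk_limit v j : Cinf v -> exists2 c, sqint c & L2cvg (fun n => Tk K v (derive1 (w n j))) c.
Proof.
move=> cv; have [M hM] := bu j.
have [|c [sc cc _]] := L2_complete _ (Tk_cauchy hK cv hM); last by exists c.
by move=> n; apply: (sqint_Tk_continuous hK cv); exact: cdw.
Qed.

Let limit_identity (c : 'I_m -> R -> R) : (forall j, sqint (c j)) ->
  (forall j, L2cvg (fun n => Tk K X (derive1 (w n j))) (c j)) ->
  aec (fun x => \sum_j g j x * c j x = f x * derive1 X x).
Proof.
move=> sc cc.
pose wp n j := trig (irange n) (fun k => lam k * hc k (compj u j)) : R -> R.
have wpE n j : wp n j = trig (irange n) (hc^~ (compj p j)).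
  by apply/funext => x; apply: eq_bigr => k _; rewrite (pP j).2.
(* The partial sums of u, those of Lam u and the commutators form one finite family, so that a
   single subsequence converges almost everywhere for all of them. *)
pose F (i : 'I_m + ('I_m + 'I_m)) n := match i with
  inl j => w n j | inr (inl j) => wp n j | inr (inr j) => Tk K X (derive1 (w n j)) end.
pose G (i : 'I_m + ('I_m + 'I_m)) := match i with
  inl j => compj u j | inr (inl j) => compj p j | inr (inr j) => c j end.
have [s [_ hs]] : exists s : nat -> nat, (forall j, (j <= s j)%N) /\
    forall i, aec (fun x => F i (s j) x @[j --> \oo] --> G i x).
  apply: L2cvg_subseq_ae.
  - move=> [j|[j|j]] n; [exact: sqint_trig|exact: sqint_trig|].
    by apply: (sqint_Tk_continuous hK hX); exact: cdw.
  - by move=> [j|[j|j]]; [exact: su|exact: (pP j).1|exact: sc].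
  - move=> [j|[j|j]]; [exact: trig_cvg| |exact: cc].
    rewrite /F/=; under eq_fun do rewrite wpE.
    exact: trig_cvg (pP j).1.
have hid : aec (fun x => forall n, \sum_j gradp L (\row_j w n j x) (\row_j wp n j x) 0 j *
    Tk K X (derive1 (w n j)) x = L (\row_j w n j x, \row_j wp n j x) * derive1 X x).
  apply: aec_foralln => n.
  exact: (pointwise_identity hK hX hphi hL hinv (fun j => hc^~ (compj u j)) (irange_uniq n)).
apply: aecS2 (aec_forall_fin hs) hid => x _ hx hn.
have w0 : \row_j w (s n) j x @[n --> \oo] --> u x.
  by apply: cvg_row => j; under eq_fun do rewrite mxE; exact: (hx (inl j)).
have p0 : \row_j wp (s n) j x @[n --> \oo] --> p x.
  by apply: cvg_row => j; under eq_fun do rewrite mxE; exact: (hx (inr (inl j))).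
have wp0 : (\row_j w (s n) j x, \row_j wp (s n) j x) @[n --> \oo] --> (u x, p x).
  by exact: (cvg_pair w0 p0).
have l1 : \sum_j gradp L (\row_j w (s n) j x) (\row_j wp (s n) j x) 0 j *
    Tk K X (derive1 (w (s n) j)) x @[n --> \oo] --> \sum_j g j x * c j x.
  apply: cvg_bigsum => j; apply: cvgM; last exact: (hx (inr (inr j))).
  rewrite /g /gradp mxE; under eq_fun do rewrite mxE.
  exact: (cvg_comp _ _ wp0 (@Ck_derive_continuous _ _ _ hL _ (u x, p x))).
have l2 : L (\row_j w (s n) j x, \row_j wp (s n) j x) * derive1 X x @[n --> \oo] --> f x * derive1 X x.
  apply: cvgM; last exact: cvg_cst.
  exact: (cvg_comp _ _ wp0 (@Ck_continuous _ _ _ hL (u x, p x))).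
have e : (fun n => L (\row_j w (s n) j x, \row_j wp (s n) j x) * derive1 X x) =
    (fun n => \sum_j gradp L (\row_j w (s n) j x) (\row_j wp (s n) j x) 0 j *
      Tk K X (derive1 (w (s n) j)) x) by apply/funext => n; rewrite hn.
rewrite e in l2; exact: (cvg_unique _ l1 l2).
Qed.

Lemma stationarity_transfer :
  distr_eq0
     (distr_add
        (distr_mul (distr_deriv (dist_of f)) X)
        (distr_mul (fracdiv K (fun x => gradp L (u x) (p x))
                 (fun j => distr_deriv (dist_of (compj u j)))) X)) ->
  distr_eq0
    (distr_add
       (distr_deriv (dist_of (fun x => f x * X x)))
       (fracdiv K (fun x => gradp L (u x) (p x))
          (fun j => distr_mul (distr_deriv (dist_of (compj u j))) X))).
Proof.
move=> hstat v cv; have cXv := CinfM hX cv.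
have gE j : compj (fun x => gradp L (u x) (p x)) j = g j by [].
have sa j : sqint (compj (fun x => gradp L (u x) (p x)) j) by rewrite gE.
pose b1 n x : 'rV[R]_m := \row_j derive1 (w n j) x.
pose b2 n x : 'rV[R]_m := \row_j (X x * derive1 (w n j) x).
have b1E n j : compj (b1 n) j = derive1 (w n j) by apply/funext => x; rewrite /compj mxE.
have b2E n j : compj (b2 n) j = fun x => X x * derive1 (w n j) x.
  by apply/funext => x; rewrite /compj mxE.
have Cinf_L21 (h : R -> R) : Cinf h -> L21 h.
  move=> ch; have [M _ hM] := periodic_bounded (Cinf_continuous ch) (Cinf_periodic ch).
  exact: (bounded_L21 (Cinf_periodic ch) (continuous_measurable_fun (Cinf_continuous ch)) hM).
have cb1 n j : Cinf (derive1 (w n j)) := Cinf_derive1 (cw n j).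
have cb2 n j : Cinf (fun x => X x * derive1 (w n j) x) := CinfM hX (cb1 n j).
have sb1 n j : sqint (derive1 (w n j)) := continuous_sqint (Cinf_continuous (cb1 n j)).
have sb2 n j := continuous_sqint (Cinf_continuous (cb2 n j)).
have H1 j : Hnorm2 (- 2^-1) (distr_sub (dist_of (compj (b1 n) j)) (distr_deriv (dist_of (compj u j)))) @[n --> \oo] --> 0%E.
  have [M hM] := bu j.
  have e n : compj (b1 n) j = fun x => 1 * derive1 (w n j) x.
    by rewrite b1E; apply/funext => x; rewrite mul1r.
  under eq_fun do rewrite e.
  apply: (Hnorm2_approx (B := distr_deriv (dist_of (compj u j))) (Cinf_cst (1 : R)) (su j) hM).
  move=> psi _; rewrite /distr_deriv dist_ofE (_ : (fun x => 1 * psi x) = psi)//.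
  by apply/funext => x; rewrite mul1r.
have H2 j : Hnorm2 (- 2^-1) (distr_sub (dist_of (compj (b2 n) j))
    (distr_mul (distr_deriv (dist_of (compj u j))) X)) @[n --> \oo] --> 0%E.
  have [M hM] := bu j; under eq_fun do rewrite b2E.
  exact: (Hnorm2_approx (B := distr_mul (distr_deriv (dist_of (compj u j))) X) hX (su j) hM).
have [c [sc cc]] : exists c : 'I_m -> R -> R, (forall j, sqint (c j)) /\
    forall j, L2cvg (fun n => Tk K X (derive1 (w n j))) (c j).
  have /choice[c hc'] : forall j, exists c, sqint c /\ L2cvg (fun n => Tk K X (derive1 (w n j))) c.
    by move=> j; have [c sc cc] := Tk_limit j hX; exists c.
  by exists c; split=> j; case: (hc' j).
have [d [sd dd]] : exists c : 'I_m -> R -> R, (forall j, sqint (c j)) /\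
    forall j, L2cvg (fun n => Tk K (fun x => X x * v x) (derive1 (w n j))) (c j).
  have /choice[c' hc'] : forall j, exists c, sqint c /\ L2cvg (fun n => Tk K (fun x => X x * v x) (derive1 (w n j))) c.
    by move=> j; have [c' sc' cc'] := Tk_limit j cXv; exists c'.
  by exists c'; split=> j; case: (hc' j).
have [N N0 vN] := periodic_bounded (Cinf_continuous cv) (Cinf_periodic cv).
have mv : measurable_fun [set: R] v := continuous_measurable_fun (Cinf_continuous cv).
have sgv j : sqint (fun x => g j x * v x) by apply: (sqintM (sg j) mv) => x _; exact: vN.
have BkE (h a b : R -> R) : Cinf h -> sqint a -> continuous b -> Bk K h a b = ip a (Tk K h b).
  move=> ch sha cb; have [C' lh] := Cinf_lips ch; have [M hM] := continuous_bounded_circ cb.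
  exact: (Bk_Tk hK lh sha (continuous_measurable_fun cb) hM).
have lim h a (e : 'I_m -> R -> R) : Cinf h -> (forall j, sqint (a j)) -> (forall j, sqint (e j)) ->
    (forall j, L2cvg (fun n => Tk K h (derive1 (w n j))) (e j)) ->
    \sum_j Bk K h (a j) (derive1 (w n j)) @[n --> \oo] --> \sum_j ip (a j) (e j).
  move=> ch sha se he; apply: cvg_bigsum => j.
  under eq_fun => n do rewrite BkE// ipC; rewrite ipC.
  by apply: L2cvg_ip => // n; apply: (sqint_Tk_continuous hK ch); exact: cdw.
have F1 : fracdiv K (fun x => gradp L (u x) (p x)) (fun j => distr_deriv (dist_of (compj u j)))
    (fun x => X x * v x) = \sum_j ip (g j) (d j).
  apply: (fracdiv_eq (b_ := b1) hK cXv sa _ H1); first by move=> n j; rewrite b1E; exact: Cinf_L21.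
  have -> : (fun n => fracdiv0 K (fun x => gradp L (u x) (p x)) (b1 n) (fun x => X x * v x)) =
      (fun n => \sum_j Bk K (fun x => X x * v x) (g j) (derive1 (w n j))).
    apply/funext => n; rewrite (fracdiv0E hK cXv sa); last by move=> j; rewrite b1E.
    by apply: eq_bigr => j _; rewrite b1E.
  exact: lim.
(* It rests on X(y) (v(x) - v(y)) = (X v)(x) - (X v)(y) - v(x) (X(x) - X(y)), whose last factor v(x)
   joins g(x). *)
have F2 : fracdiv K (fun x => gradp L (u x) (p x)) (fun j => distr_mul (distr_deriv (dist_of (compj u j))) X) v =
    \sum_j ip (g j) (d j) - \sum_j ip (fun x => g j x * v x) (c j).
  apply: (fracdiv_eq (b_ := b2) hK cv sa _ H2); first by move=> n j; rewrite b2E; exact: Cinf_L21.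
  have -> : (fun n => fracdiv0 K (fun x => gradp L (u x) (p x)) (b2 n) v) =
      (fun n => \sum_j Bk K (fun x => X x * v x) (g j) (derive1 (w n j)) -
                \sum_j Bk K X (fun x => g j x * v x) (derive1 (w n j))).
    apply/funext => n; rewrite (fracdiv0E hK cv sa); last by move=> j; rewrite b2E.
    rewrite -sumrB; apply: eq_bigr => j _; rewrite b2E gE.
    have [Cx lx] := Cinf_lips hX; have [Cxv lxv] := Cinf_lips cXv.
    have i1 := Bk_integrable hK lxv (sg j) (sb1 n j).
    have i2 := Bk_integrable hK lx (sgv j) (sb1 n j).
    rewrite /Bk -cint2B//; apply: eq_cint2 => x y _ _ /=; ring.
  by apply: cvgB; exact: lim.
have ic j : cintegrable (fun x => g j x * v x * c j x) := sqint_ip (sgv j) (sc j).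
have cX' := Cinf_derive1 hX.
have ifv (h : R -> R) : continuous h -> cintegrable (fun x => f x * h x).
  by move=> ch; exact: cintegrableM_continuous.
(* In this proof the invariance enters only here, through [limit_identity]. *)
have S : \sum_j ip (fun x => g j x * v x) (c j) = cint (fun x => f x * (v x * derive1 X x)).
  rewrite /ip -cint_sum//; apply: eq_cint_ae.
  - by have [] := cintegrable_sum (index_enum _) ic.
  - apply: (ifv (fun x => v x * derive1 X x) _).1 => x.
    by apply: cvgM; [exact: Cinf_continuous|exact: Cinf_continuous cX' x].
  - apply: aecS (limit_identity sc cc) => x _ h.
    rewrite mulrCA -h mulr_sumr; apply: eq_bigr => j _; ring.
have E : - ip f (derive1 (fun x => X x * v x)) + \sum_j ip (g j) (d j) = 0.
  by rewrite -F1; exact: hstat.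
have d1 : derive1 (fun x => X x * v x) = fun x => X x * derive1 v x + v x * derive1 X x.
  apply/funext => x; have dX := Cinf_derive x hX; have dv := Cinf_derive x cv.
  by have dXv := is_deriveM dX dv; rewrite derive1E (@derive_val _ _ _ _ _ _ _ dXv).
have E1 : ip f (derive1 (fun x => X x * v x)) =
    ip (fun x => f x * X x) (derive1 v) + cint (fun x => f x * (v x * derive1 X x)).
  rewrite /ip d1 -cintD.
  - by apply: eq_cint => x _; ring.
  - under eq_fun do rewrite -mulrA.
    apply: ifv => x; apply: cvgM; first exact: Cinf_continuous.
    exact: Cinf_continuous (Cinf_derive1 cv) x.
  - apply: ifv => x.
    by apply: cvgM; [exact: Cinf_continuous|exact: Cinf_continuous cX' x].
have key (a b s : R) : - (a + b) + s = 0 -> - a + (s - b) = 0 by move=> <-; ring.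
rewrite E1 in E; rewrite /distr_add F2 S; exact: key E.
Qed.

End main_argument.

Theorem theorem1p4 (R : realType) (m : nat) (hm : (0 < m)%N)
  (K : R -> R) (hK : is_K14 K)
  (L : 'rV[R]_m * 'rV[R]_m -> R) (hL : Ck 2 L)
  (C : R) (hC : 0 < C)
  (hL0 : forall x p, `|L (x, p)| <= C * (1 + enorm p ^+ 2))
  (hL1 : forall x p, enorm (gradp L x p) <= C * (1 + enorm p))
  (X : R -> R) (hX : Cinf X)
  (phi : R -> R -> R) (hphi : is_flow X phi)
  (hinv : forall w : R -> 'rV[R]_m, H12 w ->
     \forall t \near (0 : R),
       {ae @lebesgue_measure R, forall x, circ R x ->
         L (w (phi t x), fraclapv 4^-1 (fun y => w (phi t y)) x) =
         L (w (phi t x), fraclapv 4^-1 w (phi t x)) * (derive1 (phi t)) x})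
  (u : R -> 'rV[R]_m) (hu : H12 u)
  (hstat : distr_eq0
     (distr_add
        (distr_mul (distr_deriv (dist_of (fun x => L (u x, fraclapv 4^-1 u x)))) X)
        (distr_mul (fracdiv K (fun x => gradp L (u x) (fraclapv 4^-1 u x))
                 (fun j => distr_deriv (dist_of (compj u j)))) X))) :
  distr_eq0
    (distr_add
       (distr_deriv (dist_of (fun x => L (u x, fraclapv 4^-1 u x) * X x)))
       (fracdiv K (fun x => gradp L (u x) (fraclapv 4^-1 u x))
          (fun j => distr_mul (distr_deriv (dist_of (compj u j))) X))).
Proof.
exact: (stationarity_transfer hK hL hL0 hL1 hX hphi hinv hu hstat).
Qed.
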